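(* Fix $p\in(1,\infty)$. Let either $\delta\in[0,1]$ and $D=[\delta,1]$, or $\delta\in[0,1)$ and $D=(\delta,1]$, and let $F:D\to[0,1]$ be concave, nondecreasing, with $F(u)\le u$ for all $u\in D$. Then: (a) there exists a nondoubling metric measure space $\mathfrak Z$ such that $\mathfrak c(p,q,r,\mathfrak Z)<\infty$ if and only if $1/q\in D$ and $1/r\le F(1/q)$; (b) there exists a nondoubling metric measure space $\mathfrak Z'$ such that $\mathfrak c(p,q,r,\mathfrak Z')<\infty$ if and only if $1/q\in D$ and $1/r<F(1/q)$. Here $q,r$ range over $[1,\infty]$ with $1/\infty=0$.
   Context: Metric measure space $(X,\rho,\mu)$: nonempty set, metric, nonnegative Borel measure, every open ball of positive finite measure; doubling means $\mu(B(x,2s))\le C\mu(B(x,s))$ uniformly. Lorentz quasinorm: $d_f(t)=\mu(\{|f|>t\})$, $\|f\|_{p,q}=p^{1/q}(\int_0^\infty(t d_f(t)^{1/p})^q dt/t)^{1/q}$ for $q<\infty$, $\|f\|_{p,\infty}=\sup_{t>0}t d_f(t)^{1/p}$. $\mathcal M^{\rm c}_{\mathfrak X}f(x)=\sup_{s>0}\mu(B(x,s))^{-1}\int_{B(x,s)}|f|d\mu$. $\mathfrak c(p,q,r,\mathfrak X)$ is the smallest $c$ with $\|\mathcal M^{\rm c}_{\mathfrak X}f\|_{p,r}\le c\|f\|_{p,q}$ for all $f\in L^{p,q}(\mathfrak X)$ ($\infty$ if none). *)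

(* Defs.v *)
From HB Require Import structures.
From mathcomp Require Import all_boot all_order all_algebra.
From mathcomp Require Import all_classical all_reals all_analysis.
Set Implicit Arguments. Unset Strict Implicit. Unset Printing Implicit Defensive.
Import Order.TTheory GRing.Theory Num.Theory.
Local Open Scope classical_set_scope.
Local Open Scope ring_scope.

Section MMSDefs.
Context {R : realType}.

Definition rball {T : Type} (rho : T -> T -> R) (x : T) (s : R) : set T :=
  [set y | rho x y < s].

Definition ropen {T : Type} (rho : T -> T -> R) (A : set T) : Prop :=
  forall x, A x -> exists2 s : R, 0 < s & rball rho x s `<=` A.

Record mms := MMS {
  mms_d : measure_display;
  mms_T : measurableType mms_d;
  mms_rho : mms_T -> mms_T -> R;
  mms_mu : {measure set mms_T -> \bar R};
  mms_nonempty : exists x : mms_T, True;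
  mms_rho_ge0 : forall x y, 0 <= mms_rho x y;
  mms_rho_eq0 : forall x y, mms_rho x y = 0 <-> x = y;
  mms_rho_sym : forall x y, mms_rho x y = mms_rho y x;
  mms_rho_tri : forall x y z, mms_rho x z <= mms_rho x y + mms_rho y z;
  mms_borel : @measurable _ mms_T = <<s [set A | ropen mms_rho A] >>;
  mms_ball_pos : forall x s, 0 < s -> (0 < mms_mu (rball mms_rho x s))%E;
  mms_ball_fin : forall x s, 0 < s -> (mms_mu (rball mms_rho x s) < +oo)%E
}.

Definition doubling (Z : mms) : Prop :=
  exists C : R, forall (x : mms_T Z) (s : R), 0 < s ->
    (mms_mu Z (rball (@mms_rho Z) x (2 * s)) <= C%:E * mms_mu Z (rball (@mms_rho Z) x s))%E.

Definition einv (q : \bar R) : R :=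
  match q with
  | r%:E => r^-1
  | _ => 0
  end.

Local Open Scope ereal_scope.

(* outer measure induced by mu (equal to mu on measurable sets) *)
Definition outer (Z : mms) (A : set (mms_T Z)) : \bar R :=
  ereal_inf [set mms_mu Z B | B in [set B | measurable B /\ A `<=` B]].

Definition distf (Z : mms) (g : mms_T Z -> \bar R) (t : R) : \bar R :=
  outer [set x | t%:E < `|g x| ].

Definition lorentz (Z : mms) (p : R) (q : \bar R) (g : mms_T Z -> \bar R) : \bar R :=
  match q with
  | q'%:E =>
      (p `^ q'^-1)%:E *
      (\int[@lebesgue_measure R]_(t in `]0%R, +oo[%classic)
          ((t%:E * distf g t `^ p^-1) `^ q' * (t^-1)%:E)) `^ q'^-1
  | _ => ereal_sup [set t%:E * distf g t `^ p^-1 | t in `]0%R, +oo[%classic]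
  end.

Definition maxc (Z : mms) (f : mms_T Z -> R) (x : mms_T Z) : \bar R :=
  ereal_sup [set (fine (mms_mu Z (rball (@mms_rho Z) x s)))^-1%:E *
                 \int[mms_mu Z]_(y in rball (@mms_rho Z) x s) `|f y|%:E
            | s in `]0%R, +oo[%classic].

Definition inLorentz (Z : mms) (p : R) (q : \bar R) (f : mms_T Z -> R) : Prop :=
  measurable_fun setT f /\ lorentz p q (EFin \o f) < +oo.

Definition mconst (p : R) (q r : \bar R) (Z : mms) : \bar R :=
  ereal_inf [set c%:E | c in [set c : R | (0 <= c)%R /\
     forall f : mms_T Z -> R, inLorentz p q f ->
       lorentz p r (maxc f) <= c%:E * lorentz p q (EFin \o f)]].

End MMSDefs.

(* Main.v *)
Require Import Defs.
From HB Require Import structures.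
From mathcomp Require Import all_boot all_order all_algebra.
From mathcomp Require Import all_classical all_reals all_analysis.
From mathcomp Require Import measurable_realfun zify ring lra.
Set Implicit Arguments. Unset Strict Implicit. Unset Printing Implicit Defensive.
Import Order.TTheory GRing.Theory Num.Theory numFieldNormedType.Exports.
Local Open Scope classical_set_scope.
Local Open Scope ring_scope.

(* The space is a union of groups of equal atoms, placed at mutual distances so large and with
   masses so lacunary that a ball meeting several groups is dominated by the largest of them.  The
   maximal operator then reduces to the averages over a point and its neighbours in lower groups.
   A block of [n1] lower groups, all adjacent to each of [n2] upper groups of relative weight [w],
   contributes [n2^(1/r) w n1^(1 - 1/q)] to the best constant, and contributions of different
   blocks do not add up when [q <= r].  For [n1 = e^b], [n2 = e^a] and [w = e^(-b - c)] the
   contribution is [exp (a v - b u - c)] with [u = 1/q] and [v = 1/r], so that a countable family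
   of blocks makes the maximal operator bounded exactly where a given countable family of linear
   functionals is bounded above.  The multiples [N^2 (v - l u)], [l] running through tangent lines
   of [F] at rational points, together with a functional for the left end of [D], describe the set
   [v <= F u]; adding [N] to each of them makes the inequality strict. *)

(** * Real powers and weak-type sums *)

Section PowR.
Context {R : realType}.
Implicit Types a b q r s t : R.

(** The mass of a group is kept comparable to [(w a)^p], where a is the mass of one atom: the
    function equal to 1/a on the group then has quasinorm comparable to [w] for every q at once.
    Lower groups have [w = 1], and averaging turns the value 1/a on a lower point into 1/a' on a
    point of an upper group with atoms a', so a single lower group is transferred with norm [w]
    whatever q and r are. The exponents enter only through the number of groups: by lacunarity the
    q-th power of the Lorentz quasinorm is comparable to the sum over the groups, while adding [n1]
    functions inside one group costs [n1^(1 - 1/q)]. That last loss must be exact up to a constant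
    independent of [n1], which takes one argument for q <= p and another for q >= p. The hypothesis
    F(u) <= u confines the region to q <= r, where summing over blocks is harmless. The factor N^2
    lets any negative value of a functional absorb the added N, while the value 0 no longer does;
    this is how strictness is encoded. *)

Lemma le_powR r a b : 0 <= r -> 0 <= a -> a <= b -> a `^ r <= b `^ r.
Proof.
move=> r0 a0 ab; apply: ge0_ler_powR => //; rewrite nnegrE //.
exact: le_trans ab.
Qed.

Lemma ge_powR r a b : r <= 0 -> 0 < a -> a <= b -> b `^ r <= a `^ r.
Proof.
move=> r0 a0 ab; rewrite -[r]opprK !(powRN _ (- r)).
rewrite lef_pV2 ?posrE ?powR_gt0 ?(lt_le_trans a0 ab)//.
by apply: le_powR => //; rewrite ?oppr_ge0// ltW.
Qed.

Lemma gt0_powRD a r s : 0 < a -> a `^ (r + s) = a `^ r * a `^ s.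
Proof. by move=> a0; rewrite powRD// (gt_eqF a0) implybT. Qed.

Lemma powR_gt1 a r : 1 < a -> 0 < r -> 1 < a `^ r.
Proof.
move=> a1 r0; have -> : 1 = 1 `^ r :> R by rewrite powR1.
by apply: gt0_ltr_powR; rewrite ?nnegrE// ltW// (lt_trans _ a1).
Qed.

Lemma powRK r a : r != 0 -> 0 <= a -> (a `^ r) `^ r^-1 = a.
Proof. by move=> r0 a0; rewrite -powRrM divff// powRr1. Qed.

Lemma powRVK r a : r != 0 -> 0 <= a -> (a `^ r^-1) `^ r = a.
Proof. by move=> r0 a0; rewrite -powRrM mulVf// powRr1. Qed.

(** Young's inequality for [a ^ r * b ^ (1 - r)] with exponents 1/r and 1/(1 - r), divided by
    [b ^ (1 - r)]. *)
Lemma powR_le_tangent r a b : 0 < r -> r <= 1 -> 0 <= a -> 0 < b ->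
  a `^ r <= b `^ r + r * b `^ (r - 1) * (a - b).
Proof.
move=> r0 r1 a0 b0.
have bE : b * b `^ (r - 1) = b `^ r by rewrite mulr_powRB1// ltW.
have [->|rn1] := eqVneq r 1.
  by rewrite subrr powRr0 !powRr1// ?(ltW b0)//; lra.
have q0 : 0 < 1 - r by rewrite subr_gt0 lt_neqAle rn1.
have := @conjugate_powR R (a `^ r) (b `^ (1 - r)) r^-1 (1 - r)^-1
  (powR_ge0 _ _) (powR_ge0 _ _).
rewrite !invr_gt0 q0 r0 !invrK addrC subrK => /(_ isT isT erefl).
have r10 : 1 - r != 0 by rewrite subr_eq0 eq_sym.
rewrite !powRK ?gt_eqF ?(ltW b0)// => yng.
have bb : b `^ (1 - r) * b `^ (r - 1) = 1.
  have e : 1 - r + (r - 1) = 0 by ring.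
  by rewrite -gt0_powRD// e powRr0.
have := ler_wpM2r (powR_ge0 b (r - 1)) yng.
rewrite -(mulrA (a `^ r)) bb mulr1 => /le_trans; apply.
by rewrite -bE le_eqVlt; apply/orP; left; apply/eqP; ring.
Qed.

(** Young's inequality for [a * b ^ (r - 1)] with exponent [r] and its conjugate, multiplied by
    [r]. *)
Lemma powR_ge_tangent r a b : 1 <= r -> 0 <= a -> 0 < b ->
  b `^ r + r * b `^ (r - 1) * (a - b) <= a `^ r.
Proof.
move=> r1 a0 b0; have r0 : 0 < r by exact: lt_le_trans r1.
have bE : b * b `^ (r - 1) = b `^ r by rewrite mulr_powRB1// ltW.
have [->|rn1] := eqVneq r 1.
  by rewrite subrr powRr0 !powRr1// ?(ltW b0)//; lra.
have r10 : 0 < r - 1 by rewrite subr_gt0 lt_neqAle eq_sym rn1.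
have := @conjugate_powR R a (b `^ (r - 1)) r (r / (r - 1)) a0
  (powR_ge0 _ _) r0 (divr_gt0 r0 r10).
rewrite -powRrM mulrCA divff ?gt_eqF// mulr1 invf_div.
have -> : r^-1 + (r - 1) / r = 1 by rewrite -{1}[r^-1]mul1r -mulrDl addrC subrK divff ?gt_eqF.
move=> /(_ erefl) /(ler_wpM2r (ltW r0)).
rewrite -bE (_ : (_ / r + _) * r = a `^ r + b * b `^ (r - 1) * (r - 1)); last first.
  by field; rewrite gt_eqF.
lra.
Qed.

(** Jensen's inequality: in the sum of the tangent inequalities at the mean [A] the linear terms
    cancel. The tangent needs a positive base point, so [A = 0] is treated apart. *)
Lemma powR_sum_le n (a : 'I_n -> R) r : 1 <= r -> (forall i, 0 <= a i) ->
  (\sum_i a i) `^ r <= n%:R `^ (r - 1) * \sum_i a i `^ r.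
Proof.
move=> r1 a0; have r0 : 0 < r by exact: lt_le_trans r1.
case: n a a0 => [|n] a a0.
  by rewrite !big_ord0 mulr0 powR0// gt_eqF.
have n0 : 0 < n.+1%:R :> R by [].
pose A := (\sum_i a i) / n.+1%:R.
have sA : \sum_i a i = n.+1%:R * A by rewrite /A mulrCA divff ?mulr1// gt_eqF.
have A0 : 0 <= A by rewrite divr_ge0 ?sumr_ge0.
rewrite sA powRM// ?(ltW n0)//.
have [->|An0] := eqVneq A 0.
  by rewrite powR0 ?gt_eqF// mulr0 mulr_ge0 ?powR_ge0// sumr_ge0// => i _; exact: powR_ge0.
have {}A0 : 0 < A by rewrite lt_neqAle eq_sym An0.
have : \sum_(i < n.+1) (A `^ r + r * A `^ (r - 1) * (a i - A)) <= \sum_i a i `^ r.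
  by apply: ler_sum => i _; exact: powR_ge_tangent.
rewrite big_split/= -mulr_sumr sumrB !sumr_const card_ord sA -(mulr_natl (A `^ r)).
rewrite -(mulr_natl A) subrr mulr0 addr0 => le1.
rewrite -(mulr_powRB1 (ltW n0) r0) mulrAC mulrC.
by rewrite ler_wpM2l ?powR_ge0.
Qed.

Lemma powR_add_le a b r : 0 <= r -> 0 <= a -> 0 <= b ->
  (a + b) `^ r <= 2 `^ r * (a `^ r + b `^ r).
Proof.
move=> r0; wlog ab : a b / a <= b.
  move=> H a0 b0; have [ab|/ltW ba] := leP a b; first exact: H.
  by rewrite addrC [X in _ * X]addrC; apply: H.
move=> a0 b0; apply: (@le_trans _ _ ((2 * b) `^ r)).
  by apply: le_powR; rewrite ?addr_ge0//; lra.
by rewrite powRM// ler_wpM2l ?powR_ge0// lerDr powR_ge0.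
Qed.

(* A Hölder inequality for geometric weights in which only an arbitrarily small power of the
   geometric factor is lost. *)
Lemma powR_sum_geo_le r rho : 1 <= r -> 1 < rho ->
  exists2 C, 0 < C & forall n (a : nat -> R), (forall i, 0 <= a i) ->
    (\sum_(i < n) a i) `^ r <= C * \sum_(i < n) rho ^+ i * a i `^ r.
Proof.
move=> r1 rho1; have rho0 : 0 < rho by exact: lt_trans rho1.
pose l := rho `^ (- r^-1); have r0 : 0 < r by exact: lt_le_trans r1.
have l0 : 0 < l by rewrite powR_gt0.
have l1 : l < 1.
  rewrite /l powRN invf_lt1 ?powR_gt0//.
  have -> : 1 = 1 `^ r^-1 :> R by rewrite powR1.
  by apply: gt0_ltr_powR; rewrite ?nnegrE ?invr_gt0// ltW.
have lr : l `^ r = rho^-1 by rewrite /l -powRrM mulNr mulVf ?gt_eqF// powR_inv1 ?ltW.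
have l10 : 0 < 1 - l by rewrite subr_gt0.
pose C := (1 - l) `^ (- r); have C0 : 0 < C by rewrite powR_gt0.
exists C => //; elim=> [|n IH] a a0.
  by rewrite !big_ord0 mulr0 powR0// gt_eqF.
rewrite !big_ord_recl/= expr0 mul1r.
set y := \sum_(i < n) a _.
have y0 : 0 <= y by rewrite sumr_ge0.
(* Either [y] carries at least the share [l] of the total, and [l ^ r = rho^-1] produces the factor
   [rho], or [a 0] carries more than the share [1 - l], which costs the constant [C]. *)
have cv : (a 0%N + y) `^ r <= C * a 0%N `^ r + rho * y `^ r.
  have [h|h] := leP (a 0%N) ((1 - l) * (a 0%N + y)).
    have : a 0%N + y <= l^-1 * y.
      by rewrite ler_pdivlMl//; lra.
    move=> /(le_powR (ltW r0) (addr_ge0 (a0 0%N) y0)) /le_trans; apply.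
    rewrite powRM ?invr_ge0 ?(ltW l0)// -powR_inv1 ?(ltW l0)//.
    rewrite powRAC lr powR_inv1 ?invrK; last by rewrite invr_ge0 ltW.
    by rewrite lerDr mulr_ge0 ?powR_ge0// ltW.
  have : a 0%N + y <= (1 - l)^-1 * a 0%N by rewrite ler_pdivlMl// ltW.
  move=> /(le_powR (ltW r0) (addr_ge0 (a0 0%N) y0)) /le_trans; apply.
  rewrite powRM ?invr_ge0 ?(ltW l10)// -powR_inv1 ?(ltW l10)// powRAC.
  rewrite powR_inv1 ?powR_ge0// -powRN -/C lerDl.
  by rewrite mulr_ge0 ?powR_ge0// ltW.
apply: (le_trans cv); rewrite mulrDr lerD2l.
apply: (@le_trans _ _ (rho * (C * \sum_(i < n) rho ^+ i * a i.+1 `^ r))).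
  by rewrite ler_wpM2l ?(ltW rho0)//; exact: (IH _ (fun i => a0 i.+1)).
rewrite mulrCA ler_wpM2l ?(ltW C0)// mulr_sumr ler_sum// => i _.
by rewrite exprS mulrA.
Qed.

End PowR.

(** * Rearrangement inequalities for finite sums *)

Section Rearr.
Context {R : realType} (I : finType).
Implicit Types (m h f : I -> R) (t : R).

Definition dist m f t : R := \sum_(x | t < f x) m x.

(* Remove a point where [h] is smallest; the tangent inequality for the concave power pays for
   its term. *)
Lemma sum_psi_le m h r (A : {set I}) : 0 < r -> r <= 1 -> (forall x, 0 <= m x) ->
  \sum_(x in A) m x * (\sum_(z in A | h x <= h z) m z) `^ (r - 1) <=
  r^-1 * (\sum_(x in A) m x) `^ r.
Proof.
move=> r0 r1 m0; have rm1 : r - 1 <= 0 by rewrite subr_le0.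
have [k] := ubnP #|A|; elim: k A => // k IH A.
have [->|[a aA]] := set_0Vmem A.
  move=> _; rewrite [X in X <= _]big1 ?mulr_ge0 ?powR_ge0 ?invr_ge0 ?(ltW r0)//.
  by move=> x; rewrite inE.
have [y yA ymin] : exists2 y, y \in A & forall z, z \in A -> h y <= h z.
  by have [y yA ymin] := arg_minP h aA; exists y.
rewrite ltnS => cA; have {}IH : \sum_(x in A :\ y) m x *
    (\sum_(z in A :\ y | h x <= h z) m z) `^ (r - 1) <=
    r^-1 * (\sum_(x in A :\ y) m x) `^ r.
  by apply: IH; apply: leq_trans cA; rewrite [X in (_ < X)%N](cardsD1 y) yA.
rewrite (bigD1 y)//=.
have -> : \sum_(z in A | h y <= h z) m z = \sum_(z in A) m z.
  by apply: eq_bigl => z; case zA: (z \in A) => //=; rewrite ymin.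
set M := \sum_(z in A) m z.
have ME : M = m y + \sum_(x in A :\ y) m x.
  rewrite /M (bigD1 y)//=; congr (_ + _); apply: eq_bigl => z.
  by rewrite !inE andbC.
have M'0 : 0 <= \sum_(x in A :\ y) m x by rewrite sumr_ge0.
have le1 : \sum_(x in A | x != y) m x * (\sum_(z in A | h x <= h z) m z) `^ (r - 1)
    <= r^-1 * (\sum_(x in A :\ y) m x) `^ r.
  apply: le_trans IH; rewrite [X in _ <= X](eq_bigl (fun x => (x \in A) && (x != y))); last first.
    by move=> z; rewrite !inE andbC.
  apply: ler_sum => x /andP[xA xy].
  have := m0 x; rewrite le_eqVlt => /predU1P[<-|mx0]; first by rewrite !mul0r.
  rewrite ler_wpM2l// ge_powR//.
    rewrite (bigD1 x)/=; last by rewrite !inE xy xA lexx.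
    by rewrite ltr_pwDl// sumr_ge0.
  rewrite [X in _ <= X](bigID (mem (A :\ y)))/=.
  rewrite [X in _ <= X + _](eq_bigl (fun z => (z \in A :\ y) && (h x <= h z))).
    by rewrite lerDl sumr_ge0.
  by move=> z; rewrite !inE; case: (z \in A) => /=; rewrite ?andbT ?andbF// andbC.
apply: le_trans (_ : m y * M `^ (r - 1) + r^-1 * (\sum_(x in A :\ y) m x) `^ r <= _).
  by rewrite lerD2l.
have : 0 <= M by rewrite sumr_ge0.
rewrite le_eqVlt => /predU1P[M0|Mp].
  move: ME; rewrite -M0 => /esym/eqP; rewrite paddr_eq0// => /andP[/eqP-> /eqP->].
  by rewrite mul0r add0r.
have := powR_le_tangent r0 r1 M'0 Mp.
have -> : \sum_(x in A :\ y) m x - M = - m y by rewrite ME; ring.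
have ri : 0 <= r^-1 by rewrite invr_ge0 ltW.
move=> /(ler_wpM2l ri); rewrite mulrDr mulrN mulrN mulrA mulrA mulVf ?gt_eqF//.
by rewrite mul1r [_ * m y]mulrC => h1; rewrite addrC -lerBrDr.
Qed.

(** Weak L^p embeds in L^1 on finite measure. The weak bound at levels just below [f x] gives
    [f x <= W * m{f >= f x}^(-1/p)], and these weights are summed by [sum_psi_le] with exponent 1 -
    1/p. *)
Lemma sum_weak_le m f (p W : R) : 1 < p -> 0 <= W -> (forall x, 0 <= m x) ->
  (forall t, 0 < t -> t * dist m f t `^ p^-1 <= W) ->
  \sum_x m x * f x <= p / (p - 1) * W * (\sum_x m x) `^ (1 - p^-1).
Proof.
move=> p1 W0 m0 fW; have p0 : 0 < p by exact: lt_trans p1.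
have r0 : 0 < 1 - p^-1 by rewrite subr_gt0 invf_lt1.
have r1 : 1 - p^-1 <= 1 by rewrite gerBl invr_ge0 ltW.
have -> : p / (p - 1) = (1 - p^-1)^-1.
  have p10 : p - 1 != 0 by rewrite subr_eq0 gt_eqF.
  rewrite (_ : 1 - p^-1 = (p - 1) / p) ?invf_div//; field; exact: lt0r_neq0.
have psi : \sum_x m x * (\sum_(z | f x <= f z) m z) `^ (1 - p^-1 - 1) <=
    (1 - p^-1)^-1 * (\sum_x m x) `^ (1 - p^-1).
  have := @sum_psi_le m f (1 - p^-1) [set: I]%SET r0 r1 m0.
  have E (F : I -> R) : \sum_(x in [set: I]%SET) F x = \sum_x F x.
    by apply: eq_bigl => x; rewrite finset.in_setT.
  rewrite !E; congr (_ <= _); apply: eq_bigr => x _; congr (_ * _ `^ _).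
  by apply: eq_bigl => z; rewrite finset.in_setT.
rewrite -(mulrA _ W) (mulrCA _ W).
apply: le_trans (ler_wpM2l W0 psi); rewrite mulr_sumr; apply: ler_sum => x _.
have := m0 x; rewrite le_eqVlt => /predU1P[<-|mx0]; first by rewrite !mul0r mulr0.
rewrite mulrCA ler_wpM2l//.
set S := \sum_(z | _) _.
have S0 : 0 < S.
  rewrite /S (bigD1 x)//=.
  by rewrite ltr_pwDl// sumr_ge0.
have -> : 1 - p^-1 - 1 = - p^-1 by ring.
rewrite powRN leNgt; apply/negP => lt1.
have Sp : 0 < S `^ p^-1 by rewrite powR_gt0.
have W1 : 0 <= W / S `^ p^-1 by rewrite divr_ge0// ltW.
(* A level strictly below [f x] at which the weak bound already fails. *)
pose t := (W / S `^ p^-1 + f x) / 2.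
have tf : t < f x by rewrite /t; lra.
have Wt : W / S `^ p^-1 < t by rewrite /t; lra.
have t0 : 0 < t by exact: le_lt_trans Wt.
have := fW t t0; apply/negP; rewrite -ltNge.
rewrite ltr_pdivrMr// in Wt; apply: lt_le_trans Wt _.
rewrite ler_wpM2l ?(ltW t0)// le_powR ?invr_ge0 ?(ltW p0) ?(ltW S0)//.
rewrite /dist /S [X in _ <= X](bigID (fun z => f x <= f z))/=.
rewrite [X in _ <= X + _](eq_bigl (fun z => f x <= f z)); last first.
  move=> z; case fz: (f x <= f z) => /=; rewrite ?andbF//.
  by rewrite (lt_le_trans tf).
by rewrite lerDl sumr_ge0.
Qed.

Lemma dist_ge0 m f t : (forall x, 0 <= m x) -> 0 <= dist m f t.
Proof. by move=> m0; rewrite sumr_ge0. Qed.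

Lemma dist_ni m f : (forall x, 0 <= m x) -> nonincreasing_fun (dist m f).
Proof.
move=> m0 t s st; rewrite /dist [X in _ <= X](bigID (fun x => s < f x))/=.
rewrite [X in _ <= X + _](eq_bigl (fun z => s < f z)) ?lerDl ?sumr_ge0//.
by move=> x; apply/andb_idl => /(le_lt_trans st).
Qed.

End Rearr.

(** * Integrals of distribution functions over the half-line *)

Section Integral.
Context {R : realType}.
Implicit Types (c q t : R).
Local Notation leb := (@lebesgue_measure R).
Local Notation pos := (`]0%R, +oo[%classic : set R).

Lemma powR_within_continuous c r : 0 <= r -> 0 < c ->
  {within `[0, c], continuous (@powR R ^~ r)}.
Proof.
move=> r0 c0; have [->|rn0] := eqVneq r 0.
  rewrite (_ : (fun x : R => x `^ 0) = cst 1); last by apply/funext => x; rewrite powRr0.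
  by move=> ?; exact: cst_continuous.
have rp : 0 < r by rewrite lt_neqAle eq_sym rn0.
have cont (x : R) : 0 < x -> {for x, continuous (@powR R ^~ r)}.
  by move=> x0; apply: differentiable_continuous; apply/derivable1_diffP;
    apply: derivable_powR; rewrite in_itv/= x0.
apply/continuous_within_itvP => //; split.
- by move=> x; rewrite in_itv/= => /andP[x0 _]; exact: cont.
- by rewrite powR0//; exact: powR_cvg0.
- by apply: cvg_at_left_filter; exact: cont.
Qed.

Lemma integral_powR q c : 1 <= q -> 0 <= c ->
  (\int[leb]_(t in pos) (t `^ (q - 1) * (t < c)%R%:R)%:E = (c `^ q / q)%:E)%E.
Proof.
move=> q1 c0; have q0 : 0 < q by exact: lt_le_trans q1.
have mf : measurable_fun [set: R] (EFin \o (fun t : R => t `^ (q - 1))).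
  by apply/measurable_EFinP; exact: measurable_powR.
have [->|cn0] := eqVneq c 0.
  rewrite powR0 ?gt_eqF// mul0r integral0_eq// => t /=.
  by rewrite in_itv/= andbT => t0; rewrite ltNge (ltW t0) mulr0.
have {}c0 : 0 < c by rewrite lt_neqAle eq_sym cn0.
transitivity (\int[leb]_(t in `]0%R, c[) (t `^ (q - 1))%:E)%E.
  rewrite integral_mkcond [RHS]integral_mkcond; apply: eq_integral => t _.
  rewrite !patchE; case: (boolP (t \in `]0%R, c[%classic)) => [|].
    rewrite inE/= in_itv/= => /andP[t0 tc].
    by rewrite mem_set ?tc ?mulr1//= in_itv/= t0.
  move=> /negP h; case: ifPn => //; rewrite inE/= in_itv/= andbT => t0.
  case tc : (t < c); rewrite ?mulr0//.
  by exfalso; apply: h; rewrite inE/= in_itv/= t0.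
rewrite -(@integral_itv_bndoo R 0 c _ true false); last exact: measurable_funS mf.
transitivity ((q^-1 * c `^ q)%:E - (q^-1 * 0 `^ q)%:E)%E; last first.
  by rewrite powR0 ?gt_eqF// mulr0 sube0 mulrC.
apply: (@continuous_FTC2 R (@powR R ^~ (q - 1)) (fun t => q^-1 * t `^ q)) => //.
- by apply: powR_within_continuous; rewrite ?subr_ge0.
- have /continuous_within_itvP-/(_ c0)[h1 h2 h3] := powR_within_continuous (ltW q0) c0.
  split.
  + move=> x; rewrite in_itv/= => /andP[x0 _]; apply: derivableM => //.
    by apply: derivable_powR; rewrite in_itv/= x0.
  + by apply: cvgM => //; exact: cvg_cst.
  + by apply: cvgM => //; exact: cvg_cst.
- move=> x; rewrite in_itv/= => /andP[x0 _].
  rewrite derive1E deriveM//; last by apply: derivable_powR; rewrite in_itv/= x0.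
  rewrite derive_cst scaler0 addr0 -derive1E powR_derive1 ?in_itv/= ?x0//.
  by rewrite /GRing.scale/= mulrA mulVf ?mul1r// gt_eqF.
Qed.

(** By uniqueness of Lebesgue measure, [l] times its image under the dilation is Lebesgue measure
    again: both agree on half-open intervals. *)
Lemma integral_scale (l : R) (f : R -> \bar R) : 0 < l ->
  measurable_fun setT f -> (forall t, (0 <= f t)%E) ->
  (\int[leb]_(t in pos) f t = l%:E * \int[leb]_(t in pos) f (l * t)%R)%E.
Proof.
move=> l0 mf f0.
pose phi : R -> measurableTypeR R := fun t : R => (l * t)%R.
have mphi : measurable_fun [set: measurableTypeR R] phi by exact: measurable_funM.
pose nu := mscale (NngNum (ltW l0)) (measure_function_pushforward__canonical__measure_function_Measure leb mphi).
have nuE A : measurable A -> leb A = nu A.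
  apply: lebesgue_measure_unique => _ [[a b]] _ <-.
  rewrite /nu/= /mscale/= /pushforward/=.
  rewrite (_ : (fun t : R => l * t) @^-1` `]a, b] = `]a / l, b / l]%classic); last first.
    apply/seteqP; split=> x /=; rewrite !in_itv/=;
    by rewrite ltr_pdivrMr// ler_pdivlMr// [x * l]mulrC.
  rewrite !lebesgue_measure_itv/= !lte_fin ltr_pM2r ?invr_gt0//.
  case: ifPn => _; last by rewrite mule0.
  by rewrite -!EFinB -EFinM; congr EFin; field; rewrite gt_eqF.
transitivity (\int[nu]_(t in pos) f t)%E.
  by apply: eq_measure_integral => A mA _; exact: nuE.
rewrite ge0_integral_mscale//=; last exact: measurable_funS mf.
congr (_ * _)%E.
have := @ge0_integral_pushforward _ _ _ _ _ _ mphi leb pos f.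
move=> /(_ (measurable_itv _) (measurable_funS measurableT (subsetT _) mf) (fun t _ => f0 t)).
move=> /= ->; congr (integral _ _ _).
by apply/seteqP; split => x /=; rewrite !in_itv/= !andbT pmulr_rgt0.
Qed.

(** The q-th power of the L^{p,q} quasinorm divided by [p], as a functional of the distribution
    function, with [(t d^(1/p))^q / t] multiplied out. *)
Definition Iq (p q : R) (d : R -> R) : \bar R :=
  (\int[leb]_(t in pos) (t `^ (q - 1) * d t `^ (q / p))%:E)%E.

Lemma measurable_Iq p q d : measurable_fun setT d ->
  measurable_fun pos (fun t => (t `^ (q - 1) * d t `^ (q / p))%:E).
Proof.
move=> md; apply/measurable_EFinP; apply: (@measurable_funS _ _ _ _ setT) => //.
apply: measurable_funM; first exact: measurable_powR.
by apply: (measurableT_comp (measurable_powR _)).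
Qed.

Lemma Iq_ge0 p q d : (0 <= Iq p q d)%E.
Proof. by apply: integral_ge0 => t _; rewrite lee_fin mulr_ge0 ?powR_ge0. Qed.

Lemma le_Iq p q C (d d' : R -> R) : 0 <= C -> measurable_fun setT d -> measurable_fun setT d' ->
  (forall t, 0 < t -> d t `^ (q / p) <= C * d' t `^ (q / p)) ->
  (Iq p q d <= C%:E * Iq p q d')%E.
Proof.
move=> C0 md md' dd'; rewrite -ge0_integralZl_EFin//; last 2 first.
- by move=> t _; rewrite lee_fin mulr_ge0 ?powR_ge0.
- exact: measurable_Iq.
apply: ge0_le_integral => //=.
- by move=> t _; rewrite lee_fin mulr_ge0 ?powR_ge0.
- exact: measurable_Iq.
- by apply: measurable_funeM; exact: measurable_Iq.
- move=> t; rewrite in_itv/= andbT => t0; rewrite -EFinM lee_fin mulrCA.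
  by rewrite ler_wpM2l ?powR_ge0 ?dd'.
Qed.

Lemma integral_powR_sum (I : finType) (c h : I -> R) q : 1 <= q ->
  (forall x, 0 <= c x) -> (forall x, 0 <= h x) ->
  (\int[leb]_(t in pos) (t `^ (q - 1) * \sum_(x | (t < h x)%R) c x)%:E =
   (\sum_x c x * (h x `^ q / q))%:E)%E.
Proof.
move=> q1 c0 h0.
transitivity (\int[leb]_(t in pos) (\sum_x (c x)%:E * (t `^ (q - 1) * (t < h x)%R%:R)%:E))%E.
  apply: eq_integral => t _; rewrite mulr_sumr big_mkcond/= -sumEFin.
  apply: eq_bigr => x _; rewrite -EFinM; congr EFin.
  by case: ifP => _; rewrite ?mulr1 ?mulr0// mulrC.
have mI x : measurable_fun pos (fun t : R => (t `^ (q - 1) * (t < h x)%R%:R)%:E).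
  apply/measurable_EFinP; apply: (@measurable_funS _ _ _ _ setT) => //.
  apply: measurable_funM; first exact: measurable_powR.
  apply: nonincreasing_measurable => // s t st /=; rewrite ler_nat.
  by case: (ltP t) => //= tx; rewrite (le_lt_trans st tx).
have I0 x t : (0 <= (t `^ (q - 1) * (t < h x)%R%:R)%:E)%E.
  by rewrite lee_fin mulr_ge0 ?powR_ge0 ?ler0n.
rewrite ge0_integral_sum//; last 2 first.
- by move=> x; apply: measurable_funeM; exact: mI.
- by move=> x t _; apply: mule_ge0; [rewrite lee_fin|exact: I0].
rewrite -sumEFin; apply: eq_bigr => x _.
rewrite [RHS]EFinM -(integral_powR q1 (h0 x)) -ge0_integralZl_EFin//.
exact: mI.
Qed.

(** L^{p,q} embeds in weak L^p: on levels below [t] the integrand is at least the one with [d t] in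
    place of [d s]. The one-point index type reuses the layer-cake formula for this cut-off
    integrand. *)
Lemma powR_le_Iq p q (d : R -> R) t : 0 < p -> 1 <= q -> 0 < t ->
  (forall s, 0 <= d s) -> nonincreasing_fun d ->
  ((t `^ q * d t `^ (q / p))%:E <= q%:E * Iq p q d)%E.
Proof.
move=> p0 q1 t0 d0 dni; have q0 : 0 < q by exact: lt_le_trans q1.
have qp : 0 <= q / p by rewrite divr_ge0 ?ltW.
have md : measurable_fun setT d by exact: nonincreasing_measurable.
have := @integral_powR_sum unit (fun=> d t `^ (q / p)) (fun=> t) q q1
  (fun=> powR_ge0 _ _) (fun=> ltW t0).
rewrite (big_pred1 tt)// => E.
rewrite (_ : (t `^ q * d t `^ (q / p))%:E = (q%:E * (d t `^ (q / p) * (t `^ q / q))%:E)%E); last first.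
  by rewrite -EFinM; congr EFin; field; rewrite gt_eqF.
rewrite lee_pmul2l ?lte_fin//.
rewrite -E; apply: ge0_le_integral => //=.
- by move=> s _; rewrite lee_fin mulr_ge0 ?powR_ge0 ?sumr_ge0// => *; rewrite powR_ge0.
- apply/measurable_EFinP; apply: (@measurable_funS _ _ _ _ setT) => //.
  apply: measurable_funM; first exact: measurable_powR.
  apply: nonincreasing_measurable => // s u su /=.
  case: (ltP u) => /= ut; last by rewrite big_pred0// sumr_ge0// => *; rewrite powR_ge0.
  by rewrite (le_lt_trans su ut).
- exact: measurable_Iq.
- move=> s; rewrite in_itv/= andbT => s0; rewrite lee_fin ler_wpM2l ?powR_ge0//.
  case: (ltP s) => /= st; last by rewrite big_pred0// powR_ge0.
  by rewrite (big_pred1 tt)// le_powR// dni// ltW.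
Qed.

Lemma Iq_scale p q (l c : R) (d : R -> R) : 0 < q -> 0 < l -> 0 <= c ->
  (forall s, 0 <= d s) -> measurable_fun setT d ->
  Iq p q (fun t => c * d (t / l)) = ((l `^ q * c `^ (q / p))%:E * Iq p q d)%E.
Proof.
move=> q0 l0 c0 d0 md; rewrite /Iq.
pose f t := ((t `^ (q - 1) * (c * d (t / l)) `^ (q / p))%:E : \bar R).
have mf : measurable_fun setT f.
  apply/measurable_EFinP; apply: measurable_funM; first exact: measurable_powR.
  apply: (measurableT_comp (measurable_powR _)); apply: measurable_funM => //.
  by apply: (measurableT_comp md); exact: measurable_funM.
have f0 t : (0 <= f t)%E by rewrite lee_fin mulr_ge0 ?powR_ge0.
apply: (etrans (integral_scale l0 mf f0)).
rewrite -(mulr_powRB1 (ltW l0) q0) -mulrA EFinM -muleA; congr (_ * _)%E.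
rewrite -ge0_integralZl_EFin//; last 3 first.
- by move=> t _; rewrite lee_fin mulr_ge0 ?powR_ge0.
- exact: measurable_Iq.
- by rewrite mulr_ge0 ?powR_ge0.
apply: eq_integral => t; rewrite inE/= in_itv/= andbT => t0.
rewrite /f [l * t / l]mulrAC divff ?gt_eqF// mul1r.
rewrite !powRM// ?(ltW l0) ?(ltW t0)// -EFinM; congr EFin; ring.
Qed.

End Integral.

(** * Lorentz norms of finite sums *)

Section SumBounds.
Context {R : realType}.
Implicit Types p q t : R.
Local Notation leb := (@lebesgue_measure R).
Local Notation pos := (`]0%R, +oo[%classic : set R).

Lemma measurable_dist (I : finType) (m f : I -> R) : (forall x, 0 <= m x) ->
  measurable_fun setT (dist m f).
Proof. by move=> m0; apply: nonincreasing_measurable => //; exact: dist_ni. Qed.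

(* For [q <= p] the weight [m psi], [psi] a power of the distribution function of the sum [h],
   linearises the norm of [h] and is at most the norm on any other function. *)
Lemma Iq_sum_small (I : finType) (m : I -> R) n (g : 'I_n -> I -> R) p q :
  1 <= q -> q <= p -> (forall x, 0 <= m x) -> (forall j x, 0 <= g j x) ->
  (Iq p q (dist m (fun x => \sum_j g j x)%R) <=
   (n%:R `^ (q - 1) * (p / q))%:E * \sum_j Iq p q (dist m (g j)))%E.
Proof.
move=> q1 qp m0 g0; set h := fun x => _.
have q0 : 0 < q by exact: lt_le_trans q1.
have p0 : 0 < p by exact: lt_le_trans qp.
pose s := q / p; have s0 : 0 < s by rewrite divr_gt0.
have s1 : s <= 1 by rewrite ler_pdivrMr// mul1r.
have sE : s^-1 = p / q by rewrite /s invf_div.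
pose psi y := (\sum_(z | h y <= h z) m z) `^ (s - 1).
pose w y := m y * psi y.
have w0 y : 0 <= w y by rewrite mulr_ge0 ?powR_ge0.
have h0 y : 0 <= h y by rewrite sumr_ge0.
have mlay (f : I -> R) : measurable_fun pos (fun t => (t `^ (q - 1) * \sum_(y | t < f y) w y)%:E).
  apply/measurable_EFinP; apply: (@measurable_funS _ _ _ _ setT) => //.
  apply: measurable_funM; first exact: measurable_powR.
  exact: measurable_dist.
(* For [t < h y] the set {h >= h y} lies inside {h > t}, so its negative power [psi y] is at least
   the same power of [dist m h t]; summing [m y] over {h > t} restores the full power of
   [dist m h t]. *)
have step1 : (Iq p q (dist m h) <= (\sum_y w y * (h y `^ q / q))%:E)%E.
  rewrite -integral_powR_sum//; apply: ge0_le_integral => //=.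
  - by move=> t _; rewrite lee_fin mulr_ge0 ?powR_ge0.
  - by apply: measurable_Iq; exact: measurable_dist.
  - exact: mlay.
  - move=> t _; rewrite lee_fin ler_wpM2l ?powR_ge0// -/s.
    have := dist_ge0 h t m0; rewrite le_eqVlt => /predU1P[d0|d0].
      by rewrite -d0 powR0 ?gt_eqF// sumr_ge0.
    rewrite -(mulr_powRB1 (ltW d0) s0) {1}/dist mulr_suml.
    apply: ler_sum => y th; have := m0 y; rewrite le_eqVlt => /predU1P[my|my].
      by rewrite /w -my !mul0r.
    rewrite /w ler_wpM2l// ge_powR ?subr_le0//.
      by rewrite (bigD1 y)//= ltr_pwDl// sumr_ge0.
    rewrite /dist [X in _ <= X](bigID (fun z => h y <= h z))/=.
    rewrite [X in _ <= X + _](eq_bigl (fun z => h y <= h z)) ?lerDl ?sumr_ge0//.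
    by move=> z; apply/andb_idl => /(lt_le_trans th).
apply: (le_trans step1); rewrite EFinM -muleA.
apply: (@le_trans _ _ ((n%:R `^ (q - 1))%:E * (\sum_j \sum_y w y * (g j y `^ q / q))%:E)%E).
  rewrite -EFinM lee_fin exchange_big/= mulr_sumr ler_sum// => y _.
  rewrite -mulr_sumr [X in _ <= X]mulrCA ler_wpM2l// -mulr_suml mulrA ler_wpM2r ?invr_ge0 ?(ltW q0)//.
  exact: powR_sum_le.
apply: lee_wpmul2l; first by rewrite lee_fin powR_ge0.
rewrite -sE -sumEFin ge0_sume_distrr; last by move=> j _; exact: Iq_ge0.
apply: lee_sum => j _; rewrite -integral_powR_sum//.
rewrite /Iq -ge0_integralZl_EFin//; last 3 first.
- by move=> t _; rewrite lee_fin mulr_ge0 ?powR_ge0.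
- by apply: measurable_Iq; exact: measurable_dist.
- by rewrite invr_ge0 ltW.
apply: ge0_le_integral => //=.
- by move=> t _; rewrite lee_fin mulr_ge0 ?powR_ge0 ?sumr_ge0.
- exact: mlay.
- by apply: measurable_funeM; apply: measurable_Iq; exact: measurable_dist.
move=> t _; rewrite -EFinM lee_fin mulrCA ler_wpM2l ?powR_ge0// -/s.
(* Restricting the inner sum to {g j > t} only increases the negative power, so the weight of this
   set is at most p/q times the q/p-th power of its measure, although [psi] was built from [h]. *)
have := @sum_psi_le R I m h s [set y | t < g j y]%SET s0 s1 m0.
have E (F : I -> R) : \sum_(y in [set y | t < g j y]%SET) F y = \sum_(y | t < g j y) F y.
  by apply: eq_bigl => y; rewrite finset.inE.
rewrite !E; apply: le_trans; apply: ler_sum => y ty.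
have := m0 y; rewrite le_eqVlt => /predU1P[my|my]; first by rewrite /w -my !mul0r.
rewrite /w ler_wpM2l// ge_powR ?subr_le0//.
  by rewrite (bigD1 y)/= ?finset.inE ?ty ?lexx// ltr_pwDl// sumr_ge0.
rewrite [X in _ <= X](bigID (fun z => t < g j z))/=.
rewrite [X in _ <= X + _](eq_bigl (fun z => (z \in [set y | t < g j y]%SET) && (h y <= h z))).
  by rewrite lerDl sumr_ge0.
by move=> z; rewrite finset.inE andbC.
Qed.

(** The highest dyadic level [2 ^ l * T] below [v] alone pays for [v], because [2 ^ l.+1 * T] is at
    least [v]. *)
Lemma dyadic_le (v T : R) k : 0 < T -> v <= 2 ^+ k * T ->
  v * (T < v)%R%:R <= \sum_(l < k) 2 ^+ l.+1 * T * (2 ^+ l * T < v)%R%:R.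
Proof.
move=> T0; elim: k => [|k IH].
  by rewrite expr0 mul1r big_ord0 => vT; rewrite ltNge vT mulr0.
move=> vk; rewrite big_ord_recr/=; have [h|h] := leP v (2 ^+ k * T).
  by rewrite mulr0 addr0 IH.
rewrite mulr1 ler_wpDl// ?sumr_ge0//.
  by move=> l _; rewrite !mulr_ge0 ?exprn_ge0 ?(ltW T0).
by apply: le_trans vk; case: (T < v); rewrite ?mulr1// mulr0 (le_trans _ (ltW h))// mulr_ge0 ?exprn_ge0 ?(ltW T0).
Qed.

(** Where the sum exceeds [t], the values below [T] contribute at most t/2, so the larger values add
    up to more than t/2. Chebyshev's inequality applies to these, in their dyadic majorants. [k]
    only has to cover the finitely many values. *)
Lemma dist_sum_le (I : finType) (m : I -> R) n (g : 'I_n.+1 -> I -> R) t :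
  0 < t -> (forall x, 0 <= m x) -> (forall j x, 0 <= g j x) ->
  exists k, dist m (fun x => \sum_j g j x) t <=
    2 / n.+1%:R * \sum_j \sum_(l < k) 2 ^+ l * dist m (g j) (2 ^+ l * (t / (2 * n.+1%:R))).
Proof.
move=> t0 m0 g0; set T := t / _.
have n0 : 0 < n.+1%:R :> R by [].
have T0 : 0 < T by rewrite divr_gt0// mulr_gt0.
pose B := \sum_j \sum_x g j x.
have gB j x : g j x <= B.
  rewrite /B (bigD1 j)//= (bigD1 x)//= -addrA lerDl addr_ge0 ?sumr_ge0// => i _.
  by rewrite sumr_ge0.
have [k Bk] : exists k, B / T <= 2 ^+ k.
  have := @truncn_itv R (B / T).
  have BT : 0 <= B / T by rewrite divr_ge0 ?(ltW T0)// sumr_ge0// => i _; exact: sumr_ge0.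
  move=> /(_ BT)/andP[_ /ltW h]; exists (Num.truncn (B / T)).+1; apply: (le_trans h).
  by rewrite -natrX ler_nat ltnW// ltn_expl.
exists k; rewrite ler_pdivrMr// in Bk.
have key x : t < \sum_j g j x ->
    1 <= 2 / t * \sum_j \sum_(l < k) 2 ^+ l.+1 * T * (2 ^+ l * T < g j x)%R%:R.
  move=> th; rewrite mulrAC ler_pdivlMr// mul1r.
  apply: (@le_trans _ _ (2 * \sum_j g j x * (T < g j x)%R%:R)); last first.
    by rewrite ler_wpM2l// ler_sum// => j _; apply: dyadic_le => //; exact: le_trans Bk.
  have : \sum_j g j x <= \sum_j (g j x * (T < g j x)%R%:R + T).
    apply: ler_sum => j _; case: (ltP T) => h; rewrite ?mulr1 ?mulr0 ?add0r//.
    by rewrite lerDl ltW.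
  rewrite big_split/= sumr_const card_ord -(mulr_natl T).
  have -> : n.+1%:R * T = t / 2 by rewrite /T; field; rewrite gt_eqF.
  lra.
apply: (@le_trans _ _ (\sum_x m x * (2 / t * \sum_j \sum_(l < k) 2 ^+ l.+1 * T * (2 ^+ l * T < g j x)%R%:R))).
  rewrite /dist big_mkcond/=; apply: ler_sum => x _; case: ifP => [/key h|_].
    by rewrite -{1}[m x]mulr1 ler_wpM2l.
  apply: mulr_ge0 => //; apply: mulr_ge0; first by rewrite divr_ge0 ?(ltW t0).
  apply: sumr_ge0 => j _; apply: sumr_ge0 => l _.
  by rewrite mulr_ge0 ?ler0n// mulr_ge0 ?exprn_ge0// ltW.
under eq_bigr do rewrite mulrCA mulr_sumr.
rewrite -mulr_sumr exchange_big/= mulr_sumr mulr_sumr ler_sum// => j _.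
under eq_bigr do rewrite mulr_sumr.
rewrite exchange_big/= mulr_sumr mulr_sumr ler_sum// => l _.
rewrite [X in _ <= X]mulrA /dist [in X in _ <= X]big_mkcond/= [X in X <= _]mulr_sumr [X in _ <= X]mulr_sumr ler_sum// => x _.
rewrite le_eqVlt; apply/orP; left; apply/eqP.
rewrite exprS; case: ifP => _; rewrite /= ?mulr1n ?mulr0n ?mulr0//.
rewrite /T; clear -t0 n0; by move: n.+1%:R n0 => N N0; field; rewrite (gt_eqF t0) (gt_eqF N0).
Qed.

Lemma nneseries_geo_le (k : R) (X : \bar R) : 0 <= k -> k < 1 -> (0 <= X)%E ->
  (\sum_(l <oo) (k ^+ l)%:E * X <= ((1 - k)^-1)%:E * X)%E.
Proof.
move=> k0 k1 X0; have k10 : 0 < 1 - k by rewrite subr_gt0.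
apply: lime_le.
  by apply: is_cvg_nneseries => l _ _; rewrite mule_ge0// lee_fin exprn_ge0.
apply: nearW => N; rewrite -ge0_sume_distrl; last by move=> l _; rewrite lee_fin exprn_ge0.
rewrite sumEFin lee_wpmul2r// lee_fin.
rewrite -[X in _ <= X]mul1r ler_pdivlMr// big_mkord.
have := subrX1 k N; have := exprn_ge0 N k0; lra.
Qed.

(** Raising the dyadic bound to the power [s = q/p] uses Jensen over [j] and [powR_sum_geo_le] over
    [l]. The mass factor 2^l and the dilation of level [l] contribute 2^(l (s - q)), which is
    summable because s < q, that is, p > 1. *)
Lemma Iq_sum_large p q : 1 < p -> p <= q -> exists2 C, 0 < C &
  forall (I : finType) (m : I -> R) n (g : 'I_n.+1 -> I -> R),
  (forall x, 0 <= m x) -> (forall j x, 0 <= g j x) ->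
  (Iq p q (dist m (fun x => \sum_j g j x)%R) <=
   (C * n.+1%:R `^ (q - 1))%:E * \sum_j Iq p q (dist m (g j)))%E.
Proof.
move=> p1 pq; have p0 : 0 < p by exact: lt_trans p1.
have q1 : 1 < q by exact: lt_le_trans pq. have q0 : 0 < q by exact: lt_trans q1.
pose s := q / p; have s1 : 1 <= s by rewrite ler_pdivlMr// mul1r.
have s0 : 0 < s by exact: lt_le_trans s1.
have sq : s < q by rewrite ltr_pdivrMr// ltr_pMr.
(* Half of the gap [q - s] is spent on the geometric weights, which leaves the ratio
   [k = rho^-1 < 1]. *)
pose rho := 2 `^ ((q - s) / 2).
have half : 0 < (q - s) / 2 by rewrite divr_gt0// subr_gt0.
have rho1 : 1 < rho by rewrite powR_gt1// ltr1n.
have rho0 : 0 < rho by exact: lt_trans rho1.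
have [C0 C00 HC0] := powR_sum_geo_le s1 rho1.
pose k := rho * 2 `^ (s - q).
have k0 : 0 < k by rewrite mulr_gt0// powR_gt0.
have k1 : k < 1.
  have -> : k = rho^-1.
    by rewrite /k /rho -gt0_powRD// -powRN; congr (_ `^ _); field.
  by rewrite invf_lt1.
have powX (a r : R) l : 0 <= a -> (a ^+ l) `^ r = (a `^ r) ^+ l.
  by move=> a0; rewrite -(powR_mulrn l a0) powRAC powR_mulrn ?powR_ge0.
exists (2 `^ s * C0 * 2 `^ q / (1 - k)).
  by rewrite divr_gt0 ?subr_gt0// !mulr_gt0 ?powR_gt0.
move=> I m n g m0 g0; set h := fun x => _; set N : R := n.+1%:R.
have N0 : 0 < N by [].
pose L := 2 * N; have L0 : 0 < L by rewrite mulr_gt0.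
pose lam (l : nat) : R := L / 2 ^+ l.
have lam0 l : 0 < lam l by rewrite divr_gt0// exprn_gt0.
pose d j := dist m (g j); have d0 j t : 0 <= d j t by exact: dist_ge0.
have md j : measurable_fun setT (d j) by exact: measurable_dist.
pose e j l t := 2 ^+ l * d j (t / lam l).
have me j l : measurable_fun setT (e j l).
  apply: measurable_funM => //; apply: (measurableT_comp (md j)).
  exact: measurable_funM.
have e0 j l t : 0 <= e j l t by rewrite mulr_ge0 ?exprn_ge0.
pose F j l t : \bar R := ((rho ^+ l)%:E * (t `^ (q - 1) * e j l t `^ (q / p))%:E)%E.
have F0 j l t : (0 <= F j l t)%E.
  by rewrite mule_ge0// lee_fin ?exprn_ge0 ?(ltW rho0)// mulr_ge0 ?powR_ge0.
have mF j l : measurable_fun pos (F j l).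
  by apply: measurable_funeM; exact: measurable_Iq.
have c0 : 0 <= 2 `^ s * C0 / N by rewrite divr_ge0 ?(ltW N0)// mulr_ge0 ?powR_ge0 ?(ltW C00).
have mS j : measurable_fun pos (fun t => \sum_(l <oo) F j l t)%E.
  by apply: ge0_emeasurable_sum.
have pt t : 0 < t -> ((t `^ (q - 1) * dist m h t `^ (q / p))%:E <=
    (2 `^ s * C0 / N)%:E * \sum_j \sum_(l <oo) F j l t)%E.
  move=> t0; have [K HK] := dist_sum_le t0 m0 g0.
  apply: (@le_trans _ _ ((2 `^ s * C0 / N)%:E * \sum_j \sum_(0 <= l < K) F j l t)%E); last first.
    apply: lee_wpmul2l; first by rewrite lee_fin.
    by apply: lee_sum => j _; apply: nneseries_lim_ge => l _ _; exact: F0.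
  under eq_bigr do under eq_bigr do rewrite /F -EFinM.
  under eq_bigr do rewrite sumEFin.
  rewrite sumEFin -EFinM lee_fin -/s.
  have -> : 2 `^ s * C0 / N * (\sum_j \sum_(0 <= l < K) rho ^+ l * (t `^ (q - 1) * e j l t `^ s))
      = t `^ (q - 1) * (2 `^ s * (N^-1 * \sum_j C0 * \sum_(l < K) rho ^+ l * e j l t `^ s)).
    rewrite -mulr_sumr.
    have -> : \sum_j \sum_(0 <= l < K) rho ^+ l * (t `^ (q - 1) * e j l t `^ s) =
       t `^ (q - 1) * \sum_j \sum_(l < K) rho ^+ l * e j l t `^ s.
      rewrite mulr_sumr; apply: eq_bigr => j _; rewrite big_mkord mulr_sumr.
      by apply: eq_bigr => l _; rewrite mulrCA.
    by ring.
  rewrite ler_wpM2l ?powR_ge0//.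
  have Y0 j : 0 <= \sum_(l < K) e j l t by rewrite sumr_ge0.
  have -> : 2 `^ s * (N^-1 * \sum_j C0 * \sum_(l < K) rho ^+ l * e j l t `^ s) =
     (2 / N) `^ s * (N `^ (s - 1) * \sum_j C0 * \sum_(l < K) rho ^+ l * e j l t `^ s).
    rewrite [LHS]mulrA [RHS]mulrA; congr (_ * _).
    rewrite powRM ?invr_ge0 ?(ltW N0)// -mulrA; congr (_ * _).
    rewrite -powR_inv1 ?(ltW N0)// -powRrM -gt0_powRD//; congr (_ `^ _); ring.
  apply: (@le_trans _ _ ((2 / N * \sum_j \sum_(l < K) e j l t) `^ s)).
    apply: le_powR; [exact: ltW|exact: dist_ge0|].
    apply: (le_trans HK); rewrite le_eqVlt; apply/orP; left; apply/eqP; congr (_ * _).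
    apply: eq_bigr => j _; apply: eq_bigr => l _; rewrite /e /d; congr (_ * dist _ _ _).
    by rewrite /lam invf_div mulrCA.
  rewrite powRM ?divr_ge0 ?(ltW N0) ?sumr_ge0//.
  rewrite ler_wpM2l ?powR_ge0//.
  apply: (le_trans (powR_sum_le s1 Y0)); rewrite ler_wpM2l ?powR_ge0//.
  by apply: ler_sum => j _; exact: (HC0 K (fun l => e j l t)).
have Ie j l : (\int[leb]_(t in pos) F j l t = (L `^ q)%:E * ((k ^+ l)%:E * Iq p q (d j)))%E.
  rewrite /F ge0_integralZl_EFin//; last 3 first.
  - by move=> t _; rewrite lee_fin mulr_ge0 ?powR_ge0.
  - exact: measurable_Iq.
  - by rewrite exprn_ge0 ?ltW.
  have := @Iq_scale R p q (lam l) (2 ^+ l) (d j) q0 (lam0 l) (exprn_ge0 _ _) (d0 j) (md j).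
  rewrite /Iq => -> //; rewrite muleA muleA -!EFinM; congr (_%:E * _)%E.
  have -> : k = rho * (2 `^ s * (2^-1) `^ q).
    by rewrite /k gt0_powRD// -[in RHS]powR_inv1// -powRrM mulN1r.
  rewrite /lam powRM ?invr_ge0 ?exprn_ge0 ?(ltW L0)// -exprVn -/s.
  rewrite !powX ?invr_ge0// !exprMn; ring.
apply: (@le_trans _ _ ((2 `^ s * C0 / N)%:E * \sum_j (\int[leb]_(t in pos) \sum_(l <oo) F j l t))%E).
  rewrite -ge0_integral_sum//; last by move=> j t _; apply: nneseries_ge0 => l _ _; exact: F0.
  rewrite -ge0_integralZl_EFin//; last 2 first.
  - by move=> t _; apply: sume_ge0 => j _; apply: nneseries_ge0 => l _ _; exact: F0.
  - by apply: emeasurable_sum => j; exact: mS.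
  apply: ge0_le_integral => //=.
  - by move=> t _; rewrite lee_fin mulr_ge0 ?powR_ge0.
  - by apply: measurable_Iq; exact: measurable_dist.
  - by apply: measurable_funeM; apply: emeasurable_sum => j; exact: mS.
  - by move=> t; rewrite in_itv/= andbT => t0; exact: pt.
have -> : 2 `^ s * C0 * 2 `^ q / (1 - k) * N `^ (q - 1) =
   2 `^ s * C0 / N * (L `^ q * (1 - k)^-1).
  rewrite /L powRM ?(ltW N0)// -(mulr_powRB1 (ltW N0) q0).
  have kn : 1 - k != 0 by rewrite subr_eq0 gt_eqF.
  by field; rewrite kn gt_eqF.
rewrite [X in (_ <= X * _)%E]EFinM -[X in (_ <= X)%E]muleA.
apply: lee_wpmul2l; first by rewrite lee_fin.
rewrite ge0_sume_distrr; last by move=> j _; exact: Iq_ge0.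
apply: lee_sum => j _; rewrite integral_nneseries//; last by move=> l; exact: mF.
under eq_eseriesr do rewrite Ie.
rewrite nneseriesZl; last by move=> l _; rewrite mule_ge0 ?Iq_ge0// lee_fin exprn_ge0// ltW.
rewrite EFinM -muleA lee_wpmul2l ?lee_fin ?powR_ge0//.
by apply: nneseries_geo_le; rewrite ?Iq_ge0 ?(ltW k0).
Qed.

(** The power [q - 1] is the one of Hölder's inequality whatever the order of p and q; after taking
    q-th roots it becomes the exponent 1 - 1/q of the number of lower groups. *)
Lemma Iq_sum p q : 1 < p -> 1 <= q -> exists2 C, 0 < C &
  forall (I : finType) (m : I -> R) n (g : 'I_n -> I -> R),
  (forall x, 0 <= m x) -> (forall j x, 0 <= g j x) ->
  (Iq p q (dist m (fun x => \sum_j g j x)%R) <=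
   (C * n%:R `^ (q - 1))%:E * \sum_j Iq p q (dist m (g j)))%E.
Proof.
move=> p1 q1; have p0 : 0 < p by exact: lt_trans p1.
have q0 : 0 < q by exact: lt_le_trans q1.
have [qp|/ltW pq] := leP q p.
  exists (p / q); first exact: divr_gt0.
  by move=> I m n g m0 g0; rewrite mulrC; exact: Iq_sum_small.
have [C C0 HC] := Iq_sum_large p1 pq; exists C => // I m [|n] g m0 g0; last exact: HC.
rewrite big_ord0 mule0 /Iq integral0_eq// => t; rewrite /= in_itv/= andbT => t0.
rewrite /dist big_pred0 ?powR0 ?mulr0// ?gt_eqF ?divr_gt0//.
by move=> x; rewrite big_ord0 ltNge ltW.
Qed.

Definition weak_le p (d : R -> R) (W : R) := forall t, 0 < t -> t * d t `^ p^-1 <= W.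

Lemma sum_weak_restr_le (I : finType) (m f : I -> R) (P : pred I) p W : 1 < p -> 0 <= W ->
  (forall x, 0 <= m x) -> weak_le p (dist m f) W ->
  \sum_(x | P x) m x * f x <= p / (p - 1) * W * (\sum_(x | P x) m x) `^ (1 - p^-1).
Proof.
move=> p1 W0 m0 fW; have p0 : 0 < p by exact: lt_trans p1.
pose m' x := if P x then m x else 0.
have m'0 x : 0 <= m' x by rewrite /m'; case: ifP.
have E1 : \sum_x m' x = \sum_(x | P x) m x by rewrite -big_mkcond.
have E2 : \sum_x m' x * f x = \sum_(x | P x) m x * f x.
  by rewrite [RHS]big_mkcond; apply: eq_bigr => x _; rewrite /m'; case: ifP; rewrite ?mul0r.
have := @sum_weak_le R I m' f p W p1 W0 m'0; rewrite E1 E2.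
apply=> t t0; apply: le_trans (fW t t0).
rewrite ler_wpM2l ?(ltW t0)// le_powR ?invr_ge0 ?(ltW p0) ?dist_ge0//.
by apply: ler_sum => x _; rewrite /m'; case: ifP.
Qed.

(** Weak L^p is normable for p > 1: integrate the sum over its own superlevel set, bound each
    summand there by [sum_weak_restr_le], and divide by the power 1 - 1/p of the measure of that
    set. *)
Lemma weak_sum (I : finType) (m : I -> R) n (g : 'I_n -> I -> R) (W : 'I_n -> R) p :
  1 < p -> (forall x, 0 <= m x) -> (forall j, 0 <= W j) ->
  (forall j, weak_le p (dist m (g j)) (W j)) ->
  weak_le p (dist m (fun x => \sum_j g j x)) (p / (p - 1) * \sum_j W j).
Proof.
move=> p1 m0 W0 gW t t0; have p0 : 0 < p by exact: lt_trans p1.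
set h := fun x => _; have p10 : 0 < p - 1 by rewrite subr_gt0.
have cW : 0 <= p / (p - 1) * \sum_j W j by rewrite mulr_ge0 ?divr_ge0 ?(ltW p0) ?(ltW p10) ?sumr_ge0.
have := dist_ge0 h t m0; rewrite le_eqVlt => /predU1P[<-|d0].
  by rewrite powR0 ?mulr0// invr_eq0 gt_eqF.
have : t * dist m h t <= p / (p - 1) * (\sum_j W j) * dist m h t `^ (1 - p^-1).
  apply: (@le_trans _ _ (\sum_(x | t < h x) m x * h x)).
    by rewrite /dist mulr_sumr; apply: ler_sum => x /ltW tx; rewrite mulrC ler_wpM2l.
  rewrite /h; under eq_bigr do rewrite mulr_sumr.
  rewrite exchange_big/= mulr_sumr mulr_suml; apply: ler_sum => j _.
  exact: sum_weak_restr_le.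
rewrite -{1}(powRr1 (ltW d0)) -{1}(subrK p^-1 1) gt0_powRD// mulrA mulrAC.
by rewrite ler_pM2r// powR_gt0.
Qed.

End SumBounds.

(** * Lacunary metric measure spaces *)

Section Lacunary.
Context {R : realType}.
Variable x : nat -> R.
Hypothesis x0 : forall k, 0 <= x k.
Hypothesis xlac : forall k, x k = 0 \/ 2 * \sum_(j < k) x j <= x k.

Let S n := \sum_(j < n) x j.
Let S0 n : 0 <= S n. Proof. by rewrite sumr_ge0. Qed.

(** The last nonzero term exceeds twice the sum of the earlier ones. Hence sum, maximum and r-th
    power sums of a lacunary sequence are all comparable, for every r > 0 and any number of
    terms. *)
Lemma lac_sum_le_max X n : 0 <= X -> (forall k, x k <= X) -> \sum_(j < n) x j <= 2 * X.
Proof.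
move=> X0 xX; elim: n => [|n IH]; first by rewrite big_ord0 mulr_ge0.
rewrite big_ord_recr/=; have [->|h] := xlac n; first by rewrite addr0.
have := xX n; have := S0 n; rewrite /S; lra.
Qed.

Lemma lac_powR_sum_le r n : 0 < r ->
  (\sum_(j < n) x j) `^ r <= 2 `^ r * \sum_(j < n) x j `^ r.
Proof.
move=> r0; elim: n => [|n IH]; first by rewrite !big_ord0 powR0 ?mulr0// gt_eqF.
rewrite !big_ord_recr/=; have [->|h] := xlac n.
  by rewrite (powR0 (lt0r_neq0 r0)) !addr0.
apply: (@le_trans _ _ ((2 * x n) `^ r)).
  apply: le_powR; rewrite ?(ltW r0) ?addr_ge0 ?(S0 n)//.
  by have := S0 n; rewrite /S; lra.
rewrite powRM// ler_wpM2l ?powR_ge0// lerDr sumr_ge0// => j _; exact: powR_ge0.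
Qed.

Lemma lac_sum_powR_le r n : 0 < r ->
  \sum_(j < n) x j `^ r <= (1 - 2 `^ (- r))^-1 * (\sum_(j < n) x j) `^ r.
Proof.
move=> r0; have k1 : 2 `^ (- r) < 1 :> R.
  by rewrite powRN invf_lt1 ?powR_gt0// powR_gt1// ltr1n.
set C := _^-1; have C0 : 0 < C by rewrite invr_gt0 subr_gt0.
elim: n => [|n IH]; first by rewrite !big_ord0 powR0 ?mulr0// gt_eqF.
rewrite !big_ord_recr/=; have [->|h] := xlac n.
  by rewrite (powR0 (lt0r_neq0 r0)) !addr0.
apply: (@le_trans _ _ (C * x n `^ r)); last first.
  by rewrite ler_wpM2l ?(ltW C0)// le_powR ?(ltW r0)// lerDr (S0 n).
have le1 : S n `^ r <= 2 `^ (- r) * x n `^ r.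
  have -> : 2 `^ (- r) * x n `^ r = (x n / 2) `^ r.
    by rewrite powRM// ?invr_ge0// mulrC -(@powR_inv1 R 2)// -powRrM mulN1r.
  by apply: le_powR; rewrite ?(ltW r0)//; rewrite /S; lra.
apply: (@le_trans _ _ (C * (2 `^ (- r) * x n `^ r) + x n `^ r)).
  by rewrite lerD2r (le_trans IH)// ler_wpM2l// ltW.
rewrite mulrA -{2}[x n `^ r]mul1r -mulrDl ler_wpM2r ?powR_ge0//.
have : C * (1 - 2 `^ (- r)) = 1 by rewrite /C mulVf// subr_eq0 gt_eqF.
lra.
Qed.

Lemma lac_poweR_series_le r : 0 < r ->
  ((\sum_(k <oo) (x k)%:E) `^ r <= (2 `^ r)%:E * \sum_(k <oo) (x k `^ r)%:E)%E.
Proof.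
move=> r0; set B := (X in (_ <= X)%E).
have B0 : (0 <= B)%E.
  by rewrite mule_ge0 ?lee_fin ?powR_ge0// nneseries_ge0// => k _ _; rewrite lee_fin powR_ge0.
(* Taking the r-th root of the bound reduces the claim to plain partial sums, so the limit need not
   pass through a power. *)
have Br : B = ((B `^ r^-1) `^ r)%E by rewrite -poweRrM mulVf ?gt_eqF// poweRe1.
rewrite Br; apply: gt0_ler_poweR; rewrite ?(ltW r0)//.
- by rewrite in_itv/= leey andbT nneseries_ge0// => k _ _; rewrite lee_fin.
- by rewrite in_itv/= leey andbT poweR_ge0.
apply: lime_le; first by apply: is_cvg_nneseries => k _ _; rewrite lee_fin.
apply: nearW => n; rewrite big_mkord sumEFin.
have Sr : ((\sum_(i < n) x i)%:E = ((\sum_(i < n) x i) `^ r)%:E `^ r^-1)%E.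
  by rewrite poweR_EFin powRK ?gt_eqF// (S0 n).
rewrite Sr; apply: gt0_ler_poweR; rewrite ?invr_ge0 ?(ltW r0)//.
- by rewrite in_itv/= leey andbT lee_fin powR_ge0.
- by rewrite in_itv/= leey andbT.
apply: (@le_trans _ _ ((2 `^ r)%:E * (\sum_(j < n) x j `^ r)%:E)%E).
  by rewrite -EFinM lee_fin; exact: lac_powR_sum_le.
apply: lee_wpmul2l; first by rewrite lee_fin powR_ge0.
rewrite -sumEFin -(big_mkord xpredT (fun k => (x k `^ r)%:E)).
by apply: nneseries_lim_ge => k _ _; rewrite lee_fin powR_ge0.
Qed.

End Lacunary.

Section Space.
Context {R : realType}.
Variables (s grp lo hi : nat -> nat) (al : nat -> R).
Hypothesis s_lt : forall k, (s k < s k.+1)%N.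
Hypothesis grpP : forall x, (s (grp x) <= x < s (grp x).+1)%N.
Hypothesis al_gt0 : forall k, 0 < al k.

(* Group [k] consists of the points [s k, ..., s k.+1 - 1], each of mass [al k].  A point of group
   [k] is adjacent to one point of each group in [lo k, hi k): the one whose rank in its group is
   congruent to the rank of the given point modulo the size of that group. *)
Definition low x y : bool := (lo (grp x) <= grp y < hi (grp x))%N &&
  (y - s (grp y) == (x - s (grp x)) %% (s (grp y).+1 - s (grp y)))%N.

(** For a point of group k and larger radii in order: up to 2k + 1 its ball is a singleton; up to 2k
    + 2 it gains the adjacent points, all in lower groups when [hi k <= k] throughout; up to 2k + 3
    it is the union of the groups up to k. *)
Definition rhon x y : nat := if x == y then 0%N else
  (2 * maxn (grp x) (grp y) + (if low x y || low y x then 1 else 2))%N.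

Definition rho x y : R := (rhon x y)%:R.

Lemma s_mono j k : (j <= k)%N -> (s j <= s k)%N.
Proof. by move=> jk; apply: (homo_leq (r := leq)) jk => //; [exact: leq_trans|move=> i; exact: ltnW]. Qed.

Lemma ltn_s x k : (x < s k)%N = (grp x < k)%N.
Proof.
have /andP[h1 h2] := grpP x; apply/idP/idP => h.
  rewrite ltnNge; apply/negP => /s_mono kx.
  by have := leq_trans (leq_trans h kx) h1; rewrite ltnn.
exact: leq_trans h2 (s_mono h).
Qed.

Lemma rhon_sym x y : rhon x y = rhon y x.
Proof. by rewrite /rhon eq_sym maxnC orbC. Qed.

(** The larger group on the left occurs in one of the two maxima on the right, and the two
    increments on the right, at least 1 each, cover the single increment on the left, at most 2. *)
Lemma rhon_tri x y z : (rhon x z <= rhon x y + rhon y z)%N.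
Proof.
rewrite /rhon; have [//|xz] := eqVneq x z.
have [<-|xy] := eqVneq x y; first by rewrite (negbTE xz).
have [<-|yz] := eqVneq y z; first by rewrite addn0.
case: ifP => _; case: ifP => _; case: ifP => _; lia.
Qed.

Definition m x : R := al (grp x).
Lemma m_gt0 x : 0 < m x. Proof. exact: al_gt0. Qed.

Definition mu : {measure set nat -> \bar R} :=
  mseries (fun n => mscale (NngNum (ltW (m_gt0 n))) (dirac n)) 0.

Lemma muE (A : set nat) : mu A = (\sum_(n <oo) (m n * (n \in A)%:R)%:E)%E.
Proof.
rewrite /mu /= /mseries; apply: eq_eseriesr => n _.
by rewrite EFinM -indicE.
Qed.

Lemma integral_muE (A : set nat) (f : nat -> R) : (forall n, 0 <= f n) ->
  (\int[mu]_(y in A) (f y)%:E = \sum_(n <oo) (m n * f n * (n \in A)%:R)%:E)%E.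
Proof.
move=> f0; rewrite ge0_integral_measure_series//; last by move=> y _; rewrite lee_fin.
apply: eq_eseriesr => n _.
rewrite ge0_integral_mscale//; last by move=> y _; rewrite lee_fin.
by rewrite integral_dirac// diracE -!EFinM/= -mulrA [f n * _]mulrC.
Qed.

Lemma nneseries_fin (F : nat -> R) N : (forall n, 0 <= F n) -> (forall n, (N <= n)%N -> F n = 0) ->
  (\sum_(n <oo) (F n)%:E = (\sum_(n < N) F n)%:E)%E.
Proof.
move=> F0 FN; rewrite (nneseries_split _ N) ?add0n; last by move=> k _; rewrite lee_fin.
rewrite eseries0 ?adde0; last by move=> k Nk _; rewrite FN.
by rewrite big_mkord sumEFin.
Qed.

Lemma mu_fin (A : set nat) N : (forall n, A n -> (n < N)%N) -> mu A = (\sum_(n < N | (n : nat) \in A) m n)%:E.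
Proof.
move=> AN; rewrite muE (@nneseries_fin _ N).
- congr EFin; rewrite [RHS]big_mkcond/=; apply: eq_bigr => n _.
  by case: ifP => _; rewrite ?mulr1 ?mulr0.
- by move=> n; rewrite mulr_ge0// ltW ?m_gt0.
- move=> n Nn; case: (boolP (n \in A)); rewrite ?mulr0//.
  by rewrite inE => /AN; rewrite ltnNge Nn.
Qed.

Lemma integral_mu_fin (A : set nat) N (f : nat -> R) : (forall n, 0 <= f n) -> (forall n, A n -> (n < N)%N) ->
  (\int[mu]_(y in A) (f y)%:E)%E = (\sum_(n < N | (n : nat) \in A) m n * f n)%:E.
Proof.
move=> f0 AN; rewrite integral_muE// (@nneseries_fin _ N).
- congr EFin; rewrite [RHS]big_mkcond/=; apply: eq_bigr => n _.
  by case: ifP => _; rewrite ?mulr1 ?mulr0.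
- by move=> n; rewrite !mulr_ge0// ltW ?m_gt0.
- move=> n Nn; case: (boolP (n \in A)); rewrite ?mulr0//.
  by rewrite inE => /AN; rewrite ltnNge Nn.
Qed.

Lemma rball_grp_lt x y (r : R) : rball rho x r y -> ((maxn (grp x) (grp y)).*2)%:R < r \/ x = y.
Proof.
rewrite /rball/= /rho /rhon; case: eqVneq => [->|_]; first by right.
move=> h; left; apply: le_lt_trans h; rewrite ler_nat; lia.
Qed.

Lemma rball_bounded x r : exists N, forall y, rball rho x r y -> (y < N)%N.
Proof.
exists (s (grp x + (Num.truncn `|r|).+1).+1) => y /rball_grp_lt[h|<-]; rewrite ltn_s.
  have : (maxn (grp x) (grp y)).*2%:R < (Num.truncn `|r|).+1%:R :> R.
    apply: (lt_le_trans h); apply: (le_trans (ler_norm r)).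
    by have /andP[_ /ltW] := truncn_itv (normr_ge0 r).
  by rewrite ltr_nat; lia.
lia.
Qed.

(** Distinct points are at distance at least 1, so every set is open. *)
Lemma space_borel : @measurable _ nat = <<s [set A | ropen rho A] >>.
Proof.
apply/seteqP; split => A // _; apply: sub_sigma_algebra => x Ax.
exists 1 => // y; rewrite /rball/= /rho /rhon; case: eqVneq => [<-//|_].
by rewrite (ltr_nat R _ 1); case: ifP; lia.
Qed.

Lemma rho_eq0 x y : rho x y = 0 <-> x = y.
Proof.
rewrite /rho /rhon; case: eqVneq => [->//|xy]; split => [/eqP|/eqP]; last by rewrite (negbTE xy).
by rewrite pnatr_eq0; case: ifP; lia.
Qed.

Lemma mu_ball_pos x r : 0 < r -> (0 < mu (rball rho x r))%E.
Proof.
move=> r0; have [N HN] := rball_bounded x r.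
have xB : rball rho x r x by rewrite /rball/= (rho_eq0 x x).2.
rewrite (mu_fin HN) lte_fin (bigD1 (Ordinal (HN _ xB)))/=; last by rewrite mem_set.
by rewrite ltr_pwDl ?m_gt0// sumr_ge0// => i _; rewrite ltW ?m_gt0.
Qed.

Lemma mu_ball_fin x r : 0 < r -> (mu (rball rho x r) < +oo)%E.
Proof. by move=> r0; have [N HN] := rball_bounded x r; rewrite (mu_fin HN) ltry. Qed.

Lemma rho_sym x y : rho x y = rho y x.
Proof. by rewrite /rho rhon_sym. Qed.

Lemma rho_tri x y z : rho x z <= rho x y + rho y z.
Proof. by rewrite /rho -natrD ler_nat rhon_tri. Qed.

Definition Z : @mms R := @MMS R default_measure_display nat rho mu (ex_intro _ 0%N I)
  (fun x y => ler0n _ _) rho_eq0 rho_sym rho_tri space_borel mu_ball_pos mu_ball_fin.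

End Space.

(** * Lorentz quasinorms over lacunary groups *)

Section Norms.
Context {R : realType}.
Variables (s grp lo hi : nat -> nat) (al : nat -> R).
Hypothesis s_lt : forall k, (s k < s k.+1)%N.
Hypothesis grpP : forall x, (s (grp x) <= x < s (grp x).+1)%N.
Hypothesis al_gt0 : forall k, 0 < al k.
Hypothesis lac : forall k, 2 * 4 ^+ k * \sum_(x < s k) al (grp x) <= al k.
Variable p : R.
Hypothesis p1 : 1 < p.

Local Notation X := (Z lo hi s_lt grpP al_gt0).
Local Notation leb := (@lebesgue_measure R).
Local Notation pos := (`]0%R, +oo[%classic : set R).
Implicit Types (g : nat -> \bar R) (f : nat -> R) (q t : R).

Let ltn_sE := @ltn_s s grp s_lt grpP.
Let p0 : 0 < p. Proof. exact: lt_trans p1. Qed.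

(** The measure of group [k], extended by zero to the finite type of all points below [s k.+1], so
    that the results on finite sums apply to it. *)
Definition mk k (x : 'I_(s k.+1)) : R := if grp x == k then al k else 0.
Definition dk k f : R -> R := dist (@mk k) (fun x => f x).

Lemma mk_ge0 k x : 0 <= @mk k x.
Proof. by rewrite /mk; case: ifP => // _; rewrite ltW. Qed.

Lemma dk_ge0 k f t : 0 <= dk k f t.
Proof. by apply: dist_ge0 => x; exact: mk_ge0. Qed.

Lemma measurable_dk k f : measurable_fun setT (dk k f).
Proof. by apply: measurable_dist => x; exact: mk_ge0. Qed.

Lemma s0 : s 0 = 0%N.
Proof.
have /andP[h _] := grpP 0; apply/eqP; rewrite -leqn0.
exact: leq_trans (s_mono s_lt (leq0n _)) h.
Qed.

Lemma sum_grp (F : nat -> R) K :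
  \sum_(n < s K) F n = \sum_(k < K) \sum_(n < s k.+1 | grp n == k) F n.
Proof.
elim: K => [|K IH]; first by rewrite s0 !big_ord0.
rewrite big_ord_recr/= -IH -!(big_mkord xpredT F).
rewrite -(big_mkord (fun n => grp n == K) F).
rewrite (big_cat_nat (n := s K))//=; last exact: ltnW.
rewrite [X in _ = _ + X](big_cat_nat (n := s K))//=; last exact: ltnW.
congr (_ + _); rewrite [X in _ = X + _]big1_seq ?add0r; last first.
  by move=> n /andP[/eqP gn]; rewrite mem_index_iota ltn_sE gn ltnn andbF.
rewrite [RHS]big_mkcond/= big_nat [RHS]big_nat; apply: eq_bigr => n /andP[h1 h2].
have -> // : grp n == K.
by rewrite eqn_leq -ltnS -ltn_sE h2 leqNgt -ltn_sE -leqNgt.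
Qed.

Lemma dkE k f t : dk k f t = \sum_(n < s k.+1 | grp n == k) al (grp n) * (t < f n)%R%:R.
Proof.
rewrite /dk /dist big_mkcond [RHS]big_mkcond; apply: eq_bigr => n _.
by rewrite /mk; case: eqP => [->|_]; case: ifP => _; rewrite ?mulr1 ?mulr0.
Qed.

(** A superlevel set either misses group [k] or contains an atom of it, and a single atom outweighs
    all earlier groups. *)
Lemma dk_lac f t k : dk k f t = 0 \/ 2 * \sum_(j < k) dk j f t <= dk k f t.
Proof.
have [h|h] := pselect (exists n : 'I_(s k.+1), grp n == k /\ t < f n); last first.
  left; rewrite dkE big1// => n gn; case: (ltP t (f n)) => tn; rewrite ?mulr0//.
  by exfalso; apply: h; exists n.
right; case: h => n [/eqP gn tn].
apply: (@le_trans _ _ (al k)); last first.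
  rewrite dkE (bigD1 n) ?gn//= tn mulr1 lerDl sumr_ge0// => i _.
  by rewrite mulr_ge0// ltW.
apply: le_trans (lac k); rewrite -mulrA ler_wpM2l//.
apply: (@le_trans _ _ (\sum_(x < s k) al (grp x))).
  rewrite (sum_grp (fun x => al (grp x))); apply: ler_sum => j _.
  rewrite dkE; apply: ler_sum => i _; case: (t < f i); rewrite ?mulr1 ?mulr0//.
  exact: ltW.
rewrite -{1}[\sum_(x < s k) _]mul1r ler_wpM2r ?exprn_ege1 ?ler1n//.
by rewrite sumr_ge0// => i _; rewrite ltW.
Qed.

(** Every set is measurable, so the outer measure in [distf] is [mu] itself. *)
Lemma distfE g t : distf (Z := X) g t =
  (\sum_(n <oo) (al (grp n) * (t%:E < `|g n|)%E%:R)%:E)%E.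
Proof.
pose A : set nat := [set x | (t%:E < `|g x|)%E].
transitivity (mu grp al_gt0 A).
  apply/eqP; rewrite eq_le; apply/andP; split.
    by apply: ereal_inf_lbound; exists A => //; split.
  apply: le_ereal_inf_tmp => _ [B [_ AB] <-].
  by apply: le_measure; rewrite ?inE.
rewrite muE; apply: eq_eseriesr => n _; congr (_ * _%:R)%:E.
by congr (nat_of_bool _); apply/idP/idP; rewrite inE.
Qed.

Lemma distf_ge0 g t : (0 <= distf (Z := X) g t)%E.
Proof. by rewrite distfE nneseries_ge0// => n _ _; rewrite lee_fin mulr_ge0 ?ler0n// ltW. Qed.

Lemma le_distf g g' t : (forall n, `|g n| <= `|g' n|)%E ->
  (distf (Z := X) g t <= distf (Z := X) g' t)%E.
Proof.
move=> gg; rewrite !distfE; apply: lee_nneseries => n _; rewrite ?lee_fin.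
  by rewrite mulr_ge0 ?ler0n// ltW.
rewrite ler_wpM2l ?(ltW (al_gt0 _))// ler_nat; case: (ltP t%:E `|g n|%E) => //= tg.
by rewrite (lt_le_trans tg (gg n)).
Qed.

Lemma measurable_distf g : measurable_fun pos (distf (Z := X) g).
Proof.
rewrite (_ : distf (Z := X) g = fun t => (\sum_(n <oo) (al (grp n) * (t%:E < `|g n|)%E%:R)%:E)%E); last first.
  by apply/funext => t; rewrite distfE.
apply: ge0_emeasurable_sum => n; first by move=> t _ _; rewrite lee_fin mulr_ge0 ?ler0n// ltW.
move=> _; apply/measurable_EFinP; apply: (@measurable_funS _ _ _ _ setT) => //.
apply: nonincreasing_measurable => // t u tu /=; rewrite ler_wpM2l ?(ltW (al_gt0 _))// ler_nat.
case: (ltP u%:E) => //= h; rewrite (le_lt_trans _ h)//.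
Qed.

Lemma distf_dk f t : (forall n, 0 <= f n) ->
  distf (Z := X) (EFin \o f) t = (\sum_(k <oo) (dk k f t)%:E)%E.
Proof.
move=> f0; rewrite distfE.
pose F n := al (grp n) * (t < f n)%R%:R.
have F0 n : 0 <= F n by rewrite mulr_ge0 ?ler0n// ltW.
rewrite (@eq_eseriesr _ _ (EFin \o F)); last first.
  by move=> n _; rewrite /F/= lte_fin ger0_norm.
have part K : \sum_(n < s K) F n = \sum_(k < K) dk k f t.
  by rewrite sum_grp; apply: eq_bigr => k _; rewrite dkE.
apply/eqP; rewrite eq_le; apply/andP; split.
  apply: lime_le; first by apply: is_cvg_nneseries => n _ _; rewrite lee_fin.
  apply: nearW => N.
  have Ns : (N <= s N)%N.
    elim: N => // N IH; exact: leq_ltn_trans IH (s_lt N).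
  apply: (@le_trans _ _ (\sum_(0 <= n < s N) (F n)%:E)%E).
    by apply: lee_sum_nneg_natr => // n _; rewrite lee_fin.
  rewrite big_mkord sumEFin part -sumEFin -(big_mkord xpredT (fun k => (dk k f t)%:E)).
  by apply: nneseries_lim_ge => k _ _; rewrite lee_fin dk_ge0.
apply: lime_le; first by apply: is_cvg_nneseries => n _ _; rewrite lee_fin dk_ge0.
apply: nearW => N; rewrite big_mkord sumEFin -part -sumEFin -(big_mkord xpredT (EFin \o F)).
by apply: nneseries_lim_ge => k _ _; rewrite lee_fin.
Qed.

Definition Jq q g := (\int[leb]_(t in pos) ((t `^ (q - 1))%:E * distf (Z := X) g t `^ (q / p)))%E.

Lemma lorentzE q g : 1 <= q ->
  lorentz (Z := X) p q%:E g = ((p `^ q^-1)%:E * Jq q g `^ q^-1)%E.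
Proof.
move=> q1; rewrite /lorentz; congr (_ * _ `^ _)%E; apply: eq_integral => t.
rewrite inE/= in_itv/= andbT => t0.
have q0 : 0 < q by exact: lt_le_trans q1.
rewrite poweRM ?poweR_ge0 ?lee_fin ?(ltW t0)// -poweRrM poweR_EFin.
rewrite [(p^-1 * q)%R]mulrC -muleA [(_ * t^-1%:E)%E]muleC muleA -EFinM.
by rewrite -(mulr_powRB1 (ltW t0) q0) mulrAC divff ?mul1r ?gt_eqF.
Qed.

Lemma measurable_Jq q g :
  measurable_fun pos (fun t => ((t `^ (q - 1))%:E * distf (Z := X) g t `^ (q / p))%E).
Proof.
apply: emeasurable_funM.
  by apply/measurable_EFinP; apply: (@measurable_funS _ _ _ _ setT) => //; exact: measurable_powR.
by apply: (measurableT_comp (measurable_poweR _)); exact: measurable_distf.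
Qed.

Lemma Jq_integrand_ge0 q g t : (0 <= (t `^ (q - 1))%:E * distf (Z := X) g t `^ (q / p))%E.
Proof. by rewrite mule_ge0 ?poweR_ge0// lee_fin powR_ge0. Qed.

Lemma Jq_ge0 q g : (0 <= Jq q g)%E.
Proof. by apply: integral_ge0 => t _; exact: Jq_integrand_ge0. Qed.

Lemma le_Jq q g g' : 1 <= q -> (forall n, `|g n| <= `|g' n|)%E -> (Jq q g <= Jq q g')%E.
Proof.
move=> q1 gg; apply: ge0_le_integral => //=.
- by move=> t _; exact: Jq_integrand_ge0.
- exact: measurable_Jq.
- exact: measurable_Jq.
- move=> t _; apply: lee_wpmul2l; first by rewrite lee_fin powR_ge0.
  apply: gt0_ler_poweR.
  + by rewrite divr_ge0 ?(ltW p0)// (le_trans _ q1).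
  + by rewrite in_itv/= leey andbT distf_ge0.
  + by rewrite in_itv/= leey andbT distf_ge0.
  + exact: le_distf.
Qed.

(** At each level the distribution function is a lacunary sum over the groups, so its power q/p is
    comparable to the sum of the powers; integrating gives this bound and the reverse one,
    [sum_Iq_le]. *)
Lemma Jq_le q f : 1 <= q -> (forall n, 0 <= f n) ->
  (Jq q (EFin \o f) <= (2 `^ (q / p))%:E * \sum_(k <oo) Iq p q (dk k f))%E.
Proof.
move=> q1 f0; have q0 : 0 < q by exact: lt_le_trans q1.
have qp : 0 < q / p by rewrite divr_gt0.
have I0 k t : (0 <= (t `^ (q - 1) * dk k f t `^ (q / p))%:E)%E.
  by rewrite lee_fin mulr_ge0 ?powR_ge0.
have mI k : measurable_fun pos (fun t => (t `^ (q - 1) * dk k f t `^ (q / p))%:E).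
  by apply: measurable_Iq; exact: measurable_dk.
rewrite /Iq -integral_nneseries//.
have mS : measurable_fun pos (fun t => (\sum_(k <oo) (t `^ (q - 1) * dk k f t `^ (q / p))%:E)%E).
  by apply: ge0_emeasurable_sum.
rewrite -ge0_integralZl_EFin ?powR_ge0//; last first.
  by move=> t _; apply: nneseries_ge0 => k _ _; exact: I0.
apply: ge0_le_integral => //=.
- by move=> t _; exact: Jq_integrand_ge0.
- exact: measurable_Jq.
- exact: measurable_funeM.
- move=> t; rewrite in_itv/= andbT => t0.
  under eq_eseriesr do rewrite EFinM.
  rewrite nneseriesZl; last by move=> k _; rewrite lee_fin powR_ge0.
  rewrite muleCA; apply: lee_wpmul2l; first by rewrite lee_fin powR_ge0.
  rewrite distf_dk//.
  by apply: lac_poweR_series_le => // k; [exact: dk_ge0|exact: dk_lac].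
Qed.

Lemma sum_Iq_le q f n : 1 <= q -> (forall n, 0 <= f n) ->
  (\sum_(k < n) Iq p q (dk k f) <= ((1 - 2 `^ (- (q / p)))^-1)%:E * Jq q (EFin \o f))%E.
Proof.
move=> q1 f0; have q0 : 0 < q by exact: lt_le_trans q1.
have qp : 0 < q / p by rewrite divr_gt0.
have C0 : 0 < 1 - 2 `^ (- (q / p)) :> R.
  by rewrite subr_gt0 powRN invf_lt1 ?powR_gt0// powR_gt1// ltr1n.
have I0 k t : (0 <= (t `^ (q - 1) * dk k f t `^ (q / p))%:E)%E.
  by rewrite lee_fin mulr_ge0 ?powR_ge0.
have mI k : measurable_fun pos (fun t => (t `^ (q - 1) * dk k f t `^ (q / p))%:E).
  by apply: measurable_Iq; exact: measurable_dk.
rewrite /Iq -ge0_integral_sum//; last by move=> k; exact: mI.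
rewrite -ge0_integralZl_EFin ?invr_ge0 ?(ltW C0)//; last 2 first.
- by move=> t _; exact: Jq_integrand_ge0.
- exact: measurable_Jq.
apply: ge0_le_integral => //=.
- by move=> t _; rewrite sume_ge0.
- by apply: emeasurable_sum => k; exact: mI.
- by apply: measurable_funeM; exact: measurable_Jq.
- move=> t _; rewrite sumEFin -mulr_sumr EFinM muleCA.
  apply: lee_wpmul2l; first by rewrite lee_fin powR_ge0.
  have h1 := @lac_sum_powR_le _ (fun k => dk k f t) (fun k => dk_ge0 k f t)
    (dk_lac f t) (q / p) n qp.
  apply: (@le_trans _ _ ((1 - 2 `^ (- (q / p)))^-1 * (\sum_(j < n) dk j f t) `^ (q / p))%:E).
    by rewrite lee_fin.
  rewrite EFinM; apply: lee_wpmul2l; first by rewrite lee_fin invr_ge0 ltW.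
  rewrite -poweR_EFin; apply: gt0_ler_poweR; rewrite ?(ltW qp)//.
  + by rewrite in_itv/= leey andbT lee_fin sumr_ge0// => k _; exact: dk_ge0.
  + by rewrite in_itv/= leey andbT distf_ge0.
  rewrite distf_dk// -sumEFin -(big_mkord xpredT (fun k => (dk k f t)%:E)).
  by apply: nneseries_lim_ge => k _ _; rewrite lee_fin dk_ge0.
Qed.

Lemma lorentz_pinftyE g (W : R) : 0 <= W ->
  (forall t, (0 < t)%R -> t%:E * distf (Z := X) g t `^ p^-1 <= W%:E)%E ->
  (lorentz (Z := X) p +oo g <= W%:E)%E.
Proof.
move=> W0 gW; apply: ge_ereal_sup => _ [t + <-].
by rewrite /= in_itv/= andbT => t0; exact: gW.
Qed.

(** A lacunary sum is at most twice its largest term, so weak bounds on the groups combine without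
    counting the groups. *)
Lemma lorentz_pinfty_le f (W : R) : 0 <= W -> (forall n, 0 <= f n) ->
  (forall k, weak_le p (dk k f) W) ->
  (lorentz (Z := X) p +oo (EFin \o f) <= (2 `^ p^-1 * W)%:E)%E.
Proof.
move=> W0 f0 fW; apply: lorentz_pinftyE; first by rewrite mulr_ge0 ?powR_ge0.
move=> t t0; have pi : 0 < p^-1 by rewrite invr_gt0.
pose B := (W / t) `^ p; have B0 : 0 <= B by rewrite powR_ge0.
have dB k : dk k f t <= B.
  have := fW k t t0; rewrite mulrC -ler_pdivlMr// => h.
  rewrite -[X in X <= _](@powRVK _ p) ?gt_eqF ?dk_ge0//.
  by apply: le_powR; [exact: ltW|exact: powR_ge0|].
have : (distf (Z := X) (EFin \o f) t <= (2 * B)%:E)%E.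
  rewrite distf_dk//; apply: lime_le.
    by apply: is_cvg_nneseries => n _ _; rewrite lee_fin dk_ge0.
  apply: nearW => N; rewrite big_mkord sumEFin lee_fin.
  exact: (@lac_sum_le_max _ (fun k => dk k f t) (fun k => dk_ge0 k f t) (dk_lac f t) B N B0 dB).
move=> h; apply: (@le_trans _ _ (t%:E * ((2 * B) `^ p^-1)%:E)%E).
  apply: lee_wpmul2l; first by rewrite lee_fin ltW.
  rewrite -poweR_EFin; apply: gt0_ler_poweR => //; first exact: ltW.
  + by rewrite in_itv/= leey andbT distf_ge0.
  + by rewrite in_itv/= leey andbT lee_fin mulr_ge0.
rewrite -EFinM lee_fin powRM// /B powRK ?gt_eqF ?divr_ge0 ?(ltW t0)//.
by rewrite mulrCA [t * _]mulrC divfK ?gt_eqF.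
Qed.

Lemma weak_le_lorentz f (W : R) k : (forall n, 0 <= f n) ->
  (lorentz (Z := X) p +oo (EFin \o f) <= W%:E)%E -> weak_le p (dk k f) W.
Proof.
move=> f0 fW t t0; rewrite -lee_fin; apply: le_trans fW.
apply: (@le_trans _ _ (t%:E * distf (Z := X) (EFin \o f) t `^ p^-1)%E); last first.
  by apply: ereal_sup_ubound; exists t => //=; rewrite in_itv/= t0.
rewrite EFinM; apply: lee_wpmul2l; first by rewrite lee_fin ltW.
rewrite -poweR_EFin; apply: gt0_ler_poweR; first by rewrite invr_ge0 ltW.
- by rewrite in_itv/= leey andbT lee_fin dk_ge0.
- by rewrite in_itv/= leey andbT distf_ge0.
rewrite distf_dk//; apply: (@le_trans _ _ (\sum_(0 <= j < k.+1) (dk j f t)%:E)%E).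
  by rewrite big_nat_recr//= leeDr// sume_ge0// => j _; rewrite lee_fin dk_ge0.
by apply: nneseries_lim_ge => j _ _; rewrite lee_fin dk_ge0.
Qed.

End Norms.

(** * Pointwise bound for the maximal function *)

Section MaximalBound.
Context {R : realType}.
Variables (s grp lo hi : nat -> nat) (al : nat -> R).
Hypothesis s_lt : forall k, (s k < s k.+1)%N.
Hypothesis grpP : forall x, (s (grp x) <= x < s (grp x).+1)%N.
Hypothesis al_gt0 : forall k, 0 < al k.
Hypothesis lac : forall k, 2 * 4 ^+ k * \sum_(x < s k) al (grp x) <= al k.
Hypothesis hi_le : forall k, (hi k <= k)%N.
Variable p : R.
Hypothesis p1 : 1 < p.

Local Notation X := (Z lo hi s_lt grpP al_gt0).
Local Notation mx := (fun n => al (grp n)).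
Let ltn_sE := @ltn_s s grp s_lt grpP.
Let p0 : 0 < p. Proof. exact: lt_trans p1. Qed.
Let p10 : 0 < p - 1. Proof. by rewrite subr_gt0. Qed.
Let al_ge0 k : 0 <= al k. Proof. exact: ltW. Qed.

Definition Mk k : R := \sum_(n < s k.+1 | grp n == k) al k.

Definition nbr i x := (s i + (x - s (grp x)) %% (s i.+1 - s i))%N.

Lemma grp_nbr i x : grp (nbr i x) = i.
Proof.
have h : (nbr i x < s i.+1)%N.
  by rewrite /nbr -ltn_subRL ltn_pmod// subn_gt0.
apply/eqP; rewrite eqn_leq -ltnS -ltn_sE h leqNgt -ltn_sE -leqNgt.
exact: leq_addr.
Qed.

Lemma lowE x y : low s grp lo hi x y = (lo (grp x) <= grp y < hi (grp x))%N && (y == nbr (grp y) x).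
Proof.
rewrite /low /nbr; congr (_ && _); have /andP[h _] := grpP y.
by rewrite -(eqn_add2l (s (grp y))) subnKC.
Qed.

(** A point and its lower neighbours together have a mass comparable to that of the point, so in the
    average over them a neighbour counts with the ratio of the atom masses. *)
Definition Tf (F : nat -> R) x : R :=
  \sum_(lo (grp x) <= i < hi (grp x)) F (nbr i x) * (al i / al (grp x)).

(** The first term is the influence of the lower groups, of total mass at most [4^-k * al k], on
    averages over group [k]; the second is that of balls reaching a higher group, whose atoms weigh
    at least [4^k] times group [k]. *)
Definition eps (k : nat) : R := (4^-1 ^+ k) `^ (1 - p^-1) + (4^-1 ^+ k) `^ p^-1.

Lemma al_le_Mk x : al (grp x) <= Mk (grp x).
Proof.
have /andP[_ h] := grpP x.
by rewrite /Mk (bigD1 (Ordinal h))//= lerDl sumr_ge0.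
Qed.

Lemma Mk_gt0 k : 0 < Mk k.
Proof.
have gk : grp (s k) = k.
  by apply/eqP; rewrite eqn_leq -ltnS -ltn_sE s_lt leqNgt -ltn_sE ltnn.
by have := al_le_Mk (s k); rewrite gk; apply: lt_le_trans.
Qed.

Lemma lac_le k : \sum_(x < s k) al (grp x) <= 4^-1 ^+ k * al k.
Proof.
rewrite exprVn ler_pdivlMl ?exprn_gt0//; apply: le_trans (lac k).
rewrite ler_wpM2r ?sumr_ge0//.
by rewrite ler_peMl ?exprn_ge0// ler1n.
Qed.

Lemma Mk_le_lac j k : (j < k)%N -> Mk j <= 4^-1 ^+ k * al k.
Proof.
move=> jk; apply: le_trans (lac_le k); rewrite (sum_grp s_lt grpP (fun n => al (grp n))).
rewrite (bigD1 (Ordinal jk))//= /Mk.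
rewrite [X in _ <= X + _](eq_bigr (fun=> al j)) ?lerDl ?sumr_ge0//.
  by move=> i _; rewrite sumr_ge0.
by move=> i /eqP ->.
Qed.

Section Bound.
Variables (f : nat -> R) (W : R) (Wk : nat -> R).
Hypothesis W0 : 0 <= W.
Hypothesis Wk0 : forall k, 0 <= Wk k.
Local Notation F := (fun n => `|f n|).
Hypothesis FW : forall N, weak_le p (dist (fun n : 'I_N => al (grp n)) (fun n => F n)) W.
Hypothesis FWk : forall k, weak_le p (@dk R s grp al k F) (Wk k).

(** Constant on group [k]: multiplied by [Mk k ^ (1/p)], its weak quasinorm there is of the order of
    the group bound [Wk k] plus a summable multiple of the global bound [W]. *)
Definition cbound k : R := p / (p - 1) * Mk k `^ (- p^-1) * (Wk k + eps k * W).

Let avg_weak (a : R) : 0 < a -> a `^ (1 - p^-1) / a = a `^ (- p^-1).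
Proof.
by move=> a0; rewrite -{2}(powRr1 (ltW a0)) -powRN -gt0_powRD//; congr (_ `^ _); ring.
Qed.

(** A ball of radius at most 2k + 2 around a point of group k holds only the point and lower
    neighbours. A larger ball contains the whole group k, and it is governed by its highest group,
    which is k or a later one. *)
Lemma maxc_le x : (maxc (Z := X) f x <= (Num.max (F x + Tf F x) (cbound (grp x)))%:E)%E.
Proof.
apply: ge_ereal_sup => _ [r + <-]; rewrite /= in_itv/= andbT => r0.
have [N BN] := rball_bounded lo hi s_lt grpP x r.
set k := grp x; set B := rball _ _ _.
have xB : B x by rewrite /B /rball/= (rho_eq0 _ _ _ _ _ _).2.
have -> : (\int[mms_mu X]_(y in B) `|f y|%:E)%E = (\sum_(n < N | (n : nat) \in B) al (grp n) * F n)%:E.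
  exact: (integral_mu_fin grp al_gt0 (fun n => normr_ge0 (f n)) BN).
have -> : fine (mms_mu X B) = \sum_(n < N | (n : nat) \in B) al (grp n).
  by rewrite (_ : mms_mu X B = mu grp al_gt0 B)// (mu_fin grp al_gt0 BN).
set num := \sum_(n < N | _) _ * _; set den := \sum_(n < N | _) _.
have xB' : x \in B by rewrite inE.
have kden : al k <= den.
  by rewrite /den (bigD1 (Ordinal (BN _ xB)))//= lerDl sumr_ge0.
have den0 : 0 < den by exact: lt_le_trans kden.
have BE y : B y -> y <> x -> (rhon s grp lo hi x y)%:R < r.
  by move=> + _; rewrite /B /rball/=.
rewrite -EFinM lee_fin mulrC le_max; have [rk|rk] := leP r (2 * k + 2)%:R.
  apply/orP; left; rewrite ler_pdivrMr//.
  apply: (@le_trans _ _ ((F x + Tf F x) * al k)); last first.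
    rewrite ler_wpM2l// addr_ge0//; apply: sumr_ge0 => i _.
    by rewrite mulr_ge0// divr_ge0.
  have -> : (F x + Tf F x) * al k = al k * F x + \sum_(lo k <= i < hi k) al i * F (nbr i x).
    rewrite mulrDl mulrC /Tf mulr_suml; congr (_ + _); apply: eq_bigr => i _.
    by rewrite -mulrA divfK ?gt_eqF// mulrC.
  rewrite /num (bigD1 (Ordinal (BN _ xB)))//= lerD2l.
  pose G n := al (grp n) * F n; have G0 n : 0 <= G n by rewrite mulr_ge0.
  apply: (@le_trans _ _ (\sum_(n < N) \sum_(lo k <= i < hi k) if (n : nat) == nbr i x then G n else 0)).
    rewrite big_mkcond/=; apply: ler_sum => n _; case: ifP => [/andP[nB nx]|_]; last first.
      by rewrite sumr_ge0// => i _; case: ifP.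
    have nx' : x != n by apply: contra nx => /eqP xn; apply/eqP/val_inj.
    have : low s grp lo hi x n.
      have := BE n; rewrite inE in nB; rewrite /rhon (negbTE nx') => /(_ nB (nesym (elimN eqP nx'))) nr.
      have := lt_le_trans nr rk; rewrite ltr_nat -/k.
      case: ifP => [/orP[//|]|_]; last by clear; lia.
      by rewrite /low -/k => /andP[/andP[_ h] _]; have := hi_le (grp n); move: h; clear; lia.
    rewrite lowE -/k => /andP[lh /eqP nE].
    rewrite (bigD1_seq (grp n)) ?mem_index_iota ?iota_uniq//= -nE eqxx lerDl sumr_ge0// => i _.
    by case: ifP.
  rewrite exchange_big/=; apply: ler_sum => i _.
  apply: (@le_trans _ _ (G (nbr i x))); last by rewrite /G grp_nbr.
  rewrite -big_mkcond/=; have [h|h] := ltnP (nbr i x) N.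
    by rewrite (big_pred1 (Ordinal h)).
  by rewrite big_pred0// => n; apply/negbTE/eqP => nE; have := ltn_ord n; rewrite nE ltnNge h.
apply/orP; right.
have [y yB ymax] : exists2 y, B y & forall z, B z -> (grp z <= grp y)%N.
  pose P (i : 'I_N) := (i : nat) \in B.
  have Px : P (Ordinal (BN _ xB)) by rewrite /P inE.
  have [j Pj jmax] := @arg_maxnP 'I_N (Ordinal (BN _ xB)) P (fun i => grp i) Px.
  exists j; first by move: Pj; rewrite /P inE.
  by move=> z zB; apply: (jmax (Ordinal (BN _ zB))); rewrite /P inE.
have numW : num <= p / (p - 1) * W * den `^ (1 - p^-1).
  exact: (@sum_weak_restr_le _ 'I_N (fun n => al (grp n)) (fun n => F n)
    (fun n => (n : nat) \in B) p W p1 W0 (fun n => al_ge0 _) (FW N)).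
have cp : 0 < p / (p - 1) by rewrite divr_gt0.
have pV : - p^-1 <= 0 by rewrite oppr_le0 invr_ge0 ltW.
have Q0 j : 0 <= (4^-1 ^+ j : R) by rewrite exprn_ge0// invr_ge0.
(* When a higher group is reached, one of its atoms already gives the ball at least [4^k] times the
   mass of group [k], and the global weak bound suffices. *)
have := ymax x xB; rewrite -/k leq_eqVlt => /predU1P[ky|ky]; last first.
  rewrite ler_pdivrMr//; apply: (le_trans numW).
  rewrite -ler_pdivrMr// -(mulrA (p / (p - 1) * W)) avg_weak// /cbound.
  rewrite -[X in X <= _]mulrA -[X in _ <= X]mulrA.
  rewrite ler_wpM2l ?(ltW cp)//.
  have yden : al (grp y) <= den.
    have yB' : y \in B by rewrite inE.
    by rewrite /den (bigD1 (Ordinal (BN _ yB)))//= lerDl sumr_ge0.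
  have h1 : den `^ (- p^-1) <= Mk k `^ (- p^-1) * eps k.
    apply: (@le_trans _ _ ((4 ^+ k * Mk k) `^ (- p^-1))).
      apply: ge_powR => //; first by rewrite mulr_gt0 ?exprn_gt0 ?Mk_gt0.
      apply: le_trans yden; have := Mk_le_lac ky; rewrite exprVn ler_pdivlMl ?exprn_gt0//.
      apply: le_trans; rewrite ler_wpM2r ?(ltW (Mk_gt0 _))//.
      by rewrite ler_weXn2l ?ler1n// ltnW.
    rewrite powRM ?exprn_ge0 ?(ltW (Mk_gt0 _))// mulrC ler_wpM2l ?powR_ge0//.
    rewrite /eps exprVn -(@powR_inv1 _ (4 ^+ k)) ?exprn_ge0// -!powRrM !mulN1r.
    by rewrite lerDr powR_ge0.
  apply: (@le_trans _ _ (W * (Mk k `^ (- p^-1) * eps k))); first by rewrite ler_wpM2l.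
  by rewrite mulrCA ler_wpM2l ?powR_ge0// mulrC lerDr.
(* The highest group is now [k] and the ball contains all of it: group [k] is estimated by [Wk k],
   the lower groups by [W] and their small total mass. *)
have kB n : grp n == k -> B n.
  move=> /eqP nk; have [->//|nx] := eqVneq n x.
  rewrite /B /rball/= /rho /rhon nk -/k eq_sym (negbTE nx); apply: le_lt_trans rk.
  by rewrite ler_nat maxnn leq_add2l; case: ifP.
have Bk n : B n -> (n < s k.+1)%N by move=> /ymax; rewrite -ky -ltnS -ltn_sE.
have reN (G : nat -> R) : \sum_(n < N | (n : nat) \in B) G n = \sum_(n < s k.+1 | (n : nat) \in B) G n.
  pose H n := if n \in B then G n else 0.
  have HE N1 : \sum_(n < N1 | (n : nat) \in B) G n = \sum_(0 <= n < N1) H n.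
    by rewrite big_mkord big_mkcond.
  have aux N1 N2 : (N1 <= N2)%N -> (forall n, B n -> (n < N1)%N) ->
      \sum_(0 <= n < N1) H n = \sum_(0 <= n < N2) H n.
    move=> N12 BN1; rewrite [RHS](big_cat_nat (n := N1))//=.
    rewrite [X in _ + X]big1_seq ?addr0// => n; rewrite mem_index_iota => /andP[_ /andP[h _]].
    by rewrite /H; case: ifP => //; rewrite inE => /BN1; rewrite ltnNge h.
  by rewrite !HE; have [h|/ltnW h] := leqP N (s k.+1); [exact: (aux _ _ h BN)|rewrite (aux _ _ h Bk)].
have Mden : Mk k <= den.
  rewrite /den (reN (fun n => al (grp n))) /Mk [X in _ <= X](bigID (fun n : 'I__ => grp n == k))/=.
  rewrite [X in _ <= X + _](eq_bigl (fun n : 'I__ => grp n == k)); last first.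
    by move=> n; apply/andb_idl => /kB; rewrite inE.
  rewrite (eq_bigr (fun n : 'I__ => al (grp n))) ?lerDl ?sumr_ge0//.
  by move=> n /eqP ->.
have num2 : num <= p / (p - 1) * Wk k * Mk k `^ (1 - p^-1) +
    p / (p - 1) * W * (4^-1 ^+ k * Mk k) `^ (1 - p^-1).
  apply: (@le_trans _ _ (\sum_(n < s k.+1 | grp n == k) al k * F n + \sum_(n < s k) al (grp n) * F n)).
    rewrite /num (reN (fun n => al (grp n) * F n)).
    have -> : \sum_(n < s k) al (grp n) * F n = \sum_(n < s k.+1 | grp n != k) al (grp n) * F n.
      have E := sum_grp s_lt grpP (fun n => al (grp n) * F n) k.+1.
      rewrite big_ord_recr/= -(sum_grp s_lt grpP (fun n => al (grp n) * F n)) in E.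
      apply: (addIr (\sum_(n < s k.+1 | grp n == k) al (grp n) * F n)); rewrite -E addrC.
      by rewrite (bigID (fun n : 'I_(s k.+1) => grp n == k)).
    rewrite [X in _ <= X + _](eq_bigr (fun n : 'I__ => al (grp n) * F n)); last by move=> n /eqP ->.
    have -> : \sum_(n < s k.+1 | grp n == k) al (grp n) * F n +
        \sum_(n < s k.+1 | grp n != k) al (grp n) * F n = \sum_(n < s k.+1) al (grp n) * F n.
      by rewrite [RHS](bigID (fun n : 'I_(s k.+1) => grp n == k)).
    rewrite [X in X <= _]big_mkcond/=.
    by apply: ler_sum => n _; case: ifP => // _; rewrite mulr_ge0.
  apply: lerD.
    have := @sum_weak_restr_le _ 'I_(s k.+1) (@mk R s grp al k) (fun n => F n) (fun n => grp n == k)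
      p (Wk k) p1 (Wk0 k) (@mk_ge0 R s grp al al_gt0 k) (FWk k).
    rewrite (eq_bigr (fun n : 'I__ => al k * F n)); last by move=> n nk; rewrite /mk nk.
    congr (_ <= _ * _ `^ _); apply: eq_bigr => n nk; by rewrite /mk nk.
  apply: le_trans (@sum_weak_restr_le _ 'I_(s k) (fun n => al (grp n)) (fun n => F n) predT
      p W p1 W0 (fun n => al_ge0 _) (FW _)) _.
  apply: ler_wpM2l; first by rewrite mulr_ge0// ltW.
  apply: le_powR; first by rewrite subr_ge0 invf_le1// ltW.
    by rewrite sumr_ge0.
  by apply: (le_trans (lac_le k)); rewrite ler_wpM2l// al_le_Mk.
apply: (@le_trans _ _ (num / Mk k)).
  by rewrite ler_wpM2l ?sumr_ge0// => [n _|]; rewrite ?mulr_ge0// lef_pV2 ?posrE ?Mk_gt0.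
rewrite ler_pdivrMr ?Mk_gt0//; apply: (le_trans num2).
rewrite /cbound powRM ?Q0 ?(ltW (Mk_gt0 _))// -(avg_weak (Mk_gt0 k)).
have -> : p / (p - 1) * (Mk k `^ (1 - p^-1) / Mk k) * (Wk k + eps k * W) * Mk k =
   p / (p - 1) * (Mk k `^ (1 - p^-1)) * (Wk k + eps k * W).
  by have /gt_eqF/negbT M0 := Mk_gt0 k; field; rewrite M0 gt_eqF.
have le1 : (4^-1 ^+ k) `^ (1 - p^-1) <= eps k by rewrite /eps lerDl powR_ge0.
have cM : 0 <= p / (p - 1) * Mk k `^ (1 - p^-1) by rewrite mulr_ge0 ?powR_ge0 ?(ltW cp).
have := ler_wpM2l cM (ler_wpM2r W0 le1); lra.
Qed.

End Bound.
End MaximalBound.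

(** * Transfer from a lower group to an upper one *)

Section Transfer.
Context {R : realType}.
Variables (s grp lo hi : nat -> nat) (al w : nat -> R).
Hypothesis s_lt : forall k, (s k < s k.+1)%N.
Hypothesis grpP : forall x, (s (grp x) <= x < s (grp x).+1)%N.
Hypothesis al_gt0 : forall k, 0 < al k.
Hypothesis w_gt0 : forall k, 0 < w k.
Variable p : R.
Hypothesis p1 : 1 < p.
Hypothesis Mk_ge : forall k, (w k * al k) `^ p <= Mk s grp al k.
Hypothesis Mk_le : forall k, Mk s grp al k <= 2 * (w k * al k) `^ p.
Hypothesis w_low : forall k i, (lo k <= i < hi k)%N -> w i = 1.
Hypothesis size_low : forall k i, (lo k <= i < hi k)%N -> (s i.+1 - s i <= s k.+1 - s k)%N.

Let ltn_sE := @ltn_s s grp s_lt grpP.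
Let p0 : 0 < p. Proof. exact: lt_trans p1. Qed.
Let al_ge0 k : 0 <= al k. Proof. exact: ltW. Qed.
Local Notation dK := (@dk R s grp al).
Local Notation mK := (@mk R s grp al).
Local Notation nb := (nbr s grp).

(** Elements of a residue class are told apart by their quotients, which take at most [L %/ d + 1]
    values; [d <= L] absorbs the 1 into the factor 2. *)
Lemma card_modn_le L d l : (0 < d <= L)%N -> (l < d)%N ->
  (d * #|[set a : 'I_L | (a %% d == l)%N]%SET| <= 2 * L)%N.
Proof.
move=> /andP[d0 dL] ld.
apply: (@leq_trans (d * (L %/ d).+1)); last first.
  by rewrite mulnS mulnC; have := leq_trunc_div L d; lia.
rewrite leq_pmul2l//; pose A := [set a : 'I_L | (a %% d == l)%N]%SET; rewrite -/A.
have hb (a : 'I_L) : (a %/ d < (L %/ d).+1)%N.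
  by rewrite ltnS leq_div2r// ltnW.
pose h (a : 'I_L) : 'I_(L %/ d).+1 := Ordinal (hb a).
have hinj : {in A &, injective h}.
  move=> a b; rewrite !finset.inE => /eqP ha /eqP hb' /(congr1 val)/= e.
  by apply/val_inj; rewrite /= (divn_eq a d) (divn_eq b d) e ha hb'.
by rewrite -(card_in_imset hinj) -[X in (_ <= X)%N]card_ord max_card.
Qed.

Lemma grp_eqE x k : (grp x == k) = (s k <= x < s k.+1)%N.
Proof. by rewrite eqn_leq -ltnS -ltn_sE [(k <= _)%N]leqNgt -ltn_sE -leqNgt andbC. Qed.

(** Adjacency by residues spreads the points of group [k] evenly over those of the smaller group
    [i]. *)
Lemma fiber_le k i y : (s i.+1 - s i <= s k.+1 - s k)%N -> (s i <= y < s i.+1)%N ->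
  ((s i.+1 - s i) * \sum_(x < s k.+1 | (grp x == k) && (nb i x == y)) 1 <= 2 * (s k.+1 - s k))%N.
Proof.
move=> Lik /andP[y1 y2]; set L := (s k.+1 - s k)%N; set d := (s i.+1 - s i)%N.
have sk := s_lt k; have si := s_lt i.
apply: (@leq_trans (d * #|[set a : 'I_L | (a %% d == y - s i)%N]%SET|)); last first.
  by apply: card_modn_le; rewrite /d /L; move: Lik; lia.
rewrite leq_mul2l; apply/orP; right.
rewrite -(big_mkord (fun x => (grp x == k) && (nb i x == y)) (fun=> 1%N)).
rewrite (big_cat_nat (n := s k))//=; last exact: ltnW.
rewrite big1_seq ?add0n; last first.
  by move=> n /andP[/andP[/eqP gn _]]; rewrite mem_index_iota ltn_sE gn ltnn andbF.
rewrite -{1}[s k]add0n big_addn -/L big_mkord sum1_card.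
rewrite -sum1_card -[X in (_ <= X)%N]sum1_card.
apply: eq_leq; apply: eq_bigl => a; rewrite finset.inE.
have ga : grp (a + s k) = k.
  by apply/eqP; rewrite grp_eqE leq_addl/=; have := ltn_ord a; rewrite /L; lia.
rewrite unfold_in/= ga eqxx/= /nbr ga addnK -/d.
by rewrite -(eqn_add2l (s i) _ (y - s i)) subnKC.
Qed.

Lemma Mk_size k : Mk s grp al k = al k * (s k.+1 - s k)%:R.
Proof.
rewrite /Mk -(big_mkord (fun n => grp n == k) (fun=> al k)).
rewrite (big_cat_nat (n := s k))//=; last exact: ltnW.
rewrite big1_seq ?add0r; last first.
  by move=> n /andP[/eqP gn]; rewrite mem_index_iota ltn_sE gn ltnn andbF.
rewrite big_nat_cond (eq_bigl (fun n => (s k <= n < s k.+1)%N)); last first.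
  by move=> n; rewrite grp_eqE andbb.
by rewrite -big_nat sumr_const_nat mulr_natr.
Qed.

Section OneGroup.
Variables (F : nat -> R) (k i : nat).
Hypothesis F0 : forall n, 0 <= F n.
Hypothesis ik : (lo k <= i < hi k)%N.
Local Notation g := (fun x : 'I_(s k.+1) => F (nb i x) * (al i / al k)).

(** Since the fibres of [nbr i] are even up to a factor 2, composing with it multiplies distribution
    functions by the ratio of the group masses, up to that factor; the ratio of atom masses rescales
    the level. *)
Lemma dist_nbr_le t : dist (@mK k) g t <=
  2 * Mk s grp al k / Mk s grp al i * dK i F (t / (al i / al k)).
Proof.
have l0 : 0 < al i / al k by rewrite divr_gt0.
set t' := t / _.
have hb (x : 'I_(s k.+1)) : (nb i x < s i.+1)%N by rewrite ltn_sE (grp_nbr s_lt grpP).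
pose h (x : 'I_(s k.+1)) : 'I_(s i.+1) := Ordinal (hb x).
have -> : dist (@mK k) g t = \sum_(x < s k.+1 | (grp x == k) && (t' < F (nb i x))) al k.
  rewrite /dist [RHS]big_mkcond [LHS]big_mkcond/=; apply: eq_bigr => x _.
  by rewrite /mk /t' ltr_pdivrMr//; case: (grp x == k); case: (t < _).
have -> : dK i F t' = \sum_(y < s i.+1 | (grp y == i) && (t' < F y)) al i.
  rewrite /dk /dist [RHS]big_mkcond [LHS]big_mkcond/=; apply: eq_bigr => x _.
  by rewrite /mk; case: (grp x == i); case: (t' < _).
rewrite (partition_big h (fun y : 'I_(s i.+1) => (grp y == i) && (t' < F y)))/=; last first.
  by move=> x /andP[_ h']; rewrite (grp_nbr s_lt grpP) eqxx.
rewrite mulr_sumr; apply: ler_sum => y /andP[gy _].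
apply: (@le_trans _ _ (\sum_(x < s k.+1 | (grp x == k) && (nb i x == y)) al k)).
  rewrite big_mkcond [X in _ <= X]big_mkcond/=; apply: ler_sum => x _.
  have -> : (h x == y) = (nb i x == y) by [].
  by case: (grp x == k); case: (t' < _); case: (nb i x == y); rewrite /= ?lexx ?al_ge0.
rewrite sumr_const !Mk_size.
have := fiber_le (size_low ik) (_ : (s i <= y < s i.+1)%N); rewrite -grp_eqE gy => /(_ isT).
rewrite sum1_card; set c := #|_|; rewrite -(ler_nat R) !natrM.
have Li : 0 < (s i.+1 - s i)%:R :> R by rewrite ltr0n subn_gt0.
have Lk : 0 < (s k.+1 - s k)%:R :> R by rewrite ltr0n subn_gt0.
have ai := al_gt0 i; have ak := al_gt0 k.
move=> h1; rewrite -(mulr_natr (al k)).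
have -> : 2 * (al k * (s k.+1 - s k)%:R) / (al i * (s i.+1 - s i)%:R) * al i =
   al k * (2 * (s k.+1 - s k)%:R / (s i.+1 - s i)%:R).
  by field; rewrite !gt_eqF.
by rewrite ler_wpM2l// ler_pdivlMr// mulrC.
Qed.

(** The group masses are [(w k * al k)^p] and [(al i)^p] up to factors 2, so the atom masses cancel
    and only [w k] remains. *)
Lemma transfer_const : (al i / al k) * (2 * Mk s grp al k / Mk s grp al i) `^ p^-1 <= 4 `^ p^-1 * w k.
Proof.
have ai := al_gt0 i; have ak := al_gt0 k; have wk := w_gt0 k.
have Mi : 0 < Mk s grp al i by apply: Mk_gt0.
have le1 : 2 * Mk s grp al k / Mk s grp al i <= 4 * ((w k * al k) / al i) `^ p.
  rewrite ler_pdivrMr//.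
  have := Mk_ge i; rewrite (w_low ik) mul1r => Mige.
  have e : (w k * al k) `^ p = ((w k * al k) / al i) `^ p * al i `^ p.
    by rewrite -powRM ?divfK ?gt_eqF ?divr_ge0 ?mulr_ge0 ?(ltW wk).
  have := Mk_le k; rewrite e; have := ler_wpM2l (powR_ge0 (w k * al k / al i) p) Mige.
  lra.
have := le_powR (_ : 0 <= p^-1) _ le1; rewrite invr_ge0 (ltW p0) => /(_ isT).
rewrite divr_ge0 ?mulr_ge0 ?(ltW (Mk_gt0 s_lt grpP al_gt0 _))// => /(_ isT) h.
have aik : 0 <= al i / al k by rewrite divr_ge0.
apply: le_trans (ler_wpM2l aik h) _.
rewrite powRM ?powR_ge0// powRK ?gt_eqF ?divr_ge0 ?mulr_ge0 ?(ltW wk)//.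
by rewrite le_eqVlt; apply/orP; left; apply/eqP; field; rewrite !gt_eqF.
Qed.

Lemma Iq_nbr_le q : 1 <= q ->
  (Iq p q (dist (@mK k) g) <= ((4 `^ p^-1 * w k) `^ q)%:E * Iq p q (dK i F))%E.
Proof.
move=> q1; have q0 : 0 < q by exact: lt_le_trans q1.
have l0 : 0 < al i / al k by rewrite divr_gt0.
have c0 : 0 <= 2 * Mk s grp al k / Mk s grp al i.
  by rewrite divr_ge0 ?mulr_ge0 ?(ltW (Mk_gt0 s_lt grpP al_gt0 _)).
have md : measurable_fun setT (dK i F) by exact: measurable_dk.
apply: (@le_trans _ _ (Iq p q (fun t => 2 * Mk s grp al k / Mk s grp al i * dK i F (t / (al i / al k))))).
  have := @le_Iq R p q 1 (dist (@mK k) g) (fun t => 2 * Mk s grp al k / Mk s grp al i * dK i F (t / (al i / al k))) ler01.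
  rewrite mul1e; apply.
  - by apply: measurable_dist => x; exact: mk_ge0.
  - apply: measurable_funM => //; apply: (measurableT_comp md); exact: measurable_funM.
  - move=> t t0; rewrite mul1r le_powR ?divr_ge0 ?(ltW p0) ?(ltW q0) ?dist_nbr_le//.
    by apply: dist_ge0 => x; exact: mk_ge0.
have -> := Iq_scale p q0 l0 c0 (@dk_ge0 R s grp al al_gt0 i F) md.
apply: lee_wpmul2r; first exact: Iq_ge0.
rewrite lee_fin [q / p]mulrC powRrM -powRM ?powR_ge0 ?(ltW l0)//.
apply: le_powR; [exact: ltW| |exact: transfer_const].
by rewrite mulr_ge0 ?powR_ge0// ltW.
Qed.

Lemma weak_nbr_le W : weak_le p (dK i F) W -> weak_le p (dist (@mK k) g) (4 `^ p^-1 * w k * W).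
Proof.
move=> FW t t0; have l0 : 0 < al i / al k by rewrite divr_gt0.
have c0 : 0 <= 2 * Mk s grp al k / Mk s grp al i.
  by rewrite divr_ge0 ?mulr_ge0 ?(ltW (Mk_gt0 s_lt grpP al_gt0 _)).
have pi : 0 <= p^-1 by rewrite invr_ge0 ltW.
have tl0 : 0 < t / (al i / al k) by rewrite divr_gt0.
have h := FW _ tl0.
have W0 : 0 <= W by apply: le_trans h; rewrite mulr_ge0 ?powR_ge0 ?(ltW tl0).
apply: (@le_trans _ _ (t * (2 * Mk s grp al k / Mk s grp al i * dK i F (t / (al i / al k))) `^ p^-1)).
  rewrite ler_wpM2l ?(ltW t0)// le_powR ?dist_nbr_le//.
  by apply: dist_ge0 => x; exact: mk_ge0.
rewrite powRM ?dk_ge0//; apply: le_trans (ler_wpM2r W0 transfer_const).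
rewrite -mulrA -[X in _ <= X]mulrA; set a := _ `^ p^-1; set b := _ `^ p^-1 in h *.
apply: le_trans (_ : (al i / al k) * (a * ((t / (al i / al k)) * b)) <= _); last first.
  by rewrite ler_wpM2l ?(ltW l0)// ler_wpM2l ?powR_ge0.
by rewrite le_eqVlt; apply/orP; left; apply/eqP; field; rewrite !gt_eqF.
Qed.

End OneGroup.

End Transfer.

(** Bookkeeping for raising the exponent from q to r: the factor [o ^ q] of the mass becomes
    [o ^ r], while [S] stays linear and can be summed. *)
Lemma powR_combine {R : realType} (q r c o S : R) : 0 < q -> 0 < r -> 0 <= c -> 0 <= o -> 0 <= S ->
  ((q * (c * o `^ q * S)) `^ q^-1) `^ (r - q) * (c * o `^ q * S) =
  ((q * S) `^ q^-1) `^ (r - q) * (c `^ (r / q) * (o `^ r * S)).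
Proof.
move=> q0 r0 c0 o0 S0; have qn : q != 0 by rewrite gt_eqF.
have a0 : 0 <= c * o `^ q by rewrite mulr_ge0 ?powR_ge0.
have aE : c `^ (r / q) * o `^ r = (c * o `^ q) `^ (r / q).
  by rewrite powRM ?powR_ge0// -powRrM mulrCA divff// mulr1.
rewrite [X in _ = _ * X]mulrA aE; move: (c * o `^ q) a0 => a a0.
have e : (a `^ q^-1) `^ (r - q) * a = a `^ (r / q).
  rewrite -{2}[a](@powRVK _ q)// -powRD ?subrK; first by rewrite -powRrM mulrC.
  by rewrite gt_eqF.
rewrite -e; have -> : q * (a * S) = (q * S) * a by ring.
by rewrite (powRM _ (mulr_ge0 (ltW q0) S0) a0) powRM ?powR_ge0// -!mulrA.
Qed.

(** * Upper bounds *)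

Section Upper.
Context {R : realType}.
Variables (s grp lo hi : nat -> nat) (al w : nat -> R).
Hypothesis s_lt : forall k, (s k < s k.+1)%N.
Hypothesis grpP : forall x, (s (grp x) <= x < s (grp x).+1)%N.
Hypothesis al_gt0 : forall k, 0 < al k.
Hypothesis lac : forall k, 2 * 4 ^+ k * \sum_(x < s k) al (grp x) <= al k.
Hypothesis hi_le : forall k, (hi k <= k)%N.
Hypothesis w_gt0 : forall k, 0 < w k.
Variable p : R.
Hypothesis p1 : 1 < p.
Hypothesis Mk_ge : forall k, (w k * al k) `^ p <= Mk s grp al k.
Hypothesis Mk_le : forall k, Mk s grp al k <= 2 * (w k * al k) `^ p.
Hypothesis w_low : forall k i, (lo k <= i < hi k)%N -> w i = 1.
Hypothesis size_low : forall k i, (lo k <= i < hi k)%N -> (s i.+1 - s i <= s k.+1 - s k)%N.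

Local Notation X := (Z lo hi s_lt grpP al_gt0).
Local Notation dK := (@dk R s grp al).
Local Notation mK := (@mk R s grp al).
Local Notation nbr := (nbr s grp).
Local Notation TF := (@Tf R s grp lo hi al).
Let ltn_sE := @ltn_s s grp s_lt grpP.
Let p0 : 0 < p. Proof. exact: lt_trans p1. Qed.
Let pi0 : 0 <= p^-1. Proof. by rewrite invr_ge0 ltW. Qed.
Let al_ge0 k : 0 <= al k. Proof. exact: ltW. Qed.
Let dK0 k F t : 0 <= dK k F t. Proof. exact: dk_ge0. Qed.
Let mdK k F : measurable_fun setT (dK k F). Proof. exact: measurable_dk. Qed.
Let Mk0 k : 0 < Mk s grp al k. Proof. exact: Mk_gt0. Qed.

(** Up to constants, the norm of [Tf] from the lower groups of [k] to group [k], with u = 1/q. *)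
Definition omega (u : R) k : R := w k * ((hi k - lo k)%:R `^ (1 - u)).

Lemma omega_ge0 u k : 0 <= omega u k.
Proof. by rewrite mulr_ge0 ?powR_ge0 ?(ltW (w_gt0 _)). Qed.

Lemma dk_TfE k (F : nat -> R) : dK k (TF F) = dist (@mK k)
  (fun x => \sum_(j < hi k - lo k) F (nbr (j + lo k) x) * (al (j + lo k) / al k)).
Proof.
apply/funext => t; rewrite /dk /dist big_mkcond [RHS]big_mkcond; apply: eq_bigr => x _.
rewrite /mk; case: eqP => [xk|_]; last by rewrite !if_same.
by rewrite /Tf xk -{1}[lo k]add0n big_addn big_mkord.
Qed.

Let in_low k (j : 'I_(hi k - lo k)) : (lo k <= j + lo k < hi k)%N.
Proof. by rewrite leq_addl/=; have := ltn_ord j; lia. Qed.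

Lemma Iq_Tf_le q : 1 <= q -> exists2 C, 0 < C & forall k (F : nat -> R), (forall n, 0 <= F n) ->
  (Iq p q (dK k (TF F)) <= (C * omega q^-1 k `^ q)%:E * \sum_(lo k <= i < hi k) Iq p q (dK i F))%E.
Proof.
move=> q1; have q0 : 0 < q by exact: lt_le_trans q1.
have [C C0 HC] := Iq_sum p1 q1.
exists (C * (4 `^ p^-1) `^ q); first by rewrite mulr_gt0 ?powR_gt0.
move=> k F F0; rewrite dk_TfE.
have g0 (j : 'I_(hi k - lo k)) (x : 'I_(s k.+1)) : 0 <= F (nbr (j + lo k) x) * (al (j + lo k) / al k).
  by rewrite mulr_ge0// divr_ge0.
have := HC _ (@mK k) _ (fun j x => F (nbr (j + lo k) x) * (al (j + lo k) / al k))
  (@mk_ge0 R s grp al al_gt0 k) g0.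
move=> /le_trans; apply.
have -> : C * (4 `^ p^-1) `^ q * omega q^-1 k `^ q =
    C * (hi k - lo k)%:R `^ (q - 1) * (4 `^ p^-1 * w k) `^ q.
  rewrite /omega !powRM ?powR_ge0 ?(ltW (w_gt0 _))//.
  rewrite -[((_ - _)%:R `^ _) `^ q]powRrM mulrBl mul1r mulVf ?gt_eqF//; ring.
rewrite [X in (_ <= X * _)%E]EFinM -muleA.
apply: lee_wpmul2l; first by rewrite lee_fin mulr_ge0 ?powR_ge0 ?(ltW C0).
have -> : (\sum_(lo k <= i < hi k) Iq p q (dK i F) =
    \sum_(j < hi k - lo k) Iq p q (dK (j + lo k) F))%E.
  by rewrite -{1}[lo k]add0n big_addn big_mkord.
rewrite ge0_sume_distrr; last by move=> j _; exact: Iq_ge0.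
apply: lee_sum => j _; apply: Iq_nbr_le (in_low j) _ q1 => //.
Qed.

Lemma weak_Tf_le k (F : nat -> R) V : (forall n, 0 <= F n) -> 0 <= V ->
  (forall i, weak_le p (dK i F) V) ->
  weak_le p (dK k (TF F)) (p / (p - 1) * 4 `^ p^-1 * omega 0 k * V).
Proof.
move=> F0 V0 FV; rewrite dk_TfE.
have g0 (j : 'I_(hi k - lo k)) : 0 <= 4 `^ p^-1 * w k * V.
  by rewrite !mulr_ge0 ?powR_ge0 ?(ltW (w_gt0 _)).
have := @weak_sum R _ (@mK k) (hi k - lo k) (fun j x => F (nbr (j + lo k) x) * (al (j + lo k) / al k))
  (fun=> 4 `^ p^-1 * w k * V) p p1 (@mk_ge0 R s grp al al_gt0 k) g0.
rewrite sumr_const card_ord -(mulr_natl (4 `^ p^-1 * w k * V)).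
have -> : p / (p - 1) * ((hi k - lo k)%:R * (4 `^ p^-1 * w k * V)) = p / (p - 1) * 4 `^ p^-1 * omega 0 k * V.
  by rewrite /omega subr0 powRr1//; ring.
apply=> j; apply: weak_nbr_le (in_low j) _ _ => //.
Qed.

Lemma dist_weak_le (F : nat -> R) V N : (forall n, 0 <= F n) -> 0 <= V ->
  (forall k, weak_le p (dK k F) V) ->
  weak_le p (dist (fun n : 'I_N => al (grp n)) (fun n => F n)) (2 `^ p^-1 * V).
Proof.
move=> F0 V0 FV t t0.
pose B := (V / t) `^ p; have B0 : 0 <= B by rewrite powR_ge0.
have dB k : dK k F t <= B.
  have := FV k t t0; rewrite mulrC -ler_pdivlMr// => h.
  rewrite -[X in X <= _](@powRVK _ p) ?gt_eqF//.
  by apply: le_powR; [exact: ltW|exact: powR_ge0|].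
have h : dist (fun n : 'I_N => al (grp n)) (fun n => F n) t <= 2 * B.
  have := @lac_sum_le_max _ (fun k => dK k F t) (fun k => dK0 k F t)
    (dk_lac s_lt grpP al_gt0 lac F t) B N B0 dB.
  apply: le_trans; pose G n := al (grp n) * (t < F n)%R%:R.
  have G0 n : 0 <= G n by rewrite mulr_ge0 ?ler0n.
  have -> : \sum_(j < N) dK j F t = \sum_(n < s N) G n.
    by rewrite (sum_grp s_lt grpP); apply: eq_bigr => j _; rewrite dkE.
  rewrite /dist big_mkcond/= (eq_bigr (fun n : 'I_N => G n)); last first.
    by move=> n _; rewrite /G; case: ifP; rewrite ?mulr1 ?mulr0.
  have Ns M : (M <= s M)%N by elim: M => // M IH; exact: leq_ltn_trans IH (s_lt M).
  rewrite -!(big_mkord xpredT G) [X in _ <= X](big_cat_nat (n := N))//=.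
  by rewrite lerDl sumr_ge0.
apply: (@le_trans _ _ (t * (2 * B) `^ p^-1)).
  by rewrite ler_wpM2l ?(ltW t0)// le_powR// dist_ge0.
rewrite powRM// /B powRK ?gt_eqF ?divr_ge0 ?(ltW t0)//.
by rewrite mulrCA [t * _]mulrC divfK ?gt_eqF.
Qed.

Lemma eps_le k : eps p k <= 2.
Proof.
have h x : 0 <= x -> (4^-1 ^+ k) `^ x <= 1 :> R.
  move=> x0; suff : (4^-1 ^+ k) `^ x <= 1 `^ x :> R by rewrite powR1.
  have q1 : 4^-1 <= 1 :> R by lra.
  have q0 : 0 <= 4^-1 :> R by lra.
  exact: (le_powR x0 (exprn_ge0 _ q0) (exprn_ile1 _ q0 q1)).
rewrite /eps; have := h p^-1 pi0.
have : 0 <= 1 - p^-1 by rewrite subr_ge0 invf_le1// ltW.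
by move=> /h; lra.
Qed.

(** [eps] is a sum of two geometric sequences with ratios below 1, and powers with exponent r >= 1
    only decrease such terms. *)
Lemma sum_eps_le r : 1 <= r -> exists2 C, 0 <= C & forall n, \sum_(k < n) eps p k `^ r <= C.
Proof.
move=> r1; have r0 : 0 < r by exact: lt_le_trans r1.
pose a x : R := 4^-1 `^ x.
have a0 x : 0 < a x by rewrite powR_gt0// invr_gt0.
have a1 x : 0 < x -> a x < 1.
  move=> x0; rewrite /a -(@powR_inv1 R 4)// -powRrM mulN1r powRN invf_lt1 ?powR_gt0//.
  by rewrite powR_gt1// ltr1n.
have geo x n : 0 < x -> \sum_(k < n) a x ^+ k <= (1 - a x)^-1.
  move=> x0; have h : 0 < 1 - a x by rewrite subr_gt0 a1.
  rewrite -[X in _ <= X]mul1r ler_pdivlMr//.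
  have := subrX1 (a x) n; have := exprn_ge0 n (ltW (a0 x)); lra.
have pp : 0 < 1 - p^-1 by rewrite subr_gt0 invf_lt1.
have ppi : 0 < p^-1 by rewrite invr_gt0.
exists (2 `^ r * ((1 - a (1 - p^-1))^-1 + (1 - a p^-1)^-1)).
  by rewrite mulr_ge0 ?powR_ge0// addr_ge0// invr_ge0 subr_ge0 ltW ?a1.
move=> n; apply: (@le_trans _ _ (\sum_(k < n) 2 `^ r * (a (1 - p^-1) ^+ k + a p^-1 ^+ k))); last first.
  by rewrite -mulr_sumr ler_wpM2l ?powR_ge0// big_split/= lerD// geo.
apply: ler_sum => k _; have pw x : (4^-1 ^+ k) `^ x = a x ^+ k.
  by rewrite /a -powR_mulrn ?invr_ge0// powRAC powR_mulrn ?powR_ge0.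
have le1 x : 0 < x -> (a x ^+ k) `^ r <= a x ^+ k.
  by move=> x0; apply: ge1r_powR => //; rewrite exprn_gt0// exprn_ile1// ltW// a1.
apply: (le_trans (powR_add_le (ltW r0) (powR_ge0 _ _) (powR_ge0 _ _))).
by rewrite ler_wpM2l ?powR_ge0// !pw lerD// le1.
Qed.

(** Interpolation with weak L^p: the integrand for r is that for q times [(t * d t^(1/p))^(r - q)],
    and this factor is at most [V^(r - q)]. *)
Lemma Iq_weak_le q r (d : R -> R) V : 1 <= q -> q <= r -> (forall t, 0 <= d t) ->
  measurable_fun setT d -> weak_le p d V -> 0 <= V ->
  (Iq p r d <= (V `^ (r - q))%:E * Iq p q d)%E.
Proof.
move=> q1 qr d0 md dV V0; have q0 : 0 < q by exact: lt_le_trans q1.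
have r0 : 0 < r by exact: lt_le_trans qr.
have rq0 : 0 <= r - q by rewrite subr_ge0.
rewrite -ge0_integralZl_EFin ?powR_ge0//; last 2 first.
- by move=> t _; rewrite lee_fin mulr_ge0 ?powR_ge0.
- exact: measurable_Iq.
apply: ge0_le_integral => //=.
- by move=> t _; rewrite lee_fin mulr_ge0 ?powR_ge0.
- exact: measurable_Iq.
- by apply: measurable_funeM; exact: measurable_Iq.
- move=> t; rewrite in_itv/= andbT => t0; rewrite -EFinM lee_fin.
  have -> : r - 1 = (r - q) + (q - 1) by ring.
  have -> : r / p = (r - q) / p + q / p by rewrite -mulrDl subrK.
  rewrite (gt0_powRD (r - q) (q - 1) t0) (@powRD _ (d t) ((r - q) / p)); last first.
    by rewrite -mulrDl subrK mulf_eq0 invr_eq0 (gt_eqF r0) (gt_eqF p0).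
  rewrite mulrACA; apply: ler_wpM2r; first by rewrite mulr_ge0 ?powR_ge0.
  rewrite [(r - q) / p]mulrC powRrM -powRM ?powR_ge0 ?(ltW t0)//.
  by apply: le_powR => //; [rewrite mulr_ge0 ?powR_ge0 ?(ltW t0)|exact: dV].
Qed.

Lemma Iq_le3 r (d d1 d2 d3 : R -> R) : 1 <= r ->
  (forall t, 0 <= d t) -> (forall t, 0 <= d1 t) -> (forall t, 0 <= d2 t) -> (forall t, 0 <= d3 t) ->
  measurable_fun setT d -> measurable_fun setT d1 -> measurable_fun setT d2 ->
  measurable_fun setT d3 -> (forall t, 0 < t -> d t <= d1 t + d2 t + d3 t) ->
  (Iq p r d <= (4 `^ (r / p))%:E * (Iq p r d1 + Iq p r d2 + Iq p r d3))%E.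
Proof.
move=> r1 d0 d10 d20 d30 md md1 md2 md3 dd.
have r0 : 0 < r by exact: lt_le_trans r1.
have s0 : 0 <= r / p by rewrite divr_ge0// ltW.
have I0 (e : R -> R) t : (0 <= (t `^ (r - 1) * e t `^ (r / p))%:E)%E.
  by rewrite lee_fin mulr_ge0 ?powR_ge0.
pose i (e : R -> R) t := ((t `^ (r - 1) * e t `^ (r / p))%:E : \bar R).
have mi e : measurable_fun setT e -> measurable_fun (`]0%R, +oo[%classic : set R) (i e).
  exact: measurable_Iq.
have m12 := emeasurable_funD (mi _ md1) (mi _ md2).
have m123 := emeasurable_funD m12 (mi _ md3).
have -> : (Iq p r d1 + Iq p r d2 + Iq p r d3 =
    \int[@lebesgue_measure R]_(t in `]0%R, +oo[) (i d1 t + i d2 t + i d3 t))%E.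
  rewrite [RHS]ge0_integralD//; last 3 first.
  - by move=> t _; rewrite adde_ge0 ?I0.
  - by move=> t _; exact: I0.
  - exact: mi.
  rewrite ge0_integralD//; [by move=> t _; exact: I0|exact: mi|by move=> t _; exact: I0|exact: mi].
rewrite -ge0_integralZl_EFin ?powR_ge0//; last first.
  by move=> t _; rewrite !adde_ge0 ?I0.
apply: ge0_le_integral => //=.
- exact: measurable_Iq.
- exact: measurable_funeM.
- move=> t; rewrite in_itv/= andbT => t0; rewrite -!EFinD -EFinM lee_fin -!mulrDr mulrCA.
  rewrite ler_wpM2l ?powR_ge0//.
  apply: (le_trans (le_powR s0 (d0 t) (dd t t0))).
  apply: (le_trans (powR_add_le s0 (addr_ge0 (d10 t) (d20 t)) (d30 t))).
  have -> : 4 `^ (r / p) = 2 `^ (r / p) * 2 `^ (r / p) :> R.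
    by rewrite -powRM//; congr (_ `^ _); lra.
  rewrite -mulrA ler_wpM2l ?powR_ge0// mulrDr lerD ?powR_add_le//.
  rewrite ler_peMl ?powR_ge0//; suff : 2 `^ 0 <= 2 `^ (r / p) :> R by rewrite powRr0.
  by rewrite ler_powR// ler1n.
Qed.

Lemma weak_of_Iq q (d : R -> R) y : 1 <= q -> (forall t, 0 <= d t) -> nonincreasing_fun d ->
  0 <= y -> (Iq p q d <= y%:E)%E -> weak_le p d ((q * y) `^ q^-1).
Proof.
move=> q1 d0 dni y0 dy t t0; have q0 : 0 < q by exact: lt_le_trans q1.
have := powR_le_Iq p0 q1 t0 d0 dni.
move=> /le_trans /(_ (lee_wpmul2l (_ : (0 <= q%:E)%E) dy)).
rewrite lee_fin (ltW q0) => /(_ isT); rewrite -EFinM lee_fin => h.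
have -> : t * d t `^ p^-1 = (t `^ q * d t `^ (q / p)) `^ q^-1.
  rewrite powRM ?powR_ge0// powRK ?gt_eqF ?(ltW t0)//; congr (_ * _).
  by rewrite -powRrM; congr (_ `^ _); field; rewrite !gt_eqF.
by apply: le_powR => //; rewrite ?invr_ge0 ?(ltW q0)// mulr_ge0 ?powR_ge0.
Qed.

Lemma Iq_half r (d : R -> R) : 0 < r -> (forall t, 0 <= d t) -> measurable_fun setT d ->
  Iq p r (fun t => d (t / 2)) = ((2 `^ r)%:E * Iq p r d)%E.
Proof.
move=> r0 d0 md; have := @Iq_scale R p r 2 1 d r0 (ltr0n _ 2) ler01 d0 md.
rewrite powR1 mulr1 => <-; congr (Iq _ _ _).
by apply/funext => t; rewrite mul1r.
Qed.

Lemma Iq_indic r M c : 1 <= r -> 0 <= M -> 0 <= c ->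
  Iq p r (fun t => M * (t < c)%R%:R) = (M `^ (r / p) * (c `^ r / r))%:E.
Proof.
move=> r1 M0 c0; have r0 : 0 < r by exact: lt_le_trans r1.
rewrite EFinM -(integral_powR r1 c0) -ge0_integralZl_EFin ?powR_ge0//; last 2 first.
- by move=> t _; rewrite lee_fin mulr_ge0 ?powR_ge0 ?ler0n.
- apply/measurable_EFinP; apply: (@measurable_funS _ _ _ _ setT) => //.
  apply: measurable_funM; first exact: measurable_powR.
  apply: nonincreasing_measurable => // t u tu /=; rewrite ler_nat.
  by case: (ltP u) => //= uc; rewrite (le_lt_trans tu uc).
apply: eq_integral => t _; rewrite -EFinM; congr EFin.
rewrite mulrCA; congr (_ * _); case: (t < c); rewrite ?mulr1// !mulr0 powR0//.
by rewrite mulf_eq0 invr_eq0 (gt_eqF r0) (gt_eqF p0).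
Qed.

Section Core.
Variables (f : nat -> R) (V : R) (Wk : nat -> R).
Hypothesis V0 : 0 <= V.
Hypothesis Wk0 : forall k, 0 <= Wk k.
Hypothesis WkV : forall k, Wk k <= V.
Local Notation F := (fun n => `|f n|).
Hypothesis FWk : forall k, weak_le p (dK k F) (Wk k).
Let W := 2 `^ p^-1 * V.
Local Notation cb := (cbound s grp al p W Wk).
Let B n := Num.max (F n + TF F n) (cb (grp n)).

Let F0 n : 0 <= F n. Proof. exact: normr_ge0. Qed.
Let W0 : 0 <= W. Proof. by rewrite mulr_ge0 ?powR_ge0. Qed.
Let FV k : weak_le p (dK k F) V.
Proof. by move=> t t0; apply: le_trans (WkV k); exact: FWk. Qed.

Let TF0 n : 0 <= TF F n.
Proof. by apply: sumr_ge0 => i _; rewrite mulr_ge0// divr_ge0. Qed.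

Let B0 n : 0 <= B n.
Proof. by rewrite le_max addr_ge0. Qed.

Let pp0 : 0 < p / (p - 1).
Proof. by rewrite divr_gt0 ?subr_gt0. Qed.

Lemma maxc_ge0 n : (0 <= maxc (Z := X) f n)%E.
Proof.
apply: (@le_trans _ _ ((fine (mms_mu X (rball (mms_rho (m := X)) n 1)))^-1%:E *
  \int[mms_mu X]_(y in rball (mms_rho (m := X)) n 1) `|f y|%:E)%E).
  apply: mule_ge0; first by rewrite lee_fin invr_ge0 fine_ge0.
  by apply: integral_ge0 => y _; rewrite lee_fin.
by apply: ereal_sup_ubound; exists 1 => //=; rewrite in_itv/= ltr01.
Qed.

Lemma maxc_leB n : (`|maxc (Z := X) f n| <= `|(EFin \o B) n|)%E.
Proof.
rewrite gee0_abs ?maxc_ge0// /= ger0_norm//.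
have FW N : weak_le p (dist (fun n : 'I_N => al (grp n)) (fun n => F n)) W.
  exact: (@dist_weak_le F V N F0 V0 FV).
exact: (@maxc_le R s grp lo hi al s_lt grpP al_gt0 lac hi_le p p1 f W Wk W0 Wk0 FW FWk n).
Qed.

Lemma dkB_le k t : dK k B t <=
  dK k F (t / 2) + dK k (TF F) (t / 2) + Mk s grp al k * (t < cb k)%R%:R.
Proof.
have MkE : Mk s grp al k = \sum_(x < s k.+1) @mK k x.
  by rewrite /Mk big_mkcond; apply: eq_bigr => x _.
rewrite MkE mulr_suml /dk /dist big_mkcond/= [X in _ <= X + _ + _]big_mkcond/=.
rewrite [X in _ <= _ + X + _]big_mkcond/= -!big_split/=; apply: ler_sum => x _.
have mx := @mk_ge0 R s grp al al_gt0 k x.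
have [xk|xk] := eqVneq (grp x) k; last by rewrite /mk (negbTE xk) !if_same mul0r !addr0.
rewrite /B xk lt_max; have [h1|h1] := ltP t (cb k).
  by rewrite orbT mulr1 lerDr addr_ge0//; case: ifP.
rewrite orbF mulr0 addr0; case: (ltP t (F x + TF F x)) => h2; last by rewrite addr_ge0//; case: ifP.
have [h3|h3] := ltP (t / 2) (F x); first by rewrite lerDl; case: ifP.
have -> : t / 2 < TF F x by lra.
by rewrite add0r.
Qed.

Let c1M k : cb k * Mk s grp al k `^ p^-1 = p / (p - 1) * (Wk k + eps p k * W).
Proof.
rewrite /cbound mulrAC -[p / (p - 1) * _ * _]mulrA -gt0_powRD// addNr powRr0 mulr1.
by [].
Qed.

Let eps0 k : 0 <= eps p k. Proof. by rewrite addr_ge0 ?powR_ge0. Qed.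

Let cb0 k : 0 <= cb k.
Proof.
apply: mulr_ge0; first by rewrite mulr_ge0 ?powR_ge0// ltW.
by rewrite addr_ge0// mulr_ge0.
Qed.

Lemma upper_weak K : 0 <= K -> (forall k, weak_le p (dK k (TF F)) (K * V)) ->
  (lorentz (Z := X) p +oo (maxc (Z := X) f) <=
   (2 `^ p^-1 * (4 `^ p^-1 * (2 + 2 * K + p / (p - 1) * (1 + 2 * 2 `^ p^-1))) * V)%:E)%E.
Proof.
move=> K0 TV; have q4 : 0 <= 4 `^ p^-1 :> R by exact: powR_ge0.
set C := 4 `^ p^-1 * _.
have C0 : 0 <= C.
  apply: mulr_ge0 => //; apply: addr_ge0; first by rewrite addr_ge0 ?mulr_ge0.
  by apply: mulr_ge0; rewrite ?(ltW pp0)// addr_ge0 ?mulr_ge0 ?powR_ge0.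
apply: (@le_trans _ _ (lorentz (Z := X) p +oo (EFin \o B))).
  apply: ge_ereal_sup => _ [t + <-]; rewrite /= in_itv/= andbT => t0.
  apply: (@le_trans _ _ (t%:E * distf (Z := X) (EFin \o B) t `^ p^-1)%E); last first.
    by apply: ereal_sup_ubound; exists t => //=; rewrite in_itv/= t0.
  apply: lee_wpmul2l; first by rewrite lee_fin ltW.
  apply: gt0_ler_poweR => //.
  - by rewrite in_itv/= leey andbT distf_ge0.
  - by rewrite in_itv/= leey andbT distf_ge0.
  - by apply: le_distf => n; exact: maxc_leB.
rewrite -mulrA; apply: lorentz_pinfty_le => //; first by rewrite mulr_ge0.
move=> k t t0.
have t20 : 0 < t / 2 by rewrite divr_gt0.
apply: (@le_trans _ _ (t * (4 `^ p^-1 * (dK k F (t / 2) `^ p^-1 + dK k (TF F) (t / 2) `^ p^-1 +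
    (Mk s grp al k * (t < cb k)%R%:R) `^ p^-1)))).
  rewrite ler_wpM2l ?(ltW t0)//.
  apply: (le_trans (le_powR pi0 (dK0 _ _ _) (dkB_le k t))).
  apply: (le_trans (powR_add_le pi0 (addr_ge0 (dK0 _ _ _) (dK0 _ _ _)) _)).
    by rewrite mulr_ge0 ?ler0n ?(ltW (Mk0 _)).
  have -> : 4 `^ p^-1 = 2 `^ p^-1 * 2 `^ p^-1 :> R.
    by rewrite -powRM//; congr (_ `^ _); lra.
  rewrite -mulrA ler_wpM2l ?powR_ge0// mulrDr lerD ?powR_add_le//.
  rewrite ler_peMl ?powR_ge0//; suff : 2 `^ 0 <= 2 `^ p^-1 :> R by rewrite powRr0.
  by rewrite ler_powR// ler1n.
rewrite mulrCA /C -mulrA ler_wpM2l//.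
have h1 := FV k t20; have h2 := TV k _ t20.
have h3 : t * (Mk s grp al k * (t < cb k)%R%:R) `^ p^-1 <= p / (p - 1) * (1 + 2 * 2 `^ p^-1) * V.
  case: (ltP t (cb k)) => tc; last first.
    rewrite mulr0 powR0 ?mulr0 ?invr_eq0 ?gt_eqF//; apply: mulr_ge0 => //.
    by apply: mulr_ge0; rewrite ?(ltW pp0)// addr_ge0 ?mulr_ge0 ?powR_ge0.
  rewrite mulr1; apply: (@le_trans _ _ (cb k * Mk s grp al k `^ p^-1)).
    by rewrite ler_wpM2r ?powR_ge0// ltW.
  rewrite c1M -[X in _ <= X]mulrA ler_wpM2l ?(ltW pp0)//.
  have := ler_wpM2r W0 (eps_le k); have := WkV k; rewrite /W; lra.
move: h1 h2 h3; lra.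
Qed.

Section Finite.
Variables (q r A : R) (x : nat -> R) (CT K Ke : R).
Hypothesis q1 : 1 <= q.
Hypothesis qr : q <= r.
Hypothesis A0 : 0 <= A.
Hypothesis x0 : forall k, 0 <= x k.
Hypothesis xE : forall k, Iq p q (dK k F) = (x k)%:E.
Hypothesis xA : forall n, \sum_(k < n) x k <= A.
Hypothesis VE : V = (q * A) `^ q^-1.
Hypothesis WkE : forall k, Wk k = (q * x k) `^ q^-1.
Hypothesis CT0 : 0 <= CT.
Hypothesis Tle : forall k, (Iq p q (dK k (TF F)) <=
  (CT * omega q^-1 k `^ q)%:E * \sum_(lo k <= i < hi k) Iq p q (dK i F))%E.
Hypothesis omK : forall n i, \sum_(k < n | (lo k <= i < hi k)%N) omega q^-1 k `^ r <= K.
Hypothesis epsKe : forall n, \sum_(k < n) eps p k `^ r <= Ke.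

Let q0 : 0 < q. Proof. exact: lt_le_trans q1. Qed.
Let r1 : 1 <= r. Proof. exact: le_trans qr. Qed.
Let r0 : 0 < r. Proof. exact: lt_le_trans r1. Qed.
Let S k := \sum_(lo k <= i < hi k) x i.
Let S0 k : 0 <= S k. Proof. by rewrite sumr_ge0. Qed.
Let c4 : R := 4 `^ (r / p).
Let cp : R := (p / (p - 1)) `^ r / r * 2 `^ r.
Let c1 := c4 * (2 `^ r + cp * q).
Let c2 := c4 * (2 `^ r * CT `^ (r / q)).
Let c3 := c4 * (cp * (2 `^ (r / p) * q)).

Let cp0 : 0 <= cp.
Proof. by rewrite /cp mulr_ge0 ?powR_ge0// divr_ge0 ?powR_ge0 ?(ltW r0). Qed.

Let rq0 : 0 <= r - q. Proof. by rewrite subr_ge0. Qed.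

Let xkA k : x k <= A.
Proof. by apply: le_trans (xA k.+1); rewrite big_ord_recr/= lerDr sumr_ge0. Qed.

Let SA k : S k <= A.
Proof.
apply: le_trans (xA (hi k)); rewrite -(big_mkord xpredT x) /S.
have [h|h] := leqP (lo k) (hi k); last first.
  by rewrite [X in X <= _]big_geq ?(ltnW h)//; apply: sumr_ge0.
by rewrite [X in _ <= X](big_cat_nat (n := lo k))//= lerDr sumr_ge0.
Qed.

Let powV a : 0 <= a -> a <= A -> ((q * a) `^ q^-1) `^ (r - q) <= V `^ (r - q).
Proof.
move=> a0 aA; apply: le_powR => //; first exact: powR_ge0.
by rewrite VE; apply: le_powR; rewrite ?invr_ge0 ?(ltW q0) ?mulr_ge0 ?(ltW q0)// ler_wpM2l// ltW.
Qed.

Let powr a : 0 <= a -> ((q * a) `^ q^-1) `^ r = ((q * a) `^ q^-1) `^ (r - q) * (q * a).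
Proof.
move=> a0; rewrite -{3}[q * a](@powRVK _ q) ?gt_eqF ?mulr_ge0 ?(ltW q0)//.
rewrite -powRD ?subrK//; apply/implyP => /eqP r00; move: r0; lra.
Qed.

(** In all three parts the exponent is raised from q to r at the price of the common factor
    [V^(r - q)]; what remains is linear in [x], or in [A] with summable coefficients, and can be
    summed over the groups. *)
Let part1 k : (Iq p r (fun t => dK k F (t / 2)) <= (2 `^ r * (V `^ (r - q) * x k))%:E)%E.
Proof.
rewrite Iq_half// EFinM; apply: lee_wpmul2l; first by rewrite lee_fin powR_ge0.
rewrite EFinM -xE; apply: Iq_weak_le => //; exact: FV.
Qed.

Let part2 k : (Iq p r (fun t => dK k (TF F) (t / 2)) <=
  (2 `^ r * (V `^ (r - q) * (CT `^ (r / q) * (omega q^-1 k `^ r * S k))))%:E)%E.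
Proof.
rewrite Iq_half// EFinM; apply: lee_wpmul2l; first by rewrite lee_fin powR_ge0.
set om := omega q^-1 k; have om0 : 0 <= om by exact: omega_ge0.
pose y := CT * om `^ q * S k.
have y0 : 0 <= y by rewrite !mulr_ge0 ?powR_ge0.
have Ty : (Iq p q (dK k (TF F)) <= y%:E)%E.
  apply: (le_trans (Tle k)); rewrite /y [X in (_ <= X)%E]EFinM; apply: lee_wpmul2l.
    by rewrite lee_fin mulr_ge0 ?powR_ge0.
  by under eq_bigr do rewrite xE; rewrite sumEFin.
have Tw : weak_le p (dK k (TF F)) ((q * y) `^ q^-1).
  by apply: weak_of_Iq => //; apply: dist_ni => z; exact: mk_ge0.
apply: (le_trans (Iq_weak_le q1 qr (dK0 _ _) (mdK _ _) Tw (powR_ge0 _ _))).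
apply: (le_trans (lee_wpmul2l _ Ty)); first by rewrite lee_fin powR_ge0.
rewrite -EFinM lee_fin.
rewrite /y powR_combine//.
by apply: ler_wpM2r (powV (S0 k) (SA k)); rewrite !mulr_ge0 ?powR_ge0.
Qed.

Let part3 k : (Iq p r (fun t => Mk s grp al k * (t < cb k)%R%:R)%R <=
  (V `^ (r - q) * (cp * (q * x k + 2 `^ (r / p) * q * (eps p k `^ r * A))))%:E)%E.
Proof.
rewrite Iq_indic ?cb0 ?(ltW (Mk0 _))// lee_fin.
have -> : Mk s grp al k `^ (r / p) * (cb k `^ r / r) =
    (p / (p - 1)) `^ r / r * (Wk k + eps p k * W) `^ r.
  rewrite mulrA [r / p]mulrC powRrM -powRM ?powR_ge0 ?cb0// mulrC [_ `^ p^-1 * _]mulrC c1M.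
  rewrite powRM ?(ltW pp0) ?addr_ge0 ?mulr_ge0//; ring.
rewrite /cp; have pr0 : 0 <= (p / (p - 1)) `^ r / r by rewrite divr_ge0 ?powR_ge0 ?(ltW r0).
rewrite [X in _ <= X]mulrCA -[X in _ <= X]mulrA ler_wpM2l//.
have W2 : W `^ r = 2 `^ (r / p) * (V `^ (r - q) * (q * A)).
  rewrite /W powRM ?powR_ge0// -powRrM [p^-1 * r]mulrC; congr (_ * _).
  by rewrite VE powr.
apply: (le_trans (powR_add_le (ltW r0) (Wk0 k) (mulr_ge0 (eps0 k) W0))).
have -> : V `^ (r - q) * (q * x k + 2 `^ (r / p) * q * (eps p k `^ r * A)) =
  V `^ (r - q) * (q * x k) + eps p k `^ r * W `^ r by rewrite W2; ring.
rewrite ler_wpM2l ?powR_ge0// powRM// lerD2r WkE powr//.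
by rewrite ler_wpM2r ?mulr_ge0 ?(ltW q0)// powV.
Qed.

Let part_sum (c b v z o cT g h d e : R) :
  c * (b * (v * z) + b * (v * (cT * o)) + v * (g * (h * z + d * h * e))) =
  v * (c * (b + g * h) * z + c * (b * cT) * o + c * (g * (d * h)) * e).
Proof. by ring. Qed.

Let IqB k : (Iq p r (dK k B) <= (V `^ (r - q) *
  (c1 * x k + c2 * (omega q^-1 k `^ r * S k) + c3 * (eps p k `^ r * A)))%:E)%E.
Proof.
have mh (d : R -> R) : measurable_fun [set: R] d -> measurable_fun [set: R] (fun t : R => d (t / 2)).
  by move=> md; apply: (measurableT_comp md); exact: measurable_funM.
have h := Iq_le3 r1 (dK0 k B) (fun t => dK0 k F (t / 2)) (fun t => dK0 k (TF F) (t / 2))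
  (fun t => mulr_ge0 (ltW (Mk0 k)) (ler0n _ _)) (mdK k B) (mh _ (mdK k F)) (mh _ (mdK k (TF F)))
  _ (fun t _ => dkB_le k t).
apply: (le_trans (h _)).
  apply: measurable_funM => //; apply: nonincreasing_measurable => // t u tu /=; rewrite ler_nat.
  by case: (ltP u) => //= uc; rewrite (le_lt_trans tu uc).
apply: (le_trans (lee_wpmul2l _ (leeD (leeD (part1 k) (part2 k)) (part3 k)))).
  by rewrite lee_fin powR_ge0.
rewrite -!EFinD -EFinM lee_fin le_eqVlt; apply/orP; left; apply/eqP.
exact: part_sum.
Qed.

(** After exchanging the sums, the coefficient of [x i] involves only those groups that have group
    [i] among their lower groups, which is what [omK] bounds. This is why separate blocks do not add
    up. *)
Let sumS n : \sum_(k < n) omega q^-1 k `^ r * S k <= K * A.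
Proof.
pose N := \max_(k < n) hi k.
have hN (k : 'I_n) : (hi k <= N)%N by exact: (@leq_bigmax _ (fun k : 'I_n => hi k)).
have SE (k : 'I_n) : S k = \sum_(i < N) if (lo k <= i < hi k)%N then x i else 0.
  rewrite -big_mkcond /S big_geq_mkord/=.
  by rewrite (big_ord_widen_cond N (fun i => (lo k <= i)%N) x (hN k)).
under eq_bigr do rewrite SE mulr_sumr.
rewrite exchange_big/=; apply: (@le_trans _ _ (\sum_(i < N) K * x i)); last first.
  rewrite -mulr_sumr ler_wpM2l//; apply: le_trans (omK 0 0).
  by rewrite big_ord0.
apply: ler_sum => i _; apply: le_trans (ler_wpM2r (x0 i) (omK n i)).
rewrite mulr_suml [X in _ <= X]big_mkcond/=; apply: ler_sum => k _.
by case: ifP => _; rewrite ?mulr0.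
Qed.

Lemma upper_finite : (Jq lo hi s_lt grpP al_gt0 p r (maxc (Z := X) f) <=
  (2 `^ (r / p) * ((c1 + c2 * K + c3 * Ke) / q) * V `^ r)%:E)%E.
Proof.
have JB := le_Jq lo hi s_lt grpP al_gt0 p1 r1 maxc_leB.
apply: (le_trans JB); apply: (le_trans (Jq_le lo hi s_lt grpP al_gt0 lac p1 r1 B0)).
rewrite -mulrA EFinM; apply: lee_wpmul2l; first by rewrite lee_fin powR_ge0.
apply: lime_le; first by apply: is_cvg_nneseries => k _ _; exact: Iq_ge0.
apply: nearW => n; rewrite big_mkord.
apply: (le_trans (lee_sum _ (fun (k : 'I_n) _ => IqB k))).
rewrite sumEFin lee_fin -mulr_sumr !big_split/= -!mulr_sumr.
have Vr : V `^ r = V `^ (r - q) * (q * A) by rewrite VE powr.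
have -> : (c1 + c2 * K + c3 * Ke) / q * V `^ r = V `^ (r - q) * (c1 * A + c2 * (K * A) + c3 * (Ke * A)).
  by rewrite Vr; field; rewrite gt_eqF.
have c40 : 0 <= c4 by exact: powR_ge0.
have c10 : 0 <= c1.
  by apply: mulr_ge0 => //; apply: addr_ge0; [exact: powR_ge0|exact: mulr_ge0 cp0 (ltW q0)].
have c20 : 0 <= c2 by apply: mulr_ge0 => //; apply: mulr_ge0; exact: powR_ge0.
have c30 : 0 <= c3.
  apply: mulr_ge0 => //; apply: mulr_ge0; first exact: cp0.
  by apply: mulr_ge0; [exact: powR_ge0|exact: ltW].
apply: ler_wpM2l; first exact: powR_ge0.
have e0 : \sum_(k < n) eps p k `^ r * A <= Ke * A by rewrite -mulr_suml ler_wpM2r.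
by apply: lerD; [apply: lerD; apply: ler_wpM2l => //; [exact: xA|exact: sumS]|exact: ler_wpM2l].
Qed.

End Finite.

End Core.

Lemma mconst_lt_pinfty (q r : \bar R) c : 0 <= c ->
  (forall f : nat -> R, (lorentz (Z := X) p q (EFin \o f) < +oo)%E ->
    (lorentz (Z := X) p r (maxc (Z := X) f) <= c%:E * lorentz (Z := X) p q (EFin \o f))%E) ->
  (mconst p q r X < +oo)%E.
Proof.
move=> c0 H; apply: (@le_lt_trans _ _ c%:E); last exact: ltry.
by apply: ereal_inf_lbound; exists c => //; split => // f [_]; exact: H.
Qed.

Lemma lorentz_abs q (f : nat -> R) :
  lorentz (Z := X) p q (EFin \o f) = lorentz (Z := X) p q (EFin \o (fun n => `|f n|)).
Proof.
have dE : distf (Z := X) (EFin \o f) = distf (Z := X) (EFin \o (fun n => `|f n|)).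
  by apply/funext => t; rewrite !distfE; apply: eq_eseriesr => n _; rewrite /= normr_id.
by rewrite /lorentz dE.
Qed.

Lemma finite_lorentz q (f : nat -> R) : 1 <= q ->
  (lorentz (Z := X) p q%:E (EFin \o f) < +oo)%E ->
  exists2 J, 0 <= J & Jq lo hi s_lt grpP al_gt0 p q (EFin \o (fun n => `|f n|)) = J%:E /\
    lorentz (Z := X) p q%:E (EFin \o f) = (p `^ q^-1 * J `^ q^-1)%:E.
Proof.
move=> q1; rewrite lorentz_abs lorentzE//; have q0 : 0 < q by exact: lt_le_trans q1.
set J := Jq _ _ _ _ _ _ _ _; have := Jq_ge0 lo hi s_lt grpP al_gt0 p q (EFin \o (fun n => `|f n|)).
rewrite -/J; case: J => [J| |]//; last first.
  rewrite poweRyr ?invr_eq0 ?gt_eqF// gt0_muley ?lte_fin ?powR_gt0//.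
by rewrite lee_fin => J0 _; exists J.
Qed.

Lemma group_norms q (f : nat -> R) J : 1 <= q -> 0 <= J ->
  Jq lo hi s_lt grpP al_gt0 p q (EFin \o (fun n => `|f n|)) = J%:E ->
  let A := (1 - 2 `^ (- (q / p)))^-1 * J in
  0 <= A /\ exists x : nat -> R, [/\ forall k, 0 <= x k,
    forall k, Iq p q (dK k (fun n => `|f n|)%R) = (x k)%:E,
    forall n, \sum_(k < n) x k <= A & forall k, x k <= A].
Proof.
move=> q1 J0 JE A; have q0 : 0 < q by exact: lt_le_trans q1.
have C0 : 0 <= (1 - 2 `^ (- (q / p)))^-1 :> R.
  rewrite invr_ge0 subr_ge0 powRN invf_le1 ?powR_gt0// ltW// powR_gt1 ?ltr1n//.
  by rewrite divr_gt0.
have S n : (\sum_(k < n) Iq p q (dK k (fun n => `|f n|)%R) <= A%:E)%E.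
  by rewrite /A EFinM -JE; apply: sum_Iq_le => // k; exact: normr_ge0.
pose x k := fine (Iq p q (dK k (fun n => `|f n|))).
have xE k : Iq p q (dK k (fun n => `|f n|)) = (x k)%:E.
  have : (Iq p q (dK k (fun n => `|f n|)%R) <= A%:E)%E.
    by apply: le_trans (S k.+1); rewrite big_ord_recr/= leeDr// sume_ge0// => i _; exact: Iq_ge0.
  have := Iq_ge0 p q (dK k (fun n => `|f n|)).
  by rewrite /x; case: (Iq _ _ _).
have x0 k : 0 <= x k by rewrite fine_ge0// Iq_ge0.
have xA n : \sum_(k < n) x k <= A.
  by have := S n; under eq_bigr do rewrite xE; rewrite sumEFin.
split; first by rewrite mulr_ge0.
exists x; split => // k; apply: le_trans (xA k.+1).
by rewrite big_ord_recr/= lerDr sumr_ge0.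
Qed.

Lemma group_weak q (f : nat -> R) x k : 1 <= q -> 0 <= x ->
  Iq p q (dK k (fun n => `|f n|)) = x%:E -> weak_le p (dK k (fun n => `|f n|)) ((q * x) `^ q^-1).
Proof.
move=> q1 x0 xE; apply: weak_of_Iq => //; last by rewrite xE.
by apply: dist_ni => z; exact: mk_ge0.
Qed.

Theorem upper_finite_finite q r K : 1 <= q -> q <= r ->
  (forall n i, \sum_(k < n | (lo k <= i < hi k)%N) omega q^-1 k `^ r <= K) ->
  (mconst p q%:E r%:E X < +oo)%E.
Proof.
move=> q1 qr omK; have q0 : 0 < q by exact: lt_le_trans q1.
have r1 : 1 <= r by exact: le_trans qr.
have r0 : 0 < r by exact: lt_le_trans r1.
have [CT CT0 HCT] := Iq_Tf_le q1; have [Ke Ke0 HKe] := sum_eps_le r1.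
have K0 : 0 <= K by apply: le_trans (omK 0 0); rewrite big_ord0.
pose c4 : R := 4 `^ (r / p).
pose cp : R := (p / (p - 1)) `^ r / r * 2 `^ r.
pose c1 := c4 * (2 `^ r + cp * q).
pose c2 := c4 * (2 `^ r * CT `^ (r / q)).
pose c3 := c4 * (cp * (2 `^ (r / p) * q)).
pose C := 2 `^ (r / p) * ((c1 + c2 * K + c3 * Ke) / q).
pose D : R := (1 - 2 `^ (- (q / p)))^-1.
have cp0 : 0 <= cp by rewrite mulr_ge0 ?powR_ge0// divr_ge0 ?powR_ge0 ?(ltW r0).
have C0 : 0 <= C.
  apply: mulr_ge0; first exact: powR_ge0.
  apply: divr_ge0; last exact: ltW.
  have c40 : 0 <= c4 by exact: powR_ge0.
  have c10 : 0 <= c1.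
    by apply: mulr_ge0 => //; apply: addr_ge0; [exact: powR_ge0|exact: mulr_ge0 cp0 (ltW q0)].
  have c20 : 0 <= c2 by apply: mulr_ge0 => //; apply: mulr_ge0; exact: powR_ge0.
  have c30 : 0 <= c3.
    apply: mulr_ge0 => //; apply: mulr_ge0; first exact: cp0.
    by apply: mulr_ge0; [exact: powR_ge0|exact: ltW].
  have d1 := mulr_ge0 c20 K0; have d2 := mulr_ge0 c30 Ke0.
  exact: addr_ge0 (addr_ge0 c10 d1) d2.
apply: (@mconst_lt_pinfty _ _ (p `^ r^-1 * C `^ r^-1 * ((q * D) `^ q^-1 / p `^ q^-1))).
  by apply: mulr_ge0; [apply: mulr_ge0|apply: divr_ge0]; exact: powR_ge0.
move=> f /(finite_lorentz q1)[J J0 [JE ->]].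
have [A0 [x [x0 xE xA xkA]]] := group_norms q1 J0 JE.
set A := (1 - _)^-1 * J in A0 xA xkA.
pose V := (q * A) `^ q^-1; pose Wk k := (q * x k) `^ q^-1.
have WkV k : Wk k <= V.
  by apply: le_powR; rewrite ?invr_ge0 ?(ltW q0) ?mulr_ge0 ?(ltW q0)// ler_wpM2l// ltW.
have := @upper_finite f V Wk (powR_ge0 _ _) (fun k => powR_ge0 _ _) WkV
  (fun k => group_weak q1 (x0 k) (xE k)) q r A x CT K Ke q1 qr A0 x0 xE xA erefl
  (fun k => erefl) (ltW CT0) (fun k => HCT k _ (fun n => normr_ge0 _)) omK HKe.
rewrite -/c4 -/cp -/c1 -/c2 -/c3 -/C lorentzE// => h.
apply: (@le_trans _ _ ((p `^ r^-1)%:E * ((C * V `^ r)%:E `^ r^-1))%E).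
  apply: lee_wpmul2l; first by rewrite lee_fin powR_ge0.
  apply: gt0_ler_poweR => //; first by rewrite invr_ge0 ltW.
  - by rewrite in_itv/= leey andbT Jq_ge0.
  - by rewrite in_itv/= leey andbT lee_fin mulr_ge0 ?powR_ge0.
rewrite poweR_EFin -!EFinM lee_fin powRM ?powR_ge0// powRK ?gt_eqF ?powR_ge0//.
have -> : V = (q * D) `^ q^-1 * J `^ q^-1.
  have D0 : 0 <= D.
    rewrite invr_ge0 subr_ge0 powRN invf_le1 ?powR_gt0// ltW// powR_gt1 ?ltr1n//.
    by rewrite divr_gt0.
  by rewrite -powRM// ?mulr_ge0 ?(ltW q0)// -mulrA.
have pq : p `^ q^-1 != 0 by rewrite gt_eqF ?powR_gt0.
rewrite le_eqVlt; apply/orP; left; apply/eqP.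
move: (p `^ q^-1) pq (p `^ r^-1) (C `^ r^-1) ((q * D) `^ q^-1) (J `^ q^-1) => a a0 b c d e.
by field.
Qed.

(** Weak bounds on the groups need no summation, so a uniform bound on [omega] replaces the sums
    over upper groups. *)
Theorem upper_finite_pinfty q K : 1 <= q -> (forall k, omega q^-1 k <= K) ->
  (mconst p q%:E +oo X < +oo)%E.
Proof.
move=> q1 omK; have q0 : 0 < q by exact: lt_le_trans q1.
have [CT CT0 HCT] := Iq_Tf_le q1.
have K0 : 0 <= K by apply: le_trans (omK 0%N); exact: omega_ge0.
pose K' := CT `^ q^-1 * K.
have K'0 : 0 <= K' by apply: mulr_ge0 => //; exact: powR_ge0.
have pp0 : 0 <= p / (p - 1) by rewrite divr_ge0 ?subr_ge0 ?(ltW p0) ?(ltW p1).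
pose C := 2 `^ p^-1 * (4 `^ p^-1 * (2 + 2 * K' + p / (p - 1) * (1 + 2 * 2 `^ p^-1))).
have C0 : 0 <= C.
  apply: mulr_ge0; first exact: powR_ge0.
  apply: mulr_ge0; first exact: powR_ge0.
  apply: addr_ge0; first by apply: addr_ge0 => //; exact: mulr_ge0.
  by apply: mulr_ge0 => //; apply: addr_ge0.
pose D : R := (1 - 2 `^ (- (q / p)))^-1.
have D0 : 0 <= D.
  rewrite invr_ge0 subr_ge0 powRN invf_le1 ?powR_gt0// ltW// powR_gt1 ?ltr1n//.
  by rewrite divr_gt0.
apply: (@mconst_lt_pinfty _ _ (C * ((q * D) `^ q^-1 / p `^ q^-1))).
  by apply: mulr_ge0 => //; apply: divr_ge0; exact: powR_ge0.
move=> f /(finite_lorentz q1)[J J0 [JE ->]].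
have [A0 [x [x0 xE xA xkA]]] := group_norms q1 J0 JE.
set A := (1 - _)^-1 * J in A0 xA xkA.
pose V := (q * A) `^ q^-1; have V0 : 0 <= V by exact: powR_ge0.
have FV k : weak_le p (dK k (fun n => `|f n|)) V.
  move=> t t0; apply: le_trans (group_weak q1 (x0 k) (xE k) t0) _.
  by apply: le_powR; rewrite ?invr_ge0 ?(ltW q0) ?mulr_ge0 ?(ltW q0)// ler_wpM2l// ltW.
have TV k : weak_le p (dK k (TF (fun n => `|f n|))) (K' * V).
  have om0 := omega_ge0 q^-1 k.
  have y0 : 0 <= CT * omega q^-1 k `^ q * A.
    by apply: mulr_ge0 => //; apply: mulr_ge0; [exact: ltW|exact: powR_ge0].
  have Ty : (Iq p q (dK k (TF (fun n => `|f n|)%R)) <= (CT * omega q^-1 k `^ q * A)%:E)%E.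
    apply: (le_trans (HCT k _ (fun n => normr_ge0 _))).
    rewrite [X in (_ <= X)%E]EFinM; apply: lee_wpmul2l.
      by rewrite lee_fin mulr_ge0 ?powR_ge0 ?(ltW CT0).
    under eq_bigr do rewrite xE.
    rewrite sumEFin lee_fin; apply: le_trans (xA (hi k)).
    rewrite big_geq_mkord/= [X in X <= _]big_mkcond/=; apply: ler_sum => i _.
    by case: ifP.
  move=> t t0; apply: le_trans (weak_of_Iq q1 (dK0 k _) _ y0 Ty t0) _.
    by apply: dist_ni => z; exact: mk_ge0.
  rewrite (_ : q * (CT * omega q^-1 k `^ q * A) = CT * omega q^-1 k `^ q * (q * A)); last by ring.
  rewrite powRM ?mulr_ge0 ?powR_ge0 ?(ltW CT0) ?(ltW q0)//.
  rewrite ler_wpM2r// powRM ?powR_ge0 ?(ltW CT0)// powRK ?gt_eqF//.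
  by rewrite ler_wpM2l ?powR_ge0.
have := @upper_weak f V (fun=> V) V0 (fun=> V0) (fun=> lexx V) FV K' K'0 TV.
rewrite -/C => /le_trans; apply; rewrite -EFinM lee_fin.
have -> : V = (q * D) `^ q^-1 * J `^ q^-1 by rewrite -powRM ?mulr_ge0 ?(ltW q0)// -mulrA.
have pq : p `^ q^-1 != 0 by rewrite gt_eqF ?powR_gt0.
rewrite le_eqVlt; apply/orP; left; apply/eqP.
move: (p `^ q^-1) pq C ((q * D) `^ q^-1) (J `^ q^-1) C0 => a a0 c d e _.
by field.
Qed.

Theorem upper_pinfty_pinfty K : (forall k, omega 0 k <= K) -> (mconst p +oo +oo X < +oo)%E.
Proof.
move=> omK; have K0 : 0 <= K by apply: le_trans (omK 0%N); exact: omega_ge0.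
pose K' := p / (p - 1) * 4 `^ p^-1 * K.
have pp0 : 0 <= p / (p - 1) by rewrite divr_ge0 ?subr_ge0 ?(ltW p0) ?(ltW p1).
have K'0 : 0 <= K' by apply: mulr_ge0 => //; apply: mulr_ge0 => //; exact: powR_ge0.
pose C := 2 `^ p^-1 * (4 `^ p^-1 * (2 + 2 * K' + p / (p - 1) * (1 + 2 * 2 `^ p^-1))).
have C0 : 0 <= C.
  apply: mulr_ge0; first exact: powR_ge0.
  apply: mulr_ge0; first exact: powR_ge0.
  apply: addr_ge0; first by apply: addr_ge0 => //; exact: mulr_ge0.
  by apply: mulr_ge0 => //; apply: addr_ge0.
apply: (mconst_lt_pinfty C0) => f.
rewrite lorentz_abs; set F := fun n => _.
have F0 n : 0 <= F n by exact: normr_ge0.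
have L0 : (0 <= lorentz (Z := X) p +oo (EFin \o F))%E.
  apply: (@le_trans _ _ (1%:E * distf (Z := X) (EFin \o F) 1 `^ p^-1)%E).
    by rewrite mule_ge0 ?poweR_ge0.
  by apply: ereal_sup_ubound; exists 1 => //=; rewrite in_itv/= ltr01.
case LE : (lorentz (Z := X) p +oo (EFin \o F)) L0 => [V| |]// V0 _; rewrite lee_fin in V0.
have FV k : weak_le p (dK k F) V.
  by apply: (@weak_le_lorentz R s grp lo hi al s_lt grpP al_gt0 p p1 F V k F0); rewrite LE.
have TV k : weak_le p (dK k (TF F)) (K' * V).
  move=> t t0; apply: le_trans (weak_Tf_le k F0 V0 FV t0) _.
  by rewrite ler_wpM2r// ler_wpM2l//; apply: mulr_ge0 => //; exact: powR_ge0.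
by rewrite -EFinM; apply: (@upper_weak f V (fun=> V) V0 (fun=> V0) (fun=> lexx V) FV K' K'0 TV).
Qed.

End Upper.

(** * Lower bounds *)

Section Lower.
Context {R : realType}.
Variables (s grp lo hi : nat -> nat) (al w : nat -> R).
Hypothesis s_lt : forall k, (s k < s k.+1)%N.
Hypothesis grpP : forall x, (s (grp x) <= x < s (grp x).+1)%N.
Hypothesis al_gt0 : forall k, 0 < al k.
Hypothesis lac : forall k, 2 * 4 ^+ k * \sum_(x < s k) al (grp x) <= al k.
Hypothesis hi_le : forall k, (hi k <= k)%N.
Hypothesis w_gt0 : forall k, 0 < w k.
Variable p : R.
Hypothesis p1 : 1 < p.
Hypothesis Mk_ge : forall k, (w k * al k) `^ p <= Mk s grp al k.
Hypothesis Mk_le : forall k, Mk s grp al k <= 2 * (w k * al k) `^ p.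

Local Notation X := (Z lo hi s_lt grpP al_gt0).
Local Notation dK := (@dk R s grp al).
Local Notation nbr := (nbr s grp).
Let ltn_sE := @ltn_s s grp s_lt grpP.
Let p0 : 0 < p. Proof. exact: lt_trans p1. Qed.
Let pi0 : 0 <= p^-1. Proof. by rewrite invr_ge0 ltW. Qed.
Let al_ge0 k : 0 <= al k. Proof. exact: ltW. Qed.
Let Mk0 k : 0 < Mk s grp al k. Proof. exact: Mk_gt0. Qed.

(* The ball of radius [2 k + 2] around a point of group [k] is the point with its lower
   neighbours. *)
Lemma maxc_ge_Tf f x : (forall n, 0 <= f n) ->
  ((Tf s grp lo hi al f x / 2)%:E <= maxc (Z := X) f x)%E.
Proof.
move=> f0; set k := grp x; pose r : R := (2 * k + 2)%:R.
have r0 : 0 < r by rewrite ltr0n addn2.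
apply: le_trans; last by apply: ereal_sup_ubound; exists r => //=; rewrite in_itv/= andbT.
set B := rball _ _ _.
have BE y : B y <-> (rhon s grp lo hi x y < 2 * k + 2)%N by rewrite /B /rball/= /rho ltr_nat.
have Blt y : B y -> y = x \/ (grp y < k)%N.
  rewrite BE /rhon; have [<-|xy] := eqVneq x y; first by left.
  move=> h; right; move: h; case: ifP => [/orP[|]|_]; last by clear; lia.
    by rewrite /low => /andP[/andP[_ h] _] _; exact: leq_trans h (hi_le _).
  by rewrite /low => /andP[/andP[_ h] _]; have := hi_le (grp y); move: h; rewrite -/k; clear; lia.
have BN y : B y -> (y < s k.+1)%N.
  by rewrite ltn_sE => /Blt[->//|]; exact: ltnW.
have -> : (\int[mms_mu X]_(y in B) `|f y|%:E)%E = (\sum_(n < s k.+1 | (n : nat) \in B) al (grp n) * f n)%:E.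
  have <- := @integral_mu_fin R grp al al_gt0 B (s k.+1) f f0 BN.
  by apply: eq_integral => y _; rewrite ger0_norm.
have -> : fine (mms_mu X B) = \sum_(n < s k.+1 | (n : nat) \in B) al (grp n).
  by rewrite (_ : mms_mu X B = mu grp al_gt0 B)// (mu_fin grp al_gt0 BN).
set num := \sum_(n < _ | _) _ * _; set den := \sum_(n < _ | _) _.
have xB : B x by rewrite BE /rhon eqxx addn2.
have kden : al k <= den.
  by rewrite /den (bigD1 (Ordinal (BN _ xB)))/= ?inE// lerDl sumr_ge0.
have den0 : 0 < den by exact: lt_le_trans kden.
(* By lacunarity the lower neighbours weigh no more than the point itself; this is the factor 1/2 of
   the statement. *)
have den2 : den <= 2 * al k.
  rewrite /den (bigD1 (Ordinal (BN _ xB)))/= ?inE// mulr_natl mulr2n lerD2l.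
  apply: (@le_trans _ _ (\sum_(n < s k) al (grp n))).
    rewrite (big_ord_widen _ (fun n => al (grp n)) (s_mono s_lt (leqnSn k))).
    rewrite big_mkcond [X in _ <= X]big_mkcond/=; apply: ler_sum => n _.
    case: ifP => [/andP[nB nx]|_]; last by case: ifP.
    rewrite ltn_sE; rewrite inE in nB; have [nE|->//] := Blt _ nB.
    by move: nx; rewrite (_ : n = Ordinal (BN _ xB)) ?eqxx//; exact/val_inj.
  apply: (le_trans (lac_le al_gt0 lac _)); rewrite ler_piMl// exprVn invf_le1 ?exprn_gt0//.
  by rewrite exprn_ege1// ler1n.
have numT : Tf s grp lo hi al f x * al k <= num.
  pose G n := al (grp n) * f n; have G0 n : 0 <= G n by rewrite mulr_ge0.
  have -> : Tf s grp lo hi al f x * al k = \sum_(lo k <= i < hi k) G (nbr i x).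
    rewrite /Tf mulr_suml; apply: eq_bigr => i _.
    by rewrite /G grp_nbr// -mulrA divfK ?gt_eqF// mulrC.
  have nB i : (lo k <= i < hi k)%N -> B (nbr i x).
    move=> ik; rewrite BE /rhon; case: eqVneq => [_|_]; first by rewrite addn2.
    rewrite lowE// grp_nbr// -/k ik eqxx/=.
    by have := hi_le k; move: ik; clear; lia.
  rewrite /num [X in _ <= X]big_mkcond/=.
  apply: (@le_trans _ _ (\sum_(n < s k.+1) \sum_(lo k <= i < hi k) if (n : nat) == nbr i x then G n else 0)).
    rewrite exchange_big/= !big_nat; apply: ler_sum => i ik.
    by rewrite -big_mkcond/= (big_pred1 (Ordinal (BN _ (nB _ ik)))).
  apply: ler_sum => n _; case: ifP => nin; last first.
    rewrite big_nat big1// => i ik; case: eqP => // nE.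
    by move: nin; rewrite nE mem_set//; exact: nB.
  apply: (@le_trans _ _ (\sum_(lo k <= i < hi k | i == grp n) G n)).
    rewrite [X in _ <= X]big_mkcond/=; apply: ler_sum => i _.
    by case: eqP => [->|_]; rewrite ?grp_nbr ?eqxx//; case: ifP.
  by rewrite big_nat1_eq; case: ifP => _ //; exact: G0.
rewrite [leRHS](_ : _ = (den^-1 * num)%:E)// lee_fin ler_pdivlMl// mulrA ler_pdivrMr//.
have T0 : 0 <= Tf s grp lo hi al f x.
  by apply: sumr_ge0 => i _; rewrite mulr_ge0// divr_ge0.
apply: (le_trans (ler_wpM2r T0 den2)).
by rewrite -mulrA [num * _]mulrC ler_wpM2l// mulrC.
Qed.

Definition step (c : nat -> R) a b n : R := if (a <= grp n < b)%N then c (grp n) else 0.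

Lemma step_ge0 c a b n : (forall k, 0 <= c k) -> 0 <= step c a b n.
Proof. by move=> c0; rewrite /step; case: ifP. Qed.

Lemma dk_step c a b k t : dK k (step c a b) t =
  Mk s grp al k * (t < if (a <= k < b)%N then c k else 0)%R%:R.
Proof.
rewrite dkE /Mk mulr_suml; apply: eq_bigr => n /eqP gn.
by rewrite /step gn.
Qed.

(** On one group the quasinorm is comparable to [w k * al k * c k <= y], and [b - a] groups combine
    as an l^q sum. *)
Lemma step_norm_le (q : \bar R) : (1 <= q)%E -> exists2 C, 0 < C &
  forall c a b y, (forall k, 0 <= c k) -> (forall k, (a <= k < b)%N -> w k * al k * c k <= y) ->
    0 <= y -> (a < b)%N ->
  (lorentz (Z := X) p q (EFin \o step c a b) <= (C * (b - a)%:R `^ einv q * y)%:E)%E.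
Proof.
case: q => [q| |]//; last first.
  move=> _; exists (2 `^ p^-1 * 2 `^ p^-1); first by rewrite mulr_gt0 ?powR_gt0.
  move=> c a b y c0 cy y0 ab; rewrite /einv powRr0 mulr1 -mulrA.
  apply: (lorentz_pinfty_le lo hi s_lt grpP al_gt0 lac p1).
  - by rewrite mulr_ge0 ?powR_ge0.
  - by move=> n; exact: step_ge0.
  move=> k t t0; rewrite dk_step; case: ifP => [kab|_]; last first.
    by rewrite ltNge (ltW t0)/= mulr0 powR0 ?mulr0 ?mulr_ge0 ?powR_ge0// gt_eqF// invr_gt0.
  have [tc|_] := ltP t (c k); last first.
    by rewrite mulr0 powR0 ?mulr0 ?mulr_ge0 ?powR_ge0// gt_eqF// invr_gt0.
  rewrite mulr1; apply: (@le_trans _ _ (c k * (2 `^ p^-1 * (w k * al k)))).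
    apply: ler_pM => //; [exact: ltW|exact: powR_ge0|exact: ltW|].
    apply: (le_trans (le_powR pi0 (ltW (Mk0 k)) (Mk_le k))).
    by rewrite powRM ?powR_ge0// powRK ?gt_eqF// mulr_ge0// ltW.
  by rewrite mulrCA ler_wpM2l ?powR_ge0// mulrC cy.
rewrite lee_fin => q1; have q0 : 0 < q by exact: lt_le_trans q1.
have qp : 0 < q / p by rewrite divr_gt0.
pose C := 2 `^ (q / p) * (2 `^ (q / p) / q).
have C0 : 0 < C by rewrite mulr_gt0 ?divr_gt0 ?powR_gt0.
exists (p `^ q^-1 * C `^ q^-1); first by rewrite mulr_gt0 ?powR_gt0.
move=> c a b y c0 cy y0 ab; rewrite lorentzE// /einv.
suff J : (Jq lo hi s_lt grpP al_gt0 p q (EFin \o step c a b) <= (C * (b - a)%:R * y `^ q)%:E)%E.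
  rewrite -!mulrA EFinM; apply: lee_wpmul2l; first by rewrite lee_fin powR_ge0.
  apply: (@le_trans _ _ ((C * (b - a)%:R * y `^ q)%:E `^ q^-1)%E).
    apply: gt0_ler_poweR => //; first by rewrite invr_ge0 ltW.
    - by rewrite in_itv/= leey andbT Jq_ge0.
    - by rewrite in_itv/= leey andbT lee_fin mulr_ge0 ?powR_ge0// mulr_ge0 ?ler0n// ltW.
  have Cn : 0 <= C * (b - a)%:R by rewrite mulr_ge0 ?ler0n// ltW.
  rewrite poweR_EFin lee_fin powRM ?powR_ge0// powRM ?ler0n ?(ltW C0)//.
  by rewrite powRK ?gt_eqF// mulrA.
have f0 n : 0 <= step c a b n by exact: step_ge0.
apply: (le_trans (Jq_le lo hi s_lt grpP al_gt0 lac p1 q1 f0)).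
rewrite /C -!mulrA EFinM; apply: lee_wpmul2l; first by rewrite lee_fin powR_ge0.
pose x k : R := if (a <= k < b)%N then 2 `^ (q / p) / q * y `^ q else 0.
have Ix k : (Iq p q (dK k (step c a b)) <= (x k)%:E)%E.
  rewrite (_ : dK k _ = fun t => Mk s grp al k * (t < if (a <= k < b)%N then c k else 0)%R%:R); last first.
    by apply/funext => t; exact: dk_step.
  rewrite Iq_indic ?(ltW (Mk0 _))//; last by case: ifP.
  rewrite /x lee_fin; case: ifP => [kab|_]; last by rewrite powR0 ?mul0r ?mulr0// gt_eqF.
  rewrite mulrA [X in _ <= X]mulrAC ler_wpM2r ?invr_ge0 ?(ltW q0)//.
  apply: (@le_trans _ _ (2 `^ (q / p) * (w k * al k) `^ q * c k `^ q)).
    rewrite ler_wpM2r ?powR_ge0//.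
    apply: (le_trans (le_powR (ltW qp) (ltW (Mk0 k)) (Mk_le k))).
    rewrite powRM ?powR_ge0// -powRrM (_ : p * (q / p) = q)//.
    by rewrite mulrC divfK// gt_eqF.
  rewrite -mulrA ler_wpM2l ?powR_ge0// -powRM ?mulr_ge0 ?(ltW (w_gt0 _))//.
  by apply: le_powR; rewrite ?(ltW q0) ?mulr_ge0 ?(ltW (w_gt0 _))//; exact: cy.
apply: (@le_trans _ _ (\sum_(k <oo) (x k)%:E)%E).
  by apply: lee_nneseries => // k _ _; exact: Iq_ge0.
have x0 k : 0 <= x k by rewrite /x; case: ifP => // _; rewrite mulr_ge0 ?divr_ge0 ?powR_ge0// ltW.
rewrite (@nneseries_fin _ x b)//; last first.
  by move=> n bn; rewrite /x [(n < b)%N]ltnNge bn andbF.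
rewrite lee_fin /x -big_mkcond/= -(big_mkord (fun i => (a <= i < b)%N) (fun=> 2 `^ (q / p) / q * y `^ q)).
rewrite (big_cat_nat (n := a)) ?(ltnW ab)//= [X in X + _]big_nat_cond big_pred0; last first.
  by move=> i; case: (ltnP i a) => //; rewrite ?andbF.
rewrite add0r [X in X <= _]big_nat_cond (eq_bigl (fun i => (a <= i < b)%N)); last first.
  by move=> i; rewrite andbb.
rewrite -big_nat sumr_const_nat le_eqVlt; apply/orP; left; apply/eqP.
by ring.
Qed.

Lemma le_lorentz (r : \bar R) g g' : (1 <= r)%E -> (forall n, `|g n| <= `|g' n|)%E ->
  (lorentz (Z := X) p r g <= lorentz (Z := X) p r g')%E.
Proof.
case: r => [r r1 gg|_ gg|]//; last first.
  apply: ge_ereal_sup => _ [t + <-]; rewrite /= in_itv/= andbT => t0.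
  apply: (@le_trans _ _ (t%:E * distf (Z := X) g' t `^ p^-1)%E); last first.
    by apply: ereal_sup_ubound; exists t => //=; rewrite in_itv/= t0.
  apply: lee_wpmul2l; first by rewrite lee_fin ltW.
  apply: gt0_ler_poweR => //; last exact: le_distf.
  - by rewrite in_itv/= leey andbT distf_ge0.
  - by rewrite in_itv/= leey andbT distf_ge0.
rewrite lee_fin in r1; rewrite !lorentzE//; apply: lee_wpmul2l; first by rewrite lee_fin powR_ge0.
apply: gt0_ler_poweR => //; last exact: le_Jq.
- by rewrite invr_ge0 (le_trans ler01).
- by rewrite in_itv/= leey andbT Jq_ge0.
- by rewrite in_itv/= leey andbT Jq_ge0.
Qed.

Lemma step_norm_ge (r : \bar R) : (1 <= r)%E -> exists2 C, 0 < C &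
  forall c a b y g, (forall k, 0 <= c k) -> (forall k, (a <= k < b)%N -> y <= w k * al k * c k) ->
    0 <= y -> (a < b)%N -> (forall n, (step c a b n)%:E <= `|g n|)%E ->
  (((b - a)%:R `^ einv r * y)%:E <= C%:E * lorentz (Z := X) p r g)%E.
Proof.
have lor0 g : (0 <= lorentz (Z := X) p +oo g)%E.
  apply: (@le_trans _ _ (1%:E * distf (Z := X) g 1 `^ p^-1)%E).
    by rewrite mule_ge0 ?poweR_ge0.
  by apply: ereal_sup_ubound; exists 1 => //=; rewrite in_itv/= ltr01.
have C0 q : 0 < q -> 0 < 1 - 2 `^ (- (q / p)) :> R.
  by move=> q0; rewrite subr_gt0 powRN invf_lt1 ?powR_gt0// powR_gt1 ?ltr1n// divr_gt0.
case: r => [r| |]//; last first.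
  move=> _; exists 2 => // c a b y g c0 cy y0 ab cg; rewrite /einv powRr0 mul1r.
  apply: (@le_trans _ _ (2%:E * lorentz (Z := X) p +oo (EFin \o step c a b))%E); last first.
    apply: lee_wpmul2l => //; apply: le_lorentz => [|n]; first by rewrite leey.
    by rewrite /= ger0_norm ?step_ge0.
  case LE : (lorentz _ _ _) (lor0 (EFin \o step c a b)) => [V| |] V0 //; last by rewrite gt0_muley ?lte_fin// leey.
  rewrite lee_fin in V0; rewrite -EFinM lee_fin.
  have aab : (a <= a < b)%N by rewrite leqnn.
  have wa : 0 <= w a * al a by rewrite mulr_ge0// ltW.
  have := cy _ aab; have [->|ca] := eqVneq (c a) 0.
    by rewrite mulr0 => /le_trans; apply; rewrite mulr_ge0.
  move=> /le_trans; apply; have ca0 : 0 < c a by rewrite lt_neqAle eq_sym ca c0.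
  have LV : (lorentz (Z := X) p +oo (EFin \o step c a b) <= V%:E)%E by rewrite LE.
  (* Superlevel sets are strict, so the weak bound is tested below the value [c a]; half of it costs
     the constant 2. *)
  have := @weak_le_lorentz R s grp lo hi al s_lt grpP al_gt0 p p1 _ V a
    (fun n => step_ge0 a b n c0) LV (c a / 2).
  rewrite divr_gt0// dk_step aab (_ : (_ < _) = true) ?mulr1; last by lra.
  move=> /(_ isT) h.
  have h2 : w a * al a <= Mk s grp al a `^ p^-1.
    rewrite -[X in X <= _](@powRK _ p) ?gt_eqF//; apply: le_powR => //; exact: powR_ge0.
  have := ler_wpM2l (c0 a) h2; move: h; rewrite mulrAC; lra.
rewrite lee_fin => r1; have r0 : 0 < r by exact: lt_le_trans r1.
pose D := (1 - 2 `^ (- (r / p)))^-1 * r.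
have D0 : 0 < D by rewrite mulr_gt0 ?invr_gt0 ?C0.
exists (D `^ r^-1 / p `^ r^-1); first by rewrite divr_gt0 ?powR_gt0.
move=> c a b y g c0 cy y0 ab cg; rewrite /einv.
apply: (@le_trans _ _ ((D `^ r^-1 / p `^ r^-1)%:E * lorentz (Z := X) p r%:E (EFin \o step c a b))%E); last first.
  apply: lee_wpmul2l; first by rewrite lee_fin divr_ge0 ?powR_ge0.
  apply: le_lorentz; rewrite ?lee_fin// => n.
  by rewrite /= ger0_norm ?step_ge0.
rewrite lorentzE//; set J := Jq _ _ _ _ _ _ _ _.
have J0 : (0 <= J)%E by exact: Jq_ge0.
case JE : J J0 => [j| |]//; last first.
  rewrite poweRyr ?invr_eq0 ?gt_eqF// gt0_muley ?lte_fin ?powR_gt0//.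
  by rewrite gt0_muley ?leey// lte_fin divr_gt0 ?powR_gt0.
rewrite lee_fin => j0; rewrite poweR_EFin -!EFinM lee_fin mulrA divfK ?gt_eqF ?powR_gt0//.
rewrite -powRM ?(ltW D0)//.
have -> : (b - a)%:R `^ r^-1 * y = ((b - a)%:R * y `^ r) `^ r^-1.
  by rewrite powRM ?powR_ge0// powRK ?gt_eqF.
apply: le_powR; rewrite ?invr_ge0 ?(ltW r0) ?mulr_ge0 ?powR_ge0//.
have := @sum_Iq_le R s grp lo hi al s_lt grpP al_gt0 lac p p1 r _ b r1 (fun n => step_ge0 a b n c0).
rewrite -/J JE => h.
have : ((\sum_(k < b) if (a <= k)%N then y `^ r / r else 0)%:E <= ((1 - 2 `^ (- (r / p)))^-1 * j)%:E)%E.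
  rewrite EFinM; apply: le_trans h; rewrite -sumEFin; apply: lee_sum => k _.
  rewrite (_ : dK k _ = fun t => Mk s grp al k * (t < if (a <= k < b)%N then c k else 0)%R%:R); last first.
    by apply/funext => t; exact: dk_step.
  rewrite Iq_indic ?(ltW (Mk0 _))//; last by case: ifP.
  rewrite lee_fin ltn_ord andbT; case: ifP => ak; last first.
    by rewrite powR0 ?mul0r ?mulr0// gt_eqF.
  rewrite mulrA ler_wpM2r ?invr_ge0 ?(ltW r0)//.
  have ck : y <= w k * al k * c k by apply: cy; rewrite ak ltn_ord.
  apply: (le_trans (le_powR (ltW r0) y0 ck)).
  have wk : 0 <= w k * al k by rewrite mulr_ge0// ltW.
  rewrite powRM// ler_wpM2r ?powR_ge0//.
  have rp : 0 <= r / p by rewrite divr_ge0 ?(ltW r0) ?(ltW p0).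
  have := le_powR rp (powR_ge0 _ _) (Mk_ge k); rewrite -powRrM (_ : p * (r / p) = r)//.
  by rewrite mulrC divfK// gt_eqF.
rewrite lee_fin -big_mkcond/= -(big_mkord (fun i => (a <= i)%N) (fun=> y `^ r / r)).
rewrite (big_cat_nat (n := a)) ?(ltnW ab)//= [X in X + _]big_nat_cond big_pred0; last first.
  by move=> i; case: (ltnP i a) => //; rewrite ?andbF.
rewrite add0r [X in X <= _]big_nat_cond (eq_bigl (fun i => (a <= i < b)%N)); last first.
  by move=> i; case: (leqP a i); rewrite ?andbT ?andbF.
rewrite -big_nat sumr_const_nat -[_ *+ (b - a)]mulr_natr => {}h.
have -> : (b - a)%:R * y `^ r = r * (y `^ r / r * (b - a)%:R) by field; rewrite gt_eqF.
by rewrite /D [X in _ <= X]mulrAC [X in _ <= X]mulrC ler_wpM2l// ltW.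
Qed.

(** The test function 1/al on the lower groups gives each lower point integral 1 and has quasinorm
    of order n1^(1/q). Every point of an upper group [k] sees [n1] such points, so the maximal
    function is at least n1/(2 al k) there, of quasinorm (b - a)^(1/r) w n1 up to a constant. *)
Theorem lower (q r : \bar R) : (1 <= q)%E -> (1 <= r)%E -> (mconst p q r X < +oo)%E ->
  exists2 K, 0 <= K & forall a b, (a < b)%N -> (lo a < hi a)%N ->
    (forall k, (a <= k < b)%N -> [/\ lo k = lo a, hi k = hi a & w k = w a]) ->
    (forall i, (lo a <= i < hi a)%N -> w i = 1) ->
  (b - a)%:R `^ einv r * omega lo hi w (einv q) a <= K.
Proof.
move=> q1 r1 fin.
have [_ [c [c0 cP] <-] _] := ereal_inf_lt fin.
have [Cq Cq0 HCq] := step_norm_le q1; have [Cr Cr0 HCr] := step_norm_ge r1.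
exists (2 * (Cr * (c * Cq))); first by rewrite mulr_ge0 ?mulr_ge0// ltW.
move=> a b ab lohi cst wlow; set n1 := (hi a - lo a)%N.
have n10 : 0 < n1%:R :> R by rewrite ltr0n subn_gt0.
pose f := step (fun i => (al i)^-1) (lo a) (hi a).
have ai0 k : 0 <= (al k)^-1 by rewrite invr_ge0.
have f0 n : 0 <= f n by exact: step_ge0.
have fq : (lorentz (Z := X) p q (EFin \o f) <= (Cq * n1%:R `^ einv q)%:E)%E.
  rewrite -[X in (_ <= X%:E)%E]mulr1; apply: HCq => // k kE.
  by rewrite wlow// mul1r divff// gt_eqF.
have fin_f : inLorentz (Z := X) p q f by split => //; apply: le_lt_trans fq _; rewrite ltry.
pose h := step (fun k => n1%:R / al k / 2) a b.
have hf n : ((h n)%:E <= `|maxc (Z := X) f n|)%E.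
  apply: le_trans (lee_abs _); apply: le_trans (maxc_ge_Tf n f0); rewrite lee_fin /h /step.
  case: ifP => [gn|_]; last first.
    by rewrite divr_ge0// sumr_ge0// => i _; rewrite mulr_ge0// divr_ge0.
  rewrite ler_wpM2r ?invr_ge0// /Tf; have [-> -> _] := cst _ gn.
  rewrite le_eqVlt; apply/orP; left; apply/eqP.
  rewrite [RHS]big_nat (eq_bigr (fun=> (al (grp n))^-1)) => [|i iE]; last first.
    by rewrite /f /step grp_nbr// iE mulrA mulVf ?mul1r// gt_eqF.
  by rewrite -big_nat sumr_const_nat -[_^-1 *+ _]mulr_natl.
have := HCr (fun k => n1%:R / al k / 2) a b (w a * n1%:R / 2) _ _ _ _ ab hf.
have nk k : 0 <= n1%:R / al k / 2 by rewrite !divr_ge0.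
have y0 : 0 <= w a * n1%:R / 2 by rewrite divr_ge0// mulr_ge0// ltW.
move=> /(_ nk _ y0) H.
have {}H : (((b - a)%:R `^ einv r * (w a * n1%:R / 2))%:E <= Cr%:E * lorentz (Z := X) p r (maxc (Z := X) f))%E.
  apply: H => k kab; have [_ _ ->] := cst _ kab.
  rewrite le_eqVlt; apply/orP; left; apply/eqP.
  by field; rewrite gt_eqF.
have {}H : (b - a)%:R `^ einv r * (w a * n1%:R / 2) <= Cr * (c * (Cq * n1%:R `^ einv q)).
  rewrite -lee_fin EFinM; apply: (le_trans H); rewrite EFinM.
  apply: lee_wpmul2l; first by rewrite lee_fin ltW.
  apply: (le_trans (cP _ fin_f)); rewrite EFinM; apply: lee_wpmul2l => //.
have -> : omega lo hi w (einv q) a = w a * n1%:R / n1%:R `^ einv q.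
  by rewrite /omega -/n1 gt0_powRD// powRr1 ?(ltW n10)// powRN mulrA.
rewrite mulrA ler_pdivrMr ?powR_gt0//.
by move: H; lra.
Qed.

Lemma Z_nondoubling : ~ doubling X.
Proof.
move=> [C HC].
have [j Cm] : exists j : nat, C < 2 * 4 ^+ j.+1.
  exists (Num.truncn `|C|); apply: le_lt_trans (ler_norm C) _.
  apply: (lt_le_trans (truncnS_gt _)).
  have h k : k.+1%:R <= 2 * 4 ^+ k.+1 :> R.
    rewrite -natrX -natrM ler_nat; apply: leq_trans (ltnW (ltn_expl _ (isT : (1 < 4)%N))) _.
    by rewrite leq_pmull.
  exact: h.
pose x := s j; have gx k : grp (s k) = k.
  by apply/eqP; rewrite eqn_leq -ltnS -ltn_sE s_lt leqNgt -ltn_sE ltnn.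
(* Between 2j + 2 and 2j + 3, so the ball stays in the groups up to j, while its double, of radius
   4j + 5, contains a point at distance at most 2j + 4 in group j + 1. *)
pose t : R := (2 * j + 2)%:R + 2^-1.
have t0 : 0 < t by rewrite addr_gt0 ?ltr0n ?addn2.
have BN y : rball (@mms_rho _ X) x t y -> (y < s j.+1)%N.
  rewrite ltn_sE /rball/= /rho /rhon; case: eqP => [<-|_]; first by rewrite gx.
  rewrite gx => h; have {h} : (2 * maxn j (grp y) + 1)%:R < (2 * j + 3)%:R :> R.
    have -> : (2 * j + 3)%:R = (2 * j + 2)%:R + 1 :> R by rewrite natr1 addnS.
    apply: (@le_lt_trans _ _ t); last by rewrite /t; move: (2 * j + 2)%:R => u; lra.
    by apply: le_trans (ltW h); rewrite ler_nat; case: ifP => _; clear; lia.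
  by rewrite ltr_nat; have := leq_maxr j (grp y); move: (maxn _ _) => M; clear; lia.
have := HC x t t0.
have -> : mms_mu X (rball (@mms_rho _ X) x t) =
    (\sum_(n < s j.+1 | (n : nat) \in rball (@mms_rho _ X) x t) al (grp n))%:E.
  exact: (mu_fin grp al_gt0 BN).
set M := \sum_(n < _ | _) _ => H.
have M0 : 0 < M.
  have xB : rball (@mms_rho _ X) x t x.
    by rewrite /rball/= (rho_eq0 _ _ _ _ x x).2.
  by rewrite /M (bigD1 (Ordinal (BN _ xB)))/= ?mem_set// ltr_wpDr// sumr_ge0.
have ML : 2 * 4 ^+ j.+1 * M <= al j.+1.
  apply: le_trans (lac j.+1); rewrite ler_wpM2l ?mulr_ge0 ?exprn_ge0//.
  by rewrite /M big_mkcond/=; apply: ler_sum => n _; case: ifP.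
have [N HN] := rball_bounded lo hi s_lt grpP x (2 * t).
have yB : rball (@mms_rho _ X) x (2 * t) (s j.+1).
  rewrite /rball/= /rho /rhon; case: eqP => [_|_]; first by rewrite mulr_gt0.
  rewrite !gx; apply: (@le_lt_trans _ _ (2 * j + 4)%:R).
    by rewrite ler_nat; case: ifP => _; clear; lia.
  by rewrite /t natrD natrM [(2 * j + 2)%:R]natrD natrM; have := ler0n R j; lra.
have : ((al j.+1)%:E <= mms_mu X (rball (@mms_rho _ X) x (2 * t)))%E.
  rewrite (_ : mms_mu X _ = mu grp al_gt0 (rball (@mms_rho _ X) x (2 * t)))// (mu_fin grp al_gt0 HN) lee_fin.
  by rewrite (bigD1 (Ordinal (HN _ yB)))/= ?mem_set// /m gx lerDl sumr_ge0.
move=> /le_trans/(_ H); rewrite -EFinM lee_fin => /(le_trans ML).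
by rewrite ler_pM2r// leNgt Cm.
Qed.

End Lower.

Lemma locate (f : nat -> nat) : f 0%N = 0%N -> (forall k, (f k < f k.+1)%N) ->
  exists g : nat -> nat, forall x, (f (g x) <= x < f (g x).+1)%N.
Proof.
move=> f0 fS; have [g gP] : {g : nat -> nat & forall x, (f (g x) <= x < f (g x).+1)%N}; last by exists g.
apply: (@choice _ _ (fun x y => (f y <= x < f y.+1)%N)) => x.
have fx : exists n, (x < f n)%N.
  exists x.+1; elim: x => [|x IH]; first by have := fS 0%N; rewrite f0.
  exact: leq_ltn_trans IH (fS _).
case: (ex_minnP fx) => -[|n] xn nmin; first by rewrite f0 ltn0 in xn.
exists n; rewrite xn andbT leqNgt; apply/negP => /nmin.
by rewrite ltnn.
Qed.

(** * Spaces with prescribed blocks *)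

Section Weights.
Context {R : realType}.
Variables (w : nat -> R) (p : R).
Hypothesis w_gt0 : forall k, 0 < w k.
Hypothesis p1 : 1 < p.

(** The second bound gives lacunarity over the previous mass [T]. The third makes [w^p a^(p - 1)] at
    least [m + 1], hence at least 1, and makes each group at least as large as every earlier one. *)
Let weight k (T : R) (m : nat) : R :=
  Num.max (Num.max 1 (2 * 4 ^+ k * T)) ((m.+1%:R / w k `^ p) `^ (p - 1)^-1).
(** The number of atoms of mass [a] whose total is [(w a)^p], rounded up to an integer. *)
Let len k (a : R) : nat := (Num.truncn (w k `^ p * a `^ (p - 1))).+1.

(* Total mass and number of points of the groups before [k]. *)
Fixpoint state k : R * nat := if k is k'.+1 then
  let: (T, m) := state k' in let a := weight k' T m in
  (T + a * (len k' a)%:R, (m + len k' a)%N) else (0, 0%N).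

Lemma exists_weights : exists (s grp : nat -> nat) (al : nat -> R),
  [/\ forall k, (s k < s k.+1)%N, forall x, (s (grp x) <= x < s (grp x).+1)%N &
      forall k, 0 < al k] /\
  [/\ forall k, 2 * 4 ^+ k * \sum_(x < s k) al (grp x) <= al k,
      forall k, (w k * al k) `^ p <= Mk s grp al k,
      forall k, Mk s grp al k <= 2 * (w k * al k) `^ p &
      forall i k, (i < k)%N -> (s i.+1 - s i <= s k.+1 - s k)%N].
Proof.
pose s k := (state k).2; pose T k := (state k).1.
pose al k := weight k (T k) (s k); pose L k := len k (al k).
have sS k : s k.+1 = (s k + L k)%N by rewrite /s /L /al /T /s /=; case: (state k).
have TS k : T k.+1 = T k + al k * (L k)%:R by rewrite /s /L /al /T /s /=; case: (state k).
have s_lt k : (s k < s k.+1)%N by rewrite sS -[X in (X < _)%N]addn0 ltn_add2l.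
have [grp grpP] := locate (erefl : s 0%N = 0%N) s_lt.
have al1 k : 1 <= al k by rewrite /al /weight !le_max lexx.
have al_gt0 k : 0 < al k by exact: lt_le_trans (al1 k).
have LE k : (s k.+1 - s k)%N = L k by rewrite sS addKn.
have TE k : \sum_(x < s k) al (grp x) = T k.
  rewrite (sum_grp s_lt grpP (fun n => al (grp n))); elim: k => [|k IH]; first by rewrite big_ord0.
  rewrite big_ord_recr/= IH TS; congr (_ + _).
  by rewrite -LE -(Mk_size al s_lt grpP); apply: eq_bigr => n /eqP ->.
have p10 : 0 < p - 1 by rewrite subr_gt0.
pose y k := w k `^ p * al k `^ (p - 1).
have yE k : al k * y k = (w k * al k) `^ p.
  rewrite powRM ?(ltW (w_gt0 _)) ?(ltW (al_gt0 _))// /y mulrCA; congr (_ * _).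
  by rewrite -{1}(powRr1 (ltW (al_gt0 k))) -gt0_powRD// addrC subrK.
have yS k : (s k).+1%:R <= y k.
  have wp : 0 < w k `^ p by exact: powR_gt0.
  rewrite /y mulrC -ler_pdivrMr//.
  have b0 : 0 <= (s k).+1%:R / w k `^ p by rewrite divr_ge0 ?powR_ge0.
  rewrite -[X in X <= _](@powRVK _ (p - 1)) ?gt_eqF//.
  by apply: le_powR; rewrite ?(ltW p10) ?powR_ge0// /al /weight le_max lexx orbT.
have y1 k : 1 <= y k by apply: le_trans (yS k); rewrite ler1n.
have Ly k : y k <= (L k)%:R by rewrite ltW// truncnS_gt.
(* Rounding adds at most 1, and [1 <= y k]; this is the factor 2 in the upper bound for [Mk]. *)
have Ly2 k : (L k)%:R <= 2 * y k.
  have yr : y k \is Num.real by exact: num_real.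
  have : (Num.truncn (y k))%:R <= y k by rewrite truncn_le// (le_trans ler01).
  by rewrite /L /len -/(y k) -natr1; have := y1 k; lra.
exists s, grp, al; split; split => //.
- by move=> k; rewrite TE /al /weight !le_max lexx !orbT.
- by move=> k; rewrite Mk_size// LE -yE ler_wpM2l// ltW.
- by move=> k; rewrite Mk_size// LE -yE mulrCA ler_wpM2l// ltW.
move=> i k ik; rewrite !LE -(ler_nat R); apply: le_trans (Ly k).
apply: le_trans (yS k); rewrite ler_nat.
have h : (s i.+1 <= s k)%N by exact: s_mono.
by apply: leqW; apply: leq_trans h; rewrite sS leq_addl.
Qed.

End Weights.

Lemma sum_interval_le {R : realType} (P : pred nat) (F : nat -> R) (c : R) N a b : 0 <= c ->
  (forall k, P k -> (a <= k < b)%N /\ F k = c) -> \sum_(k < N | P k) F k <= c * (b - a)%:R.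
Proof.
move=> c0 PF; rewrite mulr_natr -sumr_const_nat big_geq_mkord/=.
rewrite (@big_ord_widen_cond _ _ _ N (N + b) P F) ?leq_addr//.
rewrite (@big_ord_widen_cond _ _ _ b (N + b) (fun k => (a <= k)%N) (fun=> c)) ?leq_addl//.
rewrite big_mkcond [X in _ <= X]big_mkcond/=; apply: ler_sum => k _.
by case: ifP => [/andP[/PF[-> ->]]//|_]; case: ifP.
Qed.

Section Blocks.
Context {R : realType}.
Variables (n1 n2 : nat -> nat) (wt : nat -> R) (p : R).
Hypothesis n1_gt0 : forall n, (0 < n1 n)%N.
Hypothesis n2_gt0 : forall n, (0 < n2 n)%N.
Hypothesis wt_gt0 : forall n, 0 < wt n.
Hypothesis p1 : 1 < p.

Lemma exists_blocks : exists X : @mms R, ~ doubling X /\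
  forall q r : \bar R, (1 <= q)%E -> (1 <= r)%E ->
  ((mconst p q r X < +oo)%E -> exists K, forall n,
     (n2 n)%:R `^ einv r * (wt n * (n1 n)%:R `^ (1 - einv q)) <= K) /\
  (einv r <= einv q -> (exists K, forall n,
     (n2 n)%:R `^ einv r * (wt n * (n1 n)%:R `^ (1 - einv q)) <= K) ->
   (mconst p q r X < +oo)%E).
Proof.
(* Block [n] occupies the groups from [bs n] on: [n1 n] lower groups, followed by [n2 n] upper
   groups. *)
pose bs n := (\sum_(j < n) (n1 j + n2 j))%N.
have bsS n : bs n.+1 = (bs n + n1 n + n2 n)%N by rewrite /bs big_ord_recr/= addnA.
have bs0 : bs 0%N = 0%N by rewrite /bs big_ord0.
have bs_lt n : (bs n < bs n.+1)%N.
  by rewrite bsS -addnA -[X in (X < _)%N]addn0 ltn_add2l addn_gt0 n1_gt0.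
have [blk blkP] := locate bs0 bs_lt.
have blkE i n : (bs n <= i < bs n.+1)%N -> blk i = n.
  rewrite leqNgt !(ltn_s bs_lt blkP) -leqNgt ltnS => ni.
  by apply/eqP; rewrite eqn_leq andbC.
pose low_end k := (bs (blk k) + n1 (blk k))%N.
(* [Y] singles out the upper groups; a lower group gets an empty range of neighbours and the weight
   1. *)
pose Y k := (low_end k <= k)%N.
pose lo k := if Y k then bs (blk k) else 0%N.
pose hi k := if Y k then low_end k else 0%N.
pose w k := if Y k then wt (blk k) else 1.
have hi_le k : (hi k <= k)%N by rewrite /hi; case: ifP.
have w_gt0 k : 0 < w k by rewrite /w; case: ifP.
have lohi k i : (lo k <= i < hi k)%N -> [/\ Y k, blk i = blk k & w i = 1].
  rewrite /lo /hi; case: ifP => [Yk /andP[h1 h2]|_]; last by rewrite ltn0 andbF.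
  have bi : blk i = blk k by apply: blkE; rewrite h1 bsS (leq_trans h2)// leq_addr.
  by split=> //; rewrite /w /Y /low_end bi leqNgt h2.
have w_low k i : (lo k <= i < hi k)%N -> w i = 1 by case/lohi.
have [s [grp [al [[s_lt grpP al_gt0] [lac Mk_ge Mk_le size_lt]]]]] := exists_weights w_gt0 p1.
have size_low k i : (lo k <= i < hi k)%N -> (s i.+1 - s i <= s k.+1 - s k)%N.
  by move=> /andP[_ ih]; apply: size_lt; exact: leq_trans ih (hi_le k).
have YE n k : (bs n + n1 n <= k < bs n.+1)%N -> [/\ Y k, lo k = bs n, hi k = (bs n + n1 n)%N & w k = wt n].
  move=> /andP[h1 h2]; have bk : blk k = n by apply: blkE; rewrite h2 (leq_trans _ h1)// leq_addr.
  have Yk : Y k by rewrite /Y /low_end bk.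
  by rewrite /lo /hi /w Yk /low_end bk.
have omY u k : Y k -> omega lo hi w u k = wt (blk k) * (n1 (blk k))%:R `^ (1 - u).
  by move=> Yk; rewrite /omega /lo /hi /w Yk /low_end addKn.
exists (Z lo hi s_lt grpP al_gt0); split; first exact: Z_nondoubling.
move=> q r q1 r1; split.
  move=> /(lower lac hi_le w_gt0 p1 Mk_ge Mk_le q1 r1)[K K0 HK]; exists K => n.
  have bn : (bs n + n1 n <= bs n + n1 n < bs n.+1)%N.
    by rewrite leqnn bsS -[X in (X < _)%N]addn0 ltn_add2l n2_gt0.
  have [Yn loE hiE wE] := YE _ _ bn.
  have := HK (bs n + n1 n)%N (bs n.+1).
  rewrite loE hiE wE omY// (blkE _ n); last by rewrite leq_addr/= (andP bn).2.
  rewrite bsS addKn; apply.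
  - by case/andP: bn; rewrite bsS.
  - by rewrite -[X in (X < _)%N]addn0 ltn_add2l n1_gt0.
  - by move=> k; rewrite -bsS => /YE[].
  - by move=> i ih; apply: (w_low (bs n + n1 n)%N); rewrite loE hiE.
move=> rq [K HK].
have inK n : (n2 n)%:R `^ einv r * (wt n * (n1 n)%:R `^ (1 - einv q)) <= K by exact: HK.
have val0 n : 0 <= wt n * (n1 n)%:R `^ (1 - einv q) by rewrite mulr_ge0 ?powR_ge0// ltW.
have K0 : 0 <= K by apply: le_trans (HK 0%N); rewrite mulr_ge0 ?powR_ge0.
(* A lower group has no neighbours, but the convention [0 ^ 0 = 1] makes its [omega] equal to 1 when
   q = 1; hence the maximum with 1. *)
have supK : einv r = 0 -> forall k, omega lo hi w (einv q) k <= Num.max K 1.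
  move=> r0 k; case: (boolP (Y k)) => Yk.
    by rewrite omY// le_max; have := HK (blk k); rewrite r0 powRr0 mul1r => ->.
  rewrite /omega /lo /hi /w (negbTE Yk) mul1r subnn le_max.
  apply/orP; right; have [->|h] := eqVneq (1 - einv q) 0; first by rewrite powRr0.
  by rewrite powR0.
case: q q1 rq val0 HK inK supK => [q| |]// q1 rq val0 HK inK supK; last first.
  case: r r1 rq HK inK supK => [r| |]// r1 rq HK inK supK.
    have r0 : 0 < r by move: r1; rewrite lee_fin; exact: lt_le_trans.
    by move: rq; rewrite /einv leNgt invr_gt0 r0.
  exact: (upper_pinfty_pinfty s_lt grpP al_gt0 lac hi_le w_gt0 p1 Mk_ge Mk_le w_low size_low
    (supK erefl)).
rewrite lee_fin in q1; have q0 : 0 < q by exact: lt_le_trans q1.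
case: r r1 rq HK inK supK => [r| |]// r1 rq HK inK supK; last first.
  exact: (upper_finite_pinfty s_lt grpP al_gt0 lac hi_le w_gt0 p1 Mk_ge Mk_le w_low size_low q1
    (supK erefl)).
rewrite lee_fin in r1; have r0 : 0 < r by exact: lt_le_trans r1.
have qr : q <= r by move: rq; rewrite /einv lef_pV2.
apply: (upper_finite_finite (K := K `^ r) s_lt grpP al_gt0 lac hi_le w_gt0 p1 Mk_ge Mk_le w_low size_low q1 qr).
move=> N i; set n := blk i; set om := wt n * (n1 n)%:R `^ (1 - q^-1).
(* The groups above a given [i] are upper groups of its own block, [n2] in number with equal
   [omega], so their sum of r-th powers is at most the r-th power of the contribution of that
   block. *)
have PF k : (lo k <= i < hi k)%N ->
    (bs n + n1 n <= k < bs n.+1)%N /\ omega lo hi w q^-1 k `^ r = om `^ r.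
  move=> /lohi[Yk bi _]; have /andP[_ kb] := blkP k.
  rewrite (omY _ _ Yk) -bi; split; last reflexivity.
  by rewrite /n bi kb andbT; exact: Yk.
apply: (le_trans (sum_interval_le _ (powR_ge0 _ _) PF)).
rewrite bsS addKn; apply: le_trans (le_powR (ltW r0) _ (inK n)); last by rewrite mulr_ge0 ?powR_ge0.
rewrite powRM ?powR_ge0 ?val0// powRVK ?gt_eqF// mulrC.
exact: lexx.
Qed.

End Blocks.

Lemma einv_itv {R : realType} (q : \bar R) : (1 <= q)%E -> 0 <= einv q <= 1.
Proof.
case: q => [q| |]//; rewrite /einv ?lexx ?ler01// lee_fin => q1.
have q0 : 0 < q by exact: lt_le_trans q1.
by rewrite invr_ge0 (ltW q0) invf_le1.
Qed.

(** * Encoding a concave function by linear functionals *)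

Section Families.
Context {R : realType}.

(** An integer above e^x, and within a factor 2 of it when x >= 0 since then e^x >= 1. *)
Definition nexp (x : R) : nat := (Num.truncn (expR x)).+1.

Lemma nexp_powR_ge x v : 0 <= v -> expR (x * v) <= (nexp x)%:R `^ v.
Proof.
move=> v0; rewrite expRM; apply: le_powR; rewrite ?expR_ge0//.
by rewrite ltW// truncnS_gt.
Qed.

Lemma nexp_powR_le x v : 0 <= x -> 0 <= v <= 1 -> (nexp x)%:R `^ v <= 2 * expR (x * v).
Proof.
move=> x0 /andP[v0 v1]; rewrite expRM.
have n2 : (nexp x)%:R <= 2 * expR x.
  have : (Num.truncn (expR x))%:R <= expR x by rewrite truncn_le// expR_ge0.
  have : 1 <= expR x by have := expR_ge1Dx x; lra.
  by rewrite /nexp -natr1; lra.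
apply: (le_trans (le_powR v0 (ler0n _ _) n2)).
rewrite powRM ?expR_ge0// ler_wpM2r ?powR_ge0//.
by have := @ler_powR R 2 (ler1n _ 2) _ _ v1; rewrite powRr1.
Qed.

Theorem exists_family (I : countType) (a b c : I -> R) (p : R) : 1 < p ->
  (forall i, 0 <= a i) -> (forall i, 0 <= b i) ->
  exists X : @mms R, ~ doubling X /\
  forall q r : \bar R, (1 <= q)%E -> (1 <= r)%E ->
  ((mconst p q r X < +oo)%E -> exists M, forall i, a i * einv r - b i * einv q - c i <= M) /\
  (einv r <= einv q -> (exists M, forall i, a i * einv r - b i * einv q - c i <= M) ->
   (mconst p q r X < +oo)%E).
Proof.
move=> p1 a0 b0.
(* Numbers that encode no index yield the zero functional, which leaves boundedness unchanged. *)
pose get (f : I -> R) n := if unpickle n is Some i then f i else 0.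
have get0 f : (forall i, 0 <= f i) -> forall n, 0 <= get f n.
  by move=> f0 n; rewrite /get; case: unpickle.
pose n1 n := nexp (get b n); pose n2 n := nexp (get a n).
pose wt n := expR (- get b n - get c n).
have wt0 n : 0 < wt n by exact: expR_gt0.
have [X [nX HX]] := @exists_blocks R n1 n2 wt p (fun=> isT) (fun=> isT) wt0 p1.
exists X; split => // q r q1 r1.
have /andP[u0 u1] := einv_itv q1; have /andP[v0 v1] := einv_itv r1.
have [H1 H2] := HX q r q1 r1; split.
  move=> /H1[K HK]; exists K => i; have := HK (pickle i).
  rewrite /n1 /n2 /wt /get pickleK => h.
  (* [x <= 1 + x <= e^x] turns a bound on the exponentials into one on the functionals. *)
  apply: (@le_trans _ _ (expR (a i * einv r - b i * einv q - c i))).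
    by apply: le_trans (expR_ge1Dx _); rewrite lerDr.
  apply: le_trans h.
  have -> : a i * einv r - b i * einv q - c i =
    a i * einv r + (- b i - c i + b i * (1 - einv q)) by ring.
  rewrite !expRD; apply: ler_pM; rewrite ?mulr_ge0 ?expR_ge0//; first exact: nexp_powR_ge.
  by rewrite ler_wpM2l ?mulr_ge0 ?expR_ge0// nexp_powR_ge// subr_ge0.
move=> rq [M HM]; apply: (H2 rq); exists (4 * expR (Num.max M 0)) => n.
have a0n := get0 _ a0 n; have b0n := get0 _ b0 n.
have hM : get a n * einv r - get b n * einv q - get c n <= Num.max M 0.
  rewrite /get le_max; case: unpickle => [i|]; first by rewrite HM.
  by rewrite !mul0r !subr0 lexx orbT.
apply: (@le_trans _ _ (4 * expR (get a n * einv r - get b n * einv q - get c n))); last first.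
  by rewrite ler_wpM2l// ler_expR.
have -> : get a n * einv r - get b n * einv q - get c n =
  get a n * einv r + (- get b n - get c n + get b n * (1 - einv q)) by ring.
rewrite !expRD.
have h1 : (n2 n)%:R `^ einv r <= 2 * expR (get a n * einv r) by apply: nexp_powR_le; rewrite ?v0.
have h2 : (n1 n)%:R `^ (1 - einv q) <= 2 * expR (get b n * (1 - einv q)).
  by apply: nexp_powR_le => //; rewrite subr_ge0 u1/= gerBl.
have -> : 4 * (expR (get a n * einv r) * (expR (- get b n) * expR (- get c n) * expR (get b n * (1 - einv q)))) =
  (2 * expR (get a n * einv r)) * (expR (- get b n) * expR (- get c n) * (2 * expR (get b n * (1 - einv q)))).
  by ring.
apply: ler_pM; rewrite ?mulr_ge0 ?powR_ge0 ?expR_ge0//.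
by rewrite /wt expRD ler_wpM2l// mulr_ge0 ?expR_ge0.
Qed.

End Families.

Section Growth.
Context {R : realType}.

Lemma nat_unbounded (e M : R) : 0 < e -> exists2 N : nat, 1 <= N%:R :> R & M < N%:R * e.
Proof.
move=> e0; exists (Num.truncn (`|M| / e)).+1; first by rewrite ler1n.
by rewrite -ltr_pdivrMr//; apply: le_lt_trans (truncnS_gt _); rewrite ler_wpM2r ?invr_ge0 ?(ltW e0)// ler_norm.
Qed.

Lemma sqr_growth_le (e N : R) : 0 < e -> N - N ^+ 2 * e <= e^-1.
Proof.
move=> e0; rewrite -[X in _ <= X]mul1r ler_pdivlMr//.
by have := sqr_ge0 (N * e - 2^-1); nra.
Qed.

(** In the variable y = N d the claim reads y^2 (2 - y) <= 8. *)
Lemma cube_growth_le (d N : R) : 0 < d -> 0 <= N -> 2 * N ^+ 2 - N ^+ 3 * d <= 8 / d ^+ 2.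
Proof.
move=> d0 N0; rewrite ler_pdivlMr ?exprn_gt0//.
have -> : (2 * N ^+ 2 - N ^+ 3 * d) * d ^+ 2 = (N * d) ^+ 2 * (2 - N * d) by ring.
have : 0 <= N * d by rewrite mulr_ge0// ltW.
move: (N * d) => y y0; have [y2|y2] := leP y 2; last first.
  by apply: (@le_trans _ _ 0) => //; rewrite mulr_ge0_le0 ?sqr_ge0//; lra.
have y4 : y ^+ 2 <= 4 by nra.
by have := sqr_ge0 y; nra.
Qed.

(** Boundedness of [N^2 x] allows x = 0; the additional N excludes it. *)
Lemma sqr_growth (k : bool) (x M : R) : (forall N : nat, N%:R ^+ 2 * x + k%:R * N%:R <= M) ->
  if k then x < 0 else x <= 0.
Proof.
case: k => H; [rewrite ltNge|rewrite leNgt]; apply/negP => x0.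
  have [N N1 NM] := nat_unbounded M (@ltr01 R).
  have := H N; have := mulr_ge0 (sqr_ge0 (N%:R : R)) x0; rewrite mul1r; lra.
have [N N1 NM] := nat_unbounded M x0.
have := H N; rewrite mul0r addr0 expr2 => h.
have : N%:R * x <= N%:R * N%:R * x by rewrite ler_wpM2r ?(ltW x0)// ler_peMl.
lra.
Qed.

End Growth.

Section Concave.
Context {R : realType}.
Variables (b : bool) (delta : R) (F : R -> R).
Hypothesis delta1 : if b then delta <= 1 else delta < 1.
Local Notation D u := ((if b then delta <= u else delta < u) && (u <= 1)).
Hypothesis F01 : forall u, D u -> 0 <= F u <= 1.
Hypothesis Fconc : forall u v (l : R), D u -> D v -> 0 <= l <= 1 ->
  l * F u + (1 - l) * F v <= F (l * u + (1 - l) * v).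
Hypothesis Fmono : forall u v, D u -> D v -> u <= v -> F u <= F v.

Let D_between u : delta < u -> u <= 1 -> D u.
Proof. by move=> h1 h2; rewrite h2 andbT; case: b => //; exact: ltW. Qed.

Let D1 : D (1 : R). Proof. by rewrite lexx andbT; exact: delta1. Qed.

Lemma concave_slope x y z : D x -> D z -> x < y -> y < z ->
  (F z - F y) * (y - x) <= (F y - F x) * (z - y).
Proof.
move=> Dx Dz xy yz; have zx : 0 < z - x by lra.
pose l := (z - y) / (z - x).
have l01 : 0 <= l <= 1.
  apply/andP; split; first by apply: divr_ge0; lra.
  by rewrite /l ler_pdivrMr// mul1r; lra.
have := Fconc Dx Dz l01.
have -> : l * x + (1 - l) * z = y by rewrite /l; field; rewrite gt_eqF.
have -> : l * F x + (1 - l) * F z = ((z - y) * F x + (y - x) * F z) / (z - x).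
  by rewrite /l; field; rewrite gt_eqF.
rewrite ler_pdivrMr// => h; lra.
Qed.

(** The slope is the supremum of the chord slopes to the right of [x], bounded because chords to the
    left are steeper. Monotonicity makes it nonnegative, as required of the coefficient of u in a
    functional. *)
Lemma supergradient x : delta < x -> x < 1 ->
  exists2 al, 0 <= al & forall u, D u -> F u <= F x + al * (u - x).
Proof.
move=> dx x1; have Dx : D x by apply: D_between => //; exact: ltW.
pose S := [set (F u - F x) / (u - x) | u in [set u | x < u /\ u <= 1]].
have Du u : x < u -> u <= 1 -> D u by move=> xu u1; apply: D_between => //; exact: lt_trans xu.
have S1 : S ((F 1 - F x) / (1 - x)) by exists 1.
have Sub y : D y -> y < x -> ubound S ((F x - F y) / (x - y)).
  move=> Dy yx _ [u [xu u1] <-].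
  rewrite ler_pdivrMr ?subr_gt0// mulrAC ler_pdivlMr ?subr_gt0//.
  exact: (concave_slope Dy (Du _ xu u1) yx xu).
have hS : has_sup S.
  split; first by exists ((F 1 - F x) / (1 - x)).
  pose y := (delta + x) / 2; have y1 : delta < y by rewrite /y; lra.
  have y2 : y < x by rewrite /y; lra.
  have Dy : D y by apply: D_between => //; lra.
  by exists ((F x - F y) / (x - y)); exact: Sub.
exists (sup S).
  apply: le_trans _ (sup_upper_bound hS S1).
  by rewrite divr_ge0 ?subr_ge0 ?(ltW x1)// Fmono// ltW.
move=> u Du'; case: (ltgtP u x) => [ux|xu|->]; last by rewrite subrr mulr0 addr0.
  have : sup S <= (F x - F u) / (x - u).
    by apply: ge_sup; [exists ((F 1 - F x) / (1 - x))|exact: Sub].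
  rewrite ler_pdivlMr ?subr_gt0//; lra.
have u1 : u <= 1 by case/andP: Du'.
have Su : S ((F u - F x) / (u - x)) by exists u.
by have := sup_upper_bound hS Su; rewrite ler_pdivrMr ?subr_gt0//; lra.
Qed.

(* Touching lines at points tending to [u] from the left have values at [u] tending to [F u],
   since their slopes stay bounded. *)
Lemma touching_approx (g : R -> R) u e : delta < u -> u <= 1 -> 0 < e ->
  (forall x, delta < x -> x < 1 -> 0 <= g x /\ forall u, D u -> F u <= F x + g x * (u - x)) ->
  exists x : rat, delta < (ratr x : R) < 1 /\ F (ratr x) + g (ratr x) * (u - ratr x) <= F u + e.
Proof.
move=> du u1 e0 gP; pose y := (delta + u) / 2.
have [dy yu] : delta < y /\ y < u by rewrite /y; split; lra.
(* Beyond (y + u)/2 the slope satisfies g x (u - y) <= 2, as F varies by at most 1; beyond the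
   second bound u - x is small enough that g x (u - x) <= e. *)
pose z := Num.max ((y + u) / 2) (u - e * (u - y) / 2).
have zu : z < u.
  by rewrite /z gt_max; apply/andP; split; [lra|]; have := mulr_gt0 e0 (_ : 0 < u - y); rewrite subr_gt0 => /(_ yu); lra.
have [x] := rat_in_itvoo zu; rewrite in_itv/= => /andP[zx xu]; exists x; move: (ratr x : R) zx xu => {}x zx xu.
have [x1 x2] : (y + u) / 2 < x /\ u - e * (u - y) / 2 < x.
  by move: zx; rewrite /z gt_max => /andP[].
have dx : delta < x by lra.
have x11 : x < 1 by lra.
split; first by rewrite dx.
have Dx : D x by apply: D_between => //; exact: ltW.
have Dy : D y by apply: D_between => //; lra.
have Du : D u by exact: D_between.
have [g0 /(_ _ Dy) gy] := gP _ dx x11.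
have Fxu : F x <= F u by rewrite Fmono// ltW.
have /andP[Fy0 _] := F01 Dy; have /andP[_ Fx1] := F01 Dx.
have h1 : g x * (x - y) <= 1 by lra.
have h2 : g x * (u - y) <= 2.
  by have := ler_wpM2l g0 (_ : (u - y) / 2 <= x - y); move=> /(_ _)/=; lra.
have uy : 0 < u - y by lra.
suff : g x * (u - x) <= e by lra.
rewrite -(ler_pM2r uy).
have h3 : u - x <= e * (u - y) / 2 by lra.
have h4 := ler_wpM2l g0 h3.
by have := ler_wpM2r (ltW (mulr_gt0 e0 uy)) h2; nra.
Qed.

(** The index carries N and either a rational touching point or [None] for the left end. Tangents
    recover F on (delta, 1], but on a closed D the function may jump up at delta: there the lines
    through (delta, F delta) of slope N, multiplied by N^2, become vertical, pinning the value at
    delta and excluding u < delta. On an open D, [N - N^2 (u - delta)] is bounded exactly when u >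
    delta. *)
Theorem exists_functionals (k : bool) : exists A B C : nat * option rat -> R,
  (forall i, 0 <= A i) /\ (forall i, 0 <= B i) /\
  forall u v, 0 <= u <= 1 -> 0 <= v <= 1 ->
    ((exists M, forall i, A i * v - B i * u - C i <= M) <->
     D u /\ if k then v < F u else v <= F u).
Proof.
have [g gP] : {g : R -> R & forall x, delta < x -> x < 1 ->
    0 <= g x /\ forall u, D u -> F u <= F x + g x * (u - x)}.
  apply: (@choice _ _ (fun x y => delta < x -> x < 1 ->
    0 <= y /\ forall u, D u -> F u <= F x + y * (u - x))) => x.
  have [dx|_] := ltP delta x; last by exists 0.
  have [x1|_] := ltP x 1; last by exists 0.
  by have [y y0 yP] := supergradient dx x1; exists y.
pose inner (x : R) := delta < x < 1.
pose A (i : nat * option rat) : R := let: (N, o) := i in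
  if o is Some x then if inner (ratr x) then N%:R ^+ 2 else 0
  else if b then N%:R ^+ 2 else 0.
pose B (i : nat * option rat) : R := let: (N, o) := i in
  if o is Some x then if inner (ratr x) then N%:R ^+ 2 * g (ratr x) else 0
  else if b then N%:R ^+ 3 else N%:R ^+ 2.
pose C (i : nat * option rat) : R := let: (N, o) := i in
  if o is Some x then
    if inner (ratr x) then N%:R ^+ 2 * (F (ratr x) - g (ratr x) * ratr x) - k%:R * N%:R else 0
  else if b then N%:R ^+ 2 * F delta - k%:R * N%:R - N%:R ^+ 3 * delta
  else - N%:R - N%:R ^+ 2 * delta.
exists A, B, C; split; [|split].
- by case=> N [x|]/=; case: ifP => // _; exact: sqr_ge0.
- case=> N [x|]/=; case: ifP => // ix; rewrite ?sqr_ge0 ?exprn_ge0//.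
  by case/andP: ix => h1 h2; rewrite mulr_ge0 ?sqr_ge0//; case: (gP _ h1 h2).
move=> u v /andP[u0 u1] /andP[v0 v1].
have tanE N x : inner (ratr x) -> A (N, Some x) * v - B (N, Some x) * u - C (N, Some x) =
    N%:R ^+ 2 * (v - (F (ratr x) + g (ratr x) * (u - ratr x))) + k%:R * N%:R.
  by move=> ix; rewrite /A /B /C ix; ring.
have vertE N : b -> A (N, None) * v - B (N, None) * u - C (N, None) =
    N%:R ^+ 2 * (v - F delta) - N%:R ^+ 3 * (u - delta) + k%:R * N%:R.
  by move=> bT; rewrite /A /B /C bT; ring.
have vertNE N : ~~ b -> A (N, None) * v - B (N, None) * u - C (N, None) =
    N%:R - N%:R ^+ 2 * (u - delta).
  by move=> /negbTE bF; rewrite /A /B /C bF; ring.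
have kN (N : nat) : k%:R * N%:R <= N%:R :> R by rewrite ler_piMl// lern1 leq_b1.
split.
  move=> [M HM].
  have Du : D u.
    rewrite u1 andbT; case: ifP => bT.
      rewrite leNgt; apply/negP => ud.
      have Dd : D delta by rewrite bT lexx; move: delta1; rewrite bT.
      have /andP[_ Fd1] := F01 Dd.
      have d0 : 0 < delta - u by rewrite subr_gt0.
      (* Such an N outweighs [v - F delta], which is at least -1, and still exceeds [M]. *)
      have [N N1 NM] := nat_unbounded (`|M| + 2) d0.
      have := HM (N, None); rewrite vertE//.
      have -> : N%:R ^+ 2 * (v - F delta) - N%:R ^+ 3 * (u - delta) + k%:R * N%:R =
        N%:R ^+ 2 * (N%:R * (delta - u) + v - F delta) + k%:R * N%:R :> R by ring.
      have h1 : 1 <= N%:R ^+ 2 :> R by rewrite exprn_ege1.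
      have h2 : `|M| + 1 <= N%:R * (delta - u) + v - F delta by lra.
      have M0 := normr_ge0 M; have h3 : 0 <= `|M| + 1 by rewrite addr_ge0.
      have h4 := ler_pM ler01 h3 h1 h2; have k0 : 0 <= k%:R * N%:R :> R by rewrite mulr_ge0.
      have MM := ler_norm M; lra.
    rewrite ltNge; apply/negP => ud.
    have [N N1 NM] := nat_unbounded M (@ltr01 R).
    have := HM (N, None); rewrite vertNE ?bT//.
    have ud' : 0 <= delta - u by rewrite subr_ge0.
    by have := mulr_ge0 (sqr_ge0 (N%:R : R)) ud'; lra.
  split => //.
  have H (N : nat) : N%:R ^+ 2 * (v - F u) + k%:R * N%:R <= M.
    have [ud|ud] := leP u delta.
      have [bT ue] : b /\ u = delta.
        by case/andP: Du; case: ifP => [_ h|_ h] _; [split=> //; apply/le_anti; rewrite ud|move: h; rewrite ltNge ud].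
      by have := HM (N, None); rewrite vertE// -ue subrr mulr0 subr0.
    apply/ler_addgt0Pr => e e0.
    (* N is fixed here, so the touching line can be taken within e/(N^2 + 1) of F u; after
       multiplication by N^2 the error stays below e. *)
    have n0 : 0 < N%:R ^+ 2 + 1 :> R by rewrite ltr_wpDl// sqr_ge0.
    have [x [ix hx]] := touching_approx ud u1 (divr_gt0 e0 n0) gP.
    have := HM (N, Some x); rewrite tanE//.
    have h1 : v - (F u + e / (N%:R ^+ 2 + 1)) <= v - (F (ratr x) + g (ratr x) * (u - ratr x)) by lra.
    have h2 := ler_wpM2l (sqr_ge0 (N%:R : R)) h1.
    have h3 : N%:R ^+ 2 * (e / (N%:R ^+ 2 + 1)) <= e.
      by rewrite mulrCA ler_piMr ?(ltW e0)// ler_pdivrMr// mul1r lerDl.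
    lra.
  by have := sqr_growth H; have [_|_] := boolP k; lra.
move=> [Du vF]; pose E := F u - v; pose d := u - delta.
have Q (N : nat) : N%:R ^+ 2 * (v - F u) + k%:R * N%:R <= `|E^-1|.
  have N0 := sqr_ge0 (N%:R : R); move: vF; have [_|_] := boolP k => vF.
    have E0 : 0 < E by rewrite subr_gt0.
    apply: le_trans (ler_norm _); apply: le_trans (sqr_growth_le N%:R E0).
    by rewrite /E/= mul1r; lra.
  rewrite mul0r addr0; apply: le_trans (normr_ge0 _).
  by rewrite mulr_ge0_le0// subr_le0.
(* The terms bound the tangents, the closed left end and the open left end. Inverses of 0 are 0, so
   the formula also covers v = F u and u = delta. *)
exists (`|E^-1| + 8 / d ^+ 2 + `|d^-1|).
have p1 : 0 <= `|E^-1| by []. have p2 : 0 <= 8 / d ^+ 2 by rewrite divr_ge0 ?sqr_ge0.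
have p3 : 0 <= `|d^-1| by [].
case=> N [x|].
  have [ix|ix] := boolP (inner (ratr x)); last first.
    by rewrite /A /B /C (negbTE ix) !mul0r !subr0; lra.
  rewrite tanE//; case/andP: ix => dx x1.
  have [_ /(_ _ Du) h] := gP _ dx x1.
  have h1 : v - (F (ratr x) + g (ratr x) * (u - ratr x)) <= v - F u by lra.
  by have := ler_wpM2l (sqr_ge0 (N%:R : R)) h1; have := Q N; lra.
have [bT|bF] := boolP b; last first.
  rewrite vertNE//; have d0 : 0 < d by move: Du; rewrite (negbTE bF) subr_gt0 => /andP[].
  by have := sqr_growth_le N%:R d0; rewrite -/d; have := ler_norm d^-1; lra.
rewrite vertE//; have [ud|ud] := leP u delta.
  have ue : u = delta by apply/le_anti; rewrite ud; case/andP: Du; rewrite bT.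
  by rewrite -ue subrr mulr0 subr0; have := Q N; lra.
have d0 : 0 < d by rewrite subr_gt0.
have Dd : D delta by rewrite bT lexx; move: delta1; rewrite bT.
have /andP[Fd0 _] := F01 Dd.
(* Since N <= N^2, the two terms other than the cubic one add up to at most 2 N^2, the form required
   by [cube_growth_le]. *)
have NN : N%:R <= N%:R ^+ 2 :> R by rewrite -natrX ler_nat -mulnn; case: (N) => // n; exact: leq_pmulr.
have h1 : v - F delta <= 1 by lra.
have := ler_wpM2l (sqr_ge0 (N%:R : R)) h1; have := kN N.
by have := cube_growth_le d0 (ler0n R N); rewrite -/d; lra.
Qed.

End Concave.

Unset Implicit Arguments.

(* b = true : D = [delta, 1] with delta in [0,1];
   b = false : D = (delta, 1] with delta in [0,1). *)
Theorem theorem4p4p2 (R : realType) (p : R) (hp : 1 < p)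
  (b : bool) (delta : R) (hdelta0 : 0 <= delta)
  (hdelta1 : if b then delta <= 1 else delta < 1)
  (F : R -> R) :
  let D : set R := if b then `[delta, 1]%classic else `]delta, 1]%classic in
  (forall u, D u -> 0 <= F u <= 1) ->
  (forall u v (l : R), D u -> D v -> 0 <= l <= 1 ->
     l * F u + (1 - l) * F v <= F (l * u + (1 - l) * v)) ->
  (forall u v, D u -> D v -> u <= v -> F u <= F v) ->
  (forall u, D u -> F u <= u) ->
  (exists Z : @mms R, ~ doubling Z /\
     forall q r : \bar R, (1 <= q)%E -> (1 <= r)%E ->
       ((mconst p q r Z < +oo)%E <-> D (einv q) /\ einv r <= F (einv q))) /\
  (exists Z' : @mms R, ~ doubling Z' /\
     forall q r : \bar R, (1 <= q)%E -> (1 <= r)%E ->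
       ((mconst p q r Z' < +oo)%E <-> D (einv q) /\ einv r < F (einv q))).
Proof.
move=> D F01 Fconc Fmono Fu.
have DE u : D u <-> (if b then delta <= u else delta < u) && (u <= 1).
  by rewrite /D; case: (b); rewrite /= in_itv/=.
have F01' u : (if b then delta <= u else delta < u) && (u <= 1) -> 0 <= F u <= 1.
  by move/DE; exact: F01.
have Fconc' u v (l : R) : (if b then delta <= u else delta < u) && (u <= 1) ->
    (if b then delta <= v else delta < v) && (v <= 1) -> 0 <= l <= 1 ->
    l * F u + (1 - l) * F v <= F (l * u + (1 - l) * v).
  by move=> /DE Du /DE Dv; exact: Fconc.
have Fmono' u v : (if b then delta <= u else delta < u) && (u <= 1) ->
    (if b then delta <= v else delta < v) && (v <= 1) -> u <= v -> F u <= F v.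
  by move=> /DE Du /DE Dv; exact: Fmono.
have main (k : bool) : exists Z : @mms R, ~ doubling Z /\
    forall q r : \bar R, (1 <= q)%E -> (1 <= r)%E ->
      ((mconst p q r Z < +oo)%E <->
       D (einv q) /\ if k then einv r < F (einv q) else einv r <= F (einv q)).
  have [A [B [C [A0 [B0 HABC]]]]] := exists_functionals hdelta1 F01' Fconc' Fmono' k.
  have [Z [nZ HZ]] := exists_family C hp A0 B0; exists Z; split => // q r q1 r1.
  have [H1 H2] := HZ q r q1 r1.
  have H3 := HABC _ _ (einv_itv q1) (einv_itv r1).
  split.
    by move=> /H1 /H3[/DE Dq h].
  move=> [Dq h]; apply: H2; last by apply/H3; split => //; apply/DE.
  (* F(u) <= u yields 1/r <= 1/q, the range in which block bounds imply boundedness. *)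
  by apply: le_trans (Fu _ Dq); move: h; case: k {HABC H3} => // /ltW.
by split; [exact: (main false)|exact: (main true)].
Qed.
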